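(* For $k\in(0,\pi)$ let $\eta^+,\eta^-$ be the alignable V-nets of the second kind on $\Omega^k$ with fundamental forms $$I_{\eta^\pm}=q_\pm^4\left(\tfrac1{u^2}\mathrm{d}u^2\pm2\tfrac{\cos\omega_k}{uv}\,\mathrm{d}u\,\mathrm{d}v+\tfrac1{v^2}\mathrm{d}v^2\right),\qquad II_{\eta^+}=2\cot\!\left(\tfrac{\omega_k}2\right)\left(\tfrac{1}{u}\mathrm{d}u^2+\tfrac{1}{v}\mathrm{d}v^2\right),\quad II_{\eta^-}=2\tan\!\left(\tfrac{\omega_k}2\right)\left(\tfrac{1}{u}\mathrm{d}u^2-\tfrac{1}{v}\mathrm{d}v^2\right),$$ where $q_+=\csc(\omega_k/2)$, $q_-=\sec(\omega_k/2)$, and let $(\tilde u,\tilde v)=(2\sqrt u,2\sqrt v)$, with $\tilde\omega_k$ denoting $\omega_k$ expressed in $(\tilde u,\tilde v)$. Then in the coordinates $(\tilde u,\tilde v)$ $$I_{\eta^+}=4\csc^4\!\left(\tfrac{\tilde\omega_k}2\right)\left(\tfrac{1}{\tilde u^2}\mathrm{d}\tilde u^2+\tfrac{2}{\tilde u\tilde v}\cos\tilde\omega_k\,\mathrm{d}\tilde u\,\mathrm{d}\tilde v+\tfrac1{\tilde v^2}\mathrm{d}\tilde v^2\right),\qquad II_{\eta^+}=2\cot\!\left(\tfrac{\tilde\omega_k}2\right)\left(\mathrm{d}\tilde u^2+\mathrm{d}\tilde v^2\right),$$ $$I_{\eta^-}=4\sec^4\!\left(\tfrac{\tilde\omega_k}2\right)\left(\tfrac{1}{\tilde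 u^2}\mathrm{d}\tilde u^2-\tfrac{2}{\tilde u\tilde v}\cos\tilde\omega_k\,\mathrm{d}\tilde u\,\mathrm{d}\tilde v+\tfrac1{\tilde v^2}\mathrm{d}\tilde v^2\right),\qquad II_{\eta^-}=2\tan\!\left(\tfrac{\tilde\omega_k}2\right)\left(\mathrm{d}\tilde u^2-\mathrm{d}\tilde v^2\right),$$ with Gaussian and mean curvatures $$\mathrm{K}^+=\left(\tfrac{\tilde u\tilde v}{4}\right)^2\sin^4\!\left(\tfrac{\tilde\omega_k}2\right),\quad \mathrm{K}^-=-\left(\tfrac{\tilde u\tilde v}{4}\right)^2\cos^4\!\left(\tfrac{\tilde\omega_k}2\right),\quad \mathrm{H}^+=\tfrac{\tilde u^2+\tilde v^2}{16}\tan\!\left(\tfrac{\tilde\omega_k}2\right),\quad \mathrm{H}^-=\tfrac{\tilde u^2-\tilde v^2}{16}\cot\!\left(\tfrac{\tilde\omega_k}2\right).$$ Thus $\eta^\pm$ are isothermal-conjugate V-nets which are neither minimal nor rotation fields of pseudospherical surfaces of revolution. In particular, Eisenhart's assertion that minimal surfaces and certain rotation fields of pseudospherical surfaces of revolution are the only Voss surfaces with an isothermal-conjugate system of geodesic lines is false.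
   Context: A V-net is a non-developable immersion $\eta(u,v)$ that is a conjugate net ($\eta_{uv}\in\mathrm{span}\{\eta_u,\eta_v\}$) whose coordinate lines are geodesics; a Voss surface (V-surface) is a surface supporting a V-net. A conjugate net with second fundamental form $L\,\mathrm{d}u^2+N\,\mathrm{d}v^2$ is isothermal-conjugate if $L=\pm N$. $\eta$ is a rotation field of $\psi$ if $\mathrm{d}\xi=\eta\times\mathrm{d}\psi$ for some map $\xi$ to $\mathbb{R}^3$. Eisenhart's ''associate'' surfaces of a surface are its rotation fields. A pseudospherical surface has constant Gaussian curvature $-1$. $\omega_k(u,v)=W_k(\sqrt{4uv})$, where $W_k$ solves $W_{rr}+r^{-1}W_r-\sin W=0$, $W(0)=k$, $W_r(0)=0$; hence $\tilde\omega_k=W_k(\tilde u\tilde v/2)$. $\Omega^k=\{u,v>0,\ 4uv<r_1^2\}$ with $r_1>0$ the first value where $W_k(r_1)=\pi$. The V-nets $\eta^\pm$ are rotation fields of the Amsler K-surface (pseudospherical surface containing two straight asymptotic lines meeting at angle $k$) with asymptotic angle function $\omega_k$. They are alignable: for loops $ABCD$ of net lines the signed lengths satisfy $l_{AB}+l_{BC}=l_{AD}+l_{DC}$ (with one coordinate direction reversed for $\eta^-$). *)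

(* Defs.v *)
From Stdlib Require Import Reals.
From Coquelicot Require Import Coquelicot.
Open Scope R_scope.

Definition csc (x : R) : R := / sin x.
Definition sec (x : R) : R := / cos x.
Definition cot (x : R) : R := cos x / sin x.

(** * Vectors of R^3 *)

Definition V3 : Type := (R * R * R)%type.
Definition c1 (a : V3) : R := fst (fst a).
Definition c2 (a : V3) : R := snd (fst a).
Definition c3 (a : V3) : R := snd a.

Definition vadd (a b : V3) : V3 := (c1 a + c1 b, c2 a + c2 b, c3 a + c3 b).
Definition vscal (t : R) (a : V3) : V3 := (t * c1 a, t * c2 a, t * c3 a).
Definition dot (a b : V3) : R := c1 a * c1 b + c2 a * c2 b + c3 a * c3 b.
Definition norm3 (a : V3) : R := sqrt (dot a a).
Definition cross (a b : V3) : V3 :=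
  (c2 a * c3 b - c3 a * c2 b,
   c3 a * c1 b - c1 a * c3 b,
   c1 a * c2 b - c2 a * c1 b).

(** * Differentiation in two variables

    Functions are total on R^2.  They are only constrained, and only
    differentiated, at points of an open set [D]. *)

Definition pu (f : R -> R -> R) (u v : R) : R := Derive (fun t => f t v) u.
Definition pv (f : R -> R -> R) (u v : R) : R := Derive (fun t => f u t) v.

Definition du (f : R -> R -> V3) (u v : R) : V3 :=
  (pu (fun s t => c1 (f s t)) u v,
   pu (fun s t => c2 (f s t)) u v,
   pu (fun s t => c3 (f s t)) u v).
Definition dv (f : R -> R -> V3) (u v : R) : V3 :=
  (pv (fun s t => c1 (f s t)) u v,
   pv (fun s t => c2 (f s t)) u v,
   pv (fun s t => c3 (f s t)) u v).

Definition open_domain (D : R -> R -> Prop) : Prop :=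
  (exists u v, D u v) /\ (forall u v, D u v -> locally_2d D u v).

Fixpoint Ck (n : nat) (D : R -> R -> Prop) (f : R -> R -> R) : Prop :=
  (forall u v, D u v -> continuity_2d_pt f u v) /\
  match n with
  | O => True
  | S m =>
      (forall u v, D u v ->
         ex_derive (fun t => f t v) u /\ ex_derive (fun t => f u t) v) /\
      Ck m D (pu f) /\ Ck m D (pv f)
  end.

Definition smooth (D : R -> R -> Prop) (f : R -> R -> R) : Prop :=
  forall n, Ck n D f.

Definition smooth3 (D : R -> R -> Prop) (f : R -> R -> V3) : Prop :=
  smooth D (fun u v => c1 (f u v)) /\
  smooth D (fun u v => c2 (f u v)) /\
  smooth D (fun u v => c3 (f u v)).

(** * Surfaces in R^3 *)

Definition immersion (D : R -> R -> Prop) (eta : R -> R -> V3) : Prop :=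
  open_domain D /\ smooth3 D eta /\
  forall u v, D u v -> cross (du eta u v) (dv eta u v) <> (0, 0, 0).

(** The orientation used for second fundamental forms and mean curvatures. *)
Definition normal (eta : R -> R -> V3) (u v : R) : V3 :=
  let w := cross (du eta u v) (dv eta u v) in vscal (/ norm3 w) w.

Definition fE (eta : R -> R -> V3) (u v : R) := dot (du eta u v) (du eta u v).
Definition fF (eta : R -> R -> V3) (u v : R) := dot (du eta u v) (dv eta u v).
Definition fG (eta : R -> R -> V3) (u v : R) := dot (dv eta u v) (dv eta u v).
Definition fL (eta : R -> R -> V3) (u v : R) := dot (du (du eta) u v) (normal eta u v).
Definition fM (eta : R -> R -> V3) (u v : R) := dot (dv (du eta) u v) (normal eta u v).
Definition fN (eta : R -> R -> V3) (u v : R) := dot (dv (dv eta) u v) (normal eta u v).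

(** Values of the two fundamental forms at [(u, v)] on the tangent vector with
    coordinates [(a, b)]. *)
Definition I_form (eta : R -> R -> V3) (u v a b : R) : R :=
  fE eta u v * a ^ 2 + 2 * fF eta u v * a * b + fG eta u v * b ^ 2.
Definition II_form (eta : R -> R -> V3) (u v a b : R) : R :=
  fL eta u v * a ^ 2 + 2 * fM eta u v * a * b + fN eta u v * b ^ 2.

Definition gauss_curv (eta : R -> R -> V3) (u v : R) : R :=
  (fL eta u v * fN eta u v - fM eta u v ^ 2) /
  (fE eta u v * fG eta u v - fF eta u v ^ 2).

Definition mean_curv (eta : R -> R -> V3) (u v : R) : R :=
  (fE eta u v * fN eta u v - 2 * fF eta u v * fM eta u v + fG eta u v * fL eta u v) /
  (2 * (fE eta u v * fG eta u v - fF eta u v ^ 2)).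

Definition minimal (D : R -> R -> Prop) (eta : R -> R -> V3) : Prop :=
  forall u v, D u v -> mean_curv eta u v = 0.

(** * V-nets *)

Definition conjugate_net (D : R -> R -> Prop) (eta : R -> R -> V3) : Prop :=
  forall u v, D u v ->
    exists a b, dv (du eta) u v = vadd (vscal a (du eta u v)) (vscal b (dv eta u v)).

(** Geodesic curvature of a curve with velocity [x] and acceleration [y] on a
    surface with unit normal [n]; the curve need not have unit speed. *)
Definition geodesic_curv (n x y : V3) : R := dot n (cross x y) / norm3 x ^ 3.

Definition geodesic_coordinate_lines (D : R -> R -> Prop) (eta : R -> R -> V3) : Prop :=
  forall u v, D u v ->
    geodesic_curv (normal eta u v) (du eta u v) (du (du eta) u v) = 0 /\
    geodesic_curv (normal eta u v) (dv eta u v) (dv (dv eta) u v) = 0.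

(** Non-developable is understood pointwise: K has no zero. *)
Definition V_net (D : R -> R -> Prop) (eta : R -> R -> V3) : Prop :=
  immersion D eta /\
  (forall u v, D u v -> gauss_curv eta u v <> 0) /\
  conjugate_net D eta /\
  geodesic_coordinate_lines D eta.

Definition isothermal_conjugate (D : R -> R -> Prop) (eta : R -> R -> V3) : Prop :=
  conjugate_net D eta /\
  ((forall u v, D u v -> fL eta u v = fN eta u v) \/
   (forall u v, D u v -> fL eta u v = - fN eta u v)).

(** For a loop A = (u1,v1), B = (u2,v1), C = (u2,v2), D = (u1,v2) of net lines:
    l_AB + l_BC = l_AD + l_DC.  Lengths along the u-lines are counted positively
    for increasing u; [eps] is the orientation given to the v-lines. *)
Definition alignable (D : R -> R -> Prop) (eta : R -> R -> V3) : Prop :=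
  exists eps, (eps = 1 \/ eps = -1) /\
  forall u1 u2 v1 v2,
    (forall u, Rmin u1 u2 <= u <= Rmax u1 u2 -> D u v1 /\ D u v2) ->
    (forall v, Rmin v1 v2 <= v <= Rmax v1 v2 -> D u1 v /\ D u2 v) ->
    RInt (fun u => norm3 (du eta u v1)) u1 u2
    + eps * RInt (fun v => norm3 (dv eta u2 v)) v1 v2
    = eps * RInt (fun v => norm3 (dv eta u1 v)) v1 v2
      + RInt (fun u => norm3 (du eta u v2)) u1 u2.

(** * Rotation fields and pseudospherical surfaces *)

(** d xi = eta x d psi *)
Definition rotation_field (D : R -> R -> Prop) (eta psi : R -> R -> V3) : Prop :=
  exists xi : R -> R -> V3, smooth3 D xi /\
  forall u v, D u v ->
    du xi u v = cross (eta u v) (du psi u v) /\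
    dv xi u v = cross (eta u v) (dv psi u v).

Definition pseudospherical (D : R -> R -> Prop) (psi : R -> R -> V3) : Prop :=
  immersion D psi /\ forall u v, D u v -> gauss_curv psi u v = -1.

Definition orthonormal (a b c : V3) : Prop :=
  dot a a = 1 /\ dot b b = 1 /\ dot c c = 1 /\
  dot a b = 0 /\ dot a c = 0 /\ dot b c = 0.

(** Up to the change of parameters [(s, th)], [psi] is obtained by rotating the
    profile curve [(f, g)] about the line through [p] directed by [e3]. *)
Definition of_revolution (D : R -> R -> Prop) (psi : R -> R -> V3) : Prop :=
  exists (p e1 e2 e3 : V3) (I : R -> Prop) (f g : R -> R) (s th : R -> R -> R),
    orthonormal e1 e2 e3 /\
    open I /\
    (forall x, I x -> forall n, ex_derive_n f n x /\ ex_derive_n g n x) /\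
    smooth D s /\ smooth D th /\
    forall u v, D u v ->
      I (s u v) /\
      psi u v =
        vadd p
          (vadd (vscal (f (s u v)) (vadd (vscal (cos (th u v)) e1)
                                         (vscal (sin (th u v)) e2)))
                (vscal (g (s u v)) e3)).

Definition rotation_field_of_pseudospherical_revolution
    (D : R -> R -> Prop) (eta : R -> R -> V3) : Prop :=
  exists psi, pseudospherical D psi /\ of_revolution D psi /\ rotation_field D eta psi.

(** The V-net is a parametrization of the Voss surface by its isothermal-conjugate
    geodesic lines.  The assertion is given in a weak, local form, implied by
    any other reading: some piece of the surface is minimal or a rotation field
    of some pseudospherical surface of revolution.  Allowing all rotation fields
    instead of "certain" ones weakens it further, and passing to a piece
    excludes counterexamples due to the topology of [D] or to gluing. *)
Definition Eisenhart_assertion : Prop :=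
  forall (D : R -> R -> Prop) (eta : R -> R -> V3),
    V_net D eta -> isothermal_conjugate D eta ->
    exists U : R -> R -> Prop,
      open_domain U /\ (forall u v, U u v -> D u v) /\
      (minimal U eta \/ rotation_field_of_pseudospherical_revolution U eta).

(** * The function W_k, the domain and the Amsler surface *)

(** Only the values on [0, +oo) matter.  The equation is invariant under
    r -> - r, so a solution on [0, +oo) with W_r(0) = 0 extends to an even
    function, and W_r(0) can be the two-sided derivative. *)
Definition solves_W (k : R) (W : R -> R) : Prop :=
  W 0 = k /\ is_derive W 0 0 /\
  forall r, 0 < r ->
    ex_derive W r /\ ex_derive (Derive W) r /\
    Derive (Derive W) r + / r * Derive W r - sin (W r) = 0.

Definition first_pi (W : R -> R) (r1 : R) : Prop :=
  0 < r1 /\ W r1 = PI /\ forall r, 0 < r < r1 -> W r <> PI.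

Definition omega (W : R -> R) (u v : R) : R := W (sqrt (4 * u * v)).

Definition Omega (r1 u v : R) : Prop := 0 < u /\ 0 < v /\ 4 * u * v < r1 ^ 2.

(** K-surface with asymptotic angle [omega W] in asymptotic arc-length
    coordinates, continued slightly across the axes so as to contain the two
    straight asymptotic lines u = 0 and v = 0, which meet at the angle k. *)
Definition Amsler_surface (k r1 : R) (W : R -> R) (psi : R -> R -> V3) : Prop :=
  exists D : R -> R -> Prop,
    (forall u v, 0 <= u -> 0 <= v -> 4 * u * v < r1 ^ 2 -> D u v) /\
    pseudospherical D psi /\
    (forall u v, D u v ->
       fL psi u v = 0 /\ fN psi u v = 0 /\ fE psi u v = 1 /\ fG psi u v = 1) /\
    (forall u v, Omega r1 u v -> fF psi u v = cos (omega W u v)) /\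
    exists p a b : V3,
      dot a b = cos k /\
      (forall u, 0 <= u -> psi u 0 = vadd p (vscal u a)) /\
      (forall v, 0 <= v -> psi 0 v = vadd p (vscal v b)).

(** * The coordinates (2 sqrt u, 2 sqrt v) *)

(** [tilde f] is [f] expressed in the new coordinates: the inverse change of
    coordinates is u = (ut / 2)^2, v = (vt / 2)^2. *)
Definition tilde {T : Type} (f : R -> R -> T) (ut vt : R) : T :=
  f ((ut / 2) ^ 2) ((vt / 2) ^ 2).

Lemma tildeE {T : Type} (f : R -> R -> T) (u v : R) :
  0 <= u -> 0 <= v -> tilde f (2 * sqrt u) (2 * sqrt v) = f u v.
Proof.
  intros hu hv. unfold tilde.
  replace (2 * sqrt u / 2) with (sqrt u) by field.
  replace (2 * sqrt v / 2) with (sqrt v) by field.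
  now rewrite !pow2_sqrt.
Qed.

(** Image of [D], a subset of u, v > 0, under the change of coordinates. *)
Definition tilde_dom (D : R -> R -> Prop) (ut vt : R) : Prop :=
  0 < ut /\ 0 < vt /\ tilde D ut vt.

(* Main.v *)
Require Import Defs.
From Stdlib Require Import Reals Lra Classical.
From Coquelicot Require Import Coquelicot.
(* Imported again because [Reals] shadows [c1]. *)
Require Import Defs.
Open Scope R_scope.

(** The forms and curvatures follow from the chain rule.  The point is that no piece of
    [etapt] or [etamt] is a rotation field of a pseudospherical surface [P] of revolution,
    even when [P] is allowed to have asymptotic lines other than the coordinate lines.

    The angle [theta] between the coordinate lines is a function of [x y], and with
    [K (x y) = cos (theta / 2) ^ 2] both nets have the same shape, up to a sign
    [eps] in [II = L (dx ^ 2 + eps dy ^ 2)].  Being a rotation field of [P] means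
    [P_x = a eta_x + b eta_y], [P_y = eps b eta_x - a eta_y], and [P] has curvature [-1]
    iff [a ^ 2 + eps b ^ 2] is the curvature of [eta].

    On an open set where [a <> 0], the integrability conditions say that, for [h = H (x y)]
    with [H z = 1 / (z K z)], the function [s = h b / a] satisfies [s_x = - eps h_y] and
    [s_y = h_x].  Hence [h_xx + eps h_yy = (y ^ 2 + eps x ^ 2) H'' (x y) = 0], so [H] is
    affine, and then the equation of [W] becomes a polynomial identity that fails.

    If [a] vanishes identically, the coordinate lines are asymptotic lines of [P].  Let
    [tau] be the Killing field of the rotations of [P] and [e] the direction of the axis.
    Up to the sign of [tau], the component [A] of [e + tau] along the first unit asymptotic
    direction and the component [B] of [e - tau] along the second one are constant, and
    [y ^ 2 A = x ^ 2 B] because [theta] depends on [x y] only.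
    So [A = B = 0], whence [e = 0], a contradiction. *)

(** * Calculus of vector-valued functions *)

(** The obstacle is that a V-net can be a rotation field of many surfaces: excluding the given
    Amsler surface would not exclude another pseudospherical one, so every admissible pair [(a, b)]
    has to be treated. The shape of [P_x], [P_y] comes from two symmetries. Equality of the mixed
    derivatives of [xi] gives [eta_y x P_x = eta_x x P_y], so [P_x], [P_y] are tangent to [eta] with
    opposite diagonal coefficients; the normal part of [P_xy = P_yx] then gives the factor [eps].
    The function [H] is an integrating factor: the tangential parts of [P_xy = P_yx] and the
    derivatives of [a ^ 2 + eps b ^ 2 = K_eta] combine into linear equations for [b / a] whose
    homogeneous parts have coefficients [- (log h)_x] and [- (log h)_y]. In the second case
    [(e, tau)] is an infinitesimal motion, and the two signs in [e + tau], [e - tau] reflect the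
    opposite torsions of the two families of asymptotic lines. Everything is local, and this is what
    permits the dichotomy: near a point with [a <> 0] the coefficient stays nonzero. *)

Lemma is_derive_eq (f : R -> R) (t l l' : R) :
  is_derive f t l -> l = l' -> is_derive f t l'.
Proof. intros h <-; exact h. Qed.

Lemma is_derive_mulR (f g : R -> R) (t a b : R) :
  is_derive f t a -> is_derive g t b ->
  is_derive (fun s => f s * g s) t (a * g t + f t * b).
Proof. intros hf hg. apply (is_derive_mult f g t a b hf hg). exact Rmult_comm. Qed.

Lemma is_derive_addR (f g : R -> R) (t a b : R) :
  is_derive f t a -> is_derive g t b -> is_derive (fun s => f s + g s) t (a + b).
Proof. intros hf hg. apply (is_derive_plus f g t a b hf hg). Qed.

Lemma is_derive_subR (f g : R -> R) (t a b : R) :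
  is_derive f t a -> is_derive g t b -> is_derive (fun s => f s - g s) t (a - b).
Proof. intros hf hg. apply (is_derive_minus f g t a b hf hg). Qed.

Lemma is_derive_unique_eq (f : R -> R) (t a b : R) :
  is_derive f t a -> is_derive f t b -> a = b.
Proof.
  intros ha hb. rewrite <- (is_derive_unique f t a ha). now apply is_derive_unique.
Qed.


Definition is_derive3 (f : R -> V3) (t : R) (w : V3) : Prop :=
  is_derive (fun s => c1 (f s)) t (c1 w) /\
  is_derive (fun s => c2 (f s)) t (c2 w) /\
  is_derive (fun s => c3 (f s)) t (c3 w).

Lemma V3_eq (a b : V3) : c1 a = c1 b -> c2 a = c2 b -> c3 a = c3 b -> a = b.
Proof. destruct a as [[? ?] ?], b as [[? ?] ?]; cbn; congruence. Qed.

Lemma is_derive3_ext_loc (f g : R -> V3) (t : R) (w : V3) :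
  locally t (fun s => f s = g s) -> is_derive3 f t w -> is_derive3 g t w.
Proof.
  intros hl [h1 [h2 h3]].
  split; [|split];
    (eapply is_derive_ext_loc; [|eassumption]);
    (apply filter_imp with (2 := hl); intros s ->; reflexivity).
Qed.

Lemma is_derive3_const (a : V3) (t : R) : is_derive3 (fun _ => a) t (0, 0, 0).
Proof. split; [|split]; exact (is_derive_const _ t). Qed.

Lemma is_derive3_vadd (f g : R -> V3) (t : R) (v w : V3) :
  is_derive3 f t v -> is_derive3 g t w ->
  is_derive3 (fun s => vadd (f s) (g s)) t (vadd v w).
Proof.
  intros [h1 [h2 h3]] [k1 [k2 k3]].
  split; [|split]; cbn; now apply is_derive_addR.
Qed.

Lemma is_derive3_vscal (a : R -> R) (f : R -> V3) (t da : R) (v : V3) :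
  is_derive a t da -> is_derive3 f t v ->
  is_derive3 (fun s => vscal (a s) (f s)) t (vadd (vscal da (f t)) (vscal (a t) v)).
Proof.
  intros ha [h1 [h2 h3]].
  split; [|split]; cbn; now apply is_derive_mulR.
Qed.

Lemma is_derive3_cross (f g : R -> V3) (t : R) (v w : V3) :
  is_derive3 f t v -> is_derive3 g t w ->
  is_derive3 (fun s => cross (f s) (g s)) t (vadd (cross v (g t)) (cross (f t) w)).
Proof.
  intros [h1 [h2 h3]] [k1 [k2 k3]].
  split; [|split]; cbn;
    (eapply is_derive_eq;
     [apply is_derive_subR; apply is_derive_mulR; eassumption | unfold cross, c1, c2, c3; cbn; ring]).
Qed.

Lemma is_derive_dot (f g : R -> V3) (t : R) (v w : V3) :
  is_derive3 f t v -> is_derive3 g t w ->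
  is_derive (fun s => dot (f s) (g s)) t (dot v (g t) + dot (f t) w).
Proof.
  intros [h1 [h2 h3]] [k1 [k2 k3]]. unfold dot.
  eapply is_derive_eq.
  - apply is_derive_addR; [apply is_derive_addR|]; apply is_derive_mulR; eassumption.
  - cbv beta; ring.
Qed.

(** * Smoothness on open sets *)

Definition open2 (D : R -> R -> Prop) : Prop := forall u v, D u v -> locally_2d D u v.

Lemma Ck_sub (n : nat) (D D' : R -> R -> Prop) (f : R -> R -> R) :
  (forall u v, D' u v -> D u v) -> Ck n D f -> Ck n D' f.
Proof.
  intros hD. revert f. induction n as [|n IH]; cbn; intros f hf.
  - split; [|exact I]. intros u v h. apply (proj1 hf); auto.
  - destruct hf as [h0 [h1 [h2 h3]]].
    split; [auto|]. split; [auto|]. split; apply IH; assumption.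
Qed.

(** Needed for products: the derivative of [f * g] contains [f] and [g] themselves, so the induction
    in [Ck_mult] must see them one order lower. *)
Lemma Ck_le1 (n : nat) (D : R -> R -> Prop) (f : R -> R -> R) : Ck (S n) D f -> Ck n D f.
Proof.
  revert f. induction n as [|n IH]; intros f [h0 [h1 [h2 h3]]].
  - cbn; auto.
  - split; [exact h0|]. split; [exact h1|]. split; apply IH; assumption.
Qed.

(** [pu] and [pv] are total functions whose values on [D] depend on germs at points of [D]; openness
    is what lets equality on [D] survive differentiation. *)
Lemma Ck_ext (n : nat) (D : R -> R -> Prop) (f g : R -> R -> R) :
  open2 D -> (forall u v, D u v -> f u v = g u v) -> Ck n D f -> Ck n D g.
Proof.
  intros hD. revert f g. induction n as [|n IH]; intros f g hfg [h0 h].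
  - split; [|exact I]. intros u v huv.
    apply continuity_2d_pt_ext_loc with f; auto.
    apply locally_2d_impl with (2 := hD u v huv), locally_2d_forall. auto.
  - assert (hu : forall u v, D u v -> locally u (fun t => f t v = g t v)).
    { intros u v huv. apply filter_imp with (2 := locally_2d_1d_const_y _ _ _ (hD u v huv)). auto. }
    assert (hv : forall u v, D u v -> locally v (fun t => f u t = g u t)).
    { intros u v huv. apply filter_imp with (2 := locally_2d_1d_const_x _ _ _ (hD u v huv)). auto. }
    destruct h as [h1 [h2 h3]]. split; [|split; [|split]].
    + intros u v huv. apply continuity_2d_pt_ext_loc with f; auto.
      apply locally_2d_impl with (2 := hD u v huv), locally_2d_forall. auto.
    + intros u v huv. destruct (h1 u v huv) as [e1 e2]. split.
      * now apply ex_derive_ext_loc with (f := fun t => f t v); [apply hu|].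
      * now apply ex_derive_ext_loc with (f := fun t => f u t); [apply hv|].
    + apply IH with (2 := h2). intros u v huv. apply Derive_ext_loc. now apply hu.
    + apply IH with (2 := h3). intros u v huv. apply Derive_ext_loc. now apply hv.
Qed.

Lemma Ck_const (n : nat) (D : R -> R -> Prop) (c : R) : open2 D -> Ck n D (fun _ _ => c).
Proof.
  intros hD. revert c. induction n as [|n IH]; intros c.
  - split; [|exact I]. intros. apply continuity_2d_pt_const.
  - split; [|split; [|split]].
    + intros. apply continuity_2d_pt_const.
    + intros u v _. split; apply @ex_derive_const.
    + apply Ck_ext with (f := fun _ _ => 0); auto.
      intros u v _. symmetry. exact (Derive_const _ _).
    + apply Ck_ext with (f := fun _ _ => 0); auto.
      intros u v _. symmetry. exact (Derive_const _ _).
Qed.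

Lemma Ck_fst (n : nat) (D : R -> R -> Prop) : open2 D -> Ck n D (fun u _ => u).
Proof.
  intros hD. destruct n as [|n].
  - split; [|exact I]. intros. apply continuity_2d_pt_id1.
  - split; [|split; [|split]].
    + intros. apply continuity_2d_pt_id1.
    + intros u v _. split; [apply @ex_derive_id|apply @ex_derive_const].
    + apply Ck_ext with (f := fun _ _ => 1); auto using Ck_const.
      intros u v _. symmetry. exact (Derive_id _).
    + apply Ck_ext with (f := fun _ _ => 0); auto using Ck_const.
      intros u v _. symmetry. exact (Derive_const _ _).
Qed.

Lemma Ck_snd (n : nat) (D : R -> R -> Prop) : open2 D -> Ck n D (fun _ v => v).
Proof.
  intros hD. destruct n as [|n].
  - split; [|exact I]. intros. apply continuity_2d_pt_id2.
  - split; [|split; [|split]].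
    + intros. apply continuity_2d_pt_id2.
    + intros u v _. split; [apply @ex_derive_const|apply @ex_derive_id].
    + apply Ck_ext with (f := fun _ _ => 0); auto using Ck_const.
      intros u v _. symmetry. exact (Derive_const _ _).
    + apply Ck_ext with (f := fun _ _ => 1); auto using Ck_const.
      intros u v _. symmetry. exact (Derive_id _).
Qed.

Lemma Ck_plus (n : nat) (D : R -> R -> Prop) (f g : R -> R -> R) :
  open2 D -> Ck n D f -> Ck n D g -> Ck n D (fun u v => f u v + g u v).
Proof.
  intros hD. revert f g. induction n as [|n IH]; intros f g [f0 f'] [g0 g'].
  - split; [|exact I]. intros. apply continuity_2d_pt_plus; auto.
  - destruct f' as [f1 [f2 f3]], g' as [g1 [g2 g3]].
    split; [|split; [|split]].
    + intros. apply continuity_2d_pt_plus; auto.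
    + intros u v h. destruct (f1 u v h), (g1 u v h).
      split; apply @ex_derive_plus; assumption.
    + apply Ck_ext with (f := fun u v => pu f u v + pu g u v); auto.
      intros u v h. destruct (f1 u v h), (g1 u v h).
      symmetry. unfold pu, pv. apply Derive_plus; assumption.
    + apply Ck_ext with (f := fun u v => pv f u v + pv g u v); auto.
      intros u v h. destruct (f1 u v h), (g1 u v h).
      symmetry. unfold pu, pv. apply Derive_plus; assumption.
Qed.

Lemma Ck_mult (n : nat) (D : R -> R -> Prop) (f g : R -> R -> R) :
  open2 D -> Ck n D f -> Ck n D g -> Ck n D (fun u v => f u v * g u v).
Proof.
  intros hD. revert f g. induction n as [|n IH]; intros f g hf hg.
  - split; [|exact I]. intros. apply continuity_2d_pt_mult; [apply hf|apply hg]; auto.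
  - pose proof (Ck_le1 _ _ _ hf) as hf'. pose proof (Ck_le1 _ _ _ hg) as hg'.
    destruct hf as [f0 [f1 [f2 f3]]], hg as [g0 [g1 [g2 g3]]].
    split; [|split; [|split]].
    + intros. apply continuity_2d_pt_mult; auto.
    + intros u v h. destruct (f1 u v h), (g1 u v h). split.
      * apply (ex_derive_mult (fun t => f t v) (fun t => g t v)); assumption.
      * apply (ex_derive_mult (fun t => f u t) (fun t => g u t)); assumption.
    + apply Ck_ext with (f := fun u v => pu f u v * g u v + f u v * pu g u v);
        auto using Ck_plus.
      intros u v h. destruct (f1 u v h), (g1 u v h).
      symmetry. apply (Derive_mult (fun t => f t v) (fun t => g t v)); assumption.
    + apply Ck_ext with (f := fun u v => pv f u v * g u v + f u v * pv g u v);
        auto using Ck_plus.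
      intros u v h. destruct (f1 u v h), (g1 u v h).
      symmetry. apply (Derive_mult (fun t => f u t) (fun t => g u t)); assumption.
Qed.

Lemma smooth3_sub (D D' : R -> R -> Prop) (f : R -> R -> V3) :
  (forall u v, D' u v -> D u v) -> smooth3 D f -> smooth3 D' f.
Proof.
  intros h [h1 [h2 h3]]. repeat split; intro n; apply Ck_sub with D; auto.
Qed.

Lemma smooth_pu (D : R -> R -> Prop) (f : R -> R -> R) : smooth D f -> smooth D (pu f).
Proof. intros h n. apply (h (S n)). Qed.

Lemma smooth_pv (D : R -> R -> Prop) (f : R -> R -> R) : smooth D f -> smooth D (pv f).
Proof. intros h n. apply (h (S n)). Qed.

Lemma smooth3_du (D : R -> R -> Prop) (f : R -> R -> V3) : smooth3 D f -> smooth3 D (du f).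
Proof. intros [h1 [h2 h3]]. split; [|split]; apply smooth_pu; assumption. Qed.

Lemma smooth3_dv (D : R -> R -> Prop) (f : R -> R -> V3) : smooth3 D f -> smooth3 D (dv f).
Proof. intros [h1 [h2 h3]]. split; [|split]; apply smooth_pv; assumption. Qed.

Lemma smooth_is_derive_u (D : R -> R -> Prop) (f : R -> R -> R) (u v : R) :
  smooth D f -> D u v -> is_derive (fun t => f t v) u (pu f u v).
Proof.
  intros hf h. apply Derive_correct. destruct (hf 1%nat) as [_ [h1 _]]. exact (proj1 (h1 u v h)).
Qed.

Lemma smooth_is_derive_v (D : R -> R -> Prop) (f : R -> R -> R) (u v : R) :
  smooth D f -> D u v -> is_derive (fun t => f u t) v (pv f u v).
Proof.
  intros hf h. apply Derive_correct. destruct (hf 1%nat) as [_ [h1 _]]. exact (proj2 (h1 u v h)).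
Qed.

Lemma smooth3_is_derive_u (D : R -> R -> Prop) (f : R -> R -> V3) (u v : R) :
  smooth3 D f -> D u v -> is_derive3 (fun t => f t v) u (du f u v).
Proof.
  intros [h1 [h2 h3]] h. split; [|split].
  - exact (smooth_is_derive_u D (fun s t => c1 (f s t)) u v h1 h).
  - exact (smooth_is_derive_u D (fun s t => c2 (f s t)) u v h2 h).
  - exact (smooth_is_derive_u D (fun s t => c3 (f s t)) u v h3 h).
Qed.

Lemma smooth3_is_derive_v (D : R -> R -> Prop) (f : R -> R -> V3) (u v : R) :
  smooth3 D f -> D u v -> is_derive3 (fun t => f u t) v (dv f u v).
Proof.
  intros [h1 [h2 h3]] h. split; [|split].
  - exact (smooth_is_derive_v D (fun s t => c1 (f s t)) u v h1 h).
  - exact (smooth_is_derive_v D (fun s t => c2 (f s t)) u v h2 h).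
  - exact (smooth_is_derive_v D (fun s t => c3 (f s t)) u v h3 h).
Qed.

Lemma is_derive3_du (f : R -> R -> V3) (u v : R) (w : V3) :
  is_derive3 (fun t => f t v) u w -> du f u v = w.
Proof.
  intros [h1 [h2 h3]]. apply V3_eq; cbn; now apply is_derive_unique.
Qed.

Lemma is_derive3_dv (f : R -> R -> V3) (u v : R) (w : V3) :
  is_derive3 (fun t => f u t) v w -> dv f u v = w.
Proof.
  intros [h1 [h2 h3]]. apply V3_eq; cbn; now apply is_derive_unique.
Qed.

Lemma smooth_schwarz (D : R -> R -> Prop) (f : R -> R -> R) (u v : R) :
  open2 D -> smooth D f -> D u v -> pv (pu f) u v = pu (pv f) u v.
Proof.
  intros hD hf h.
  destruct (hf 2%nat) as [_ [h1 [[_ [h2 [_ [h4 _]]]] [_ [h3 [[h5 _] _]]]]]].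
  symmetry. apply Schwarz.
  - apply locally_2d_impl with (2 := hD u v h), locally_2d_forall.
    intros s t hst.
    exact (conj (proj1 (h1 s t hst)) (conj (proj2 (h1 s t hst))
      (conj (proj1 (h3 s t hst)) (proj2 (h2 s t hst))))).
  - exact (h5 u v h).
  - exact (h4 u v h).
Qed.

Lemma smooth3_schwarz (D : R -> R -> Prop) (f : R -> R -> V3) (u v : R) :
  open2 D -> smooth3 D f -> D u v -> dv (du f) u v = du (dv f) u v.
Proof.
  intros hD [h1 [h2 h3]] h. apply V3_eq.
  - apply (smooth_schwarz D (fun s t => c1 (f s t))); assumption.
  - apply (smooth_schwarz D (fun s t => c2 (f s t))); assumption.
  - apply (smooth_schwarz D (fun s t => c3 (f s t))); assumption.
Qed.

Lemma smooth3_continuity (D : R -> R -> Prop) (f : R -> R -> V3) (u v : R) :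
  smooth3 D f -> D u v ->
  continuity_2d_pt (fun s t => c1 (f s t)) u v /\
  continuity_2d_pt (fun s t => c2 (f s t)) u v /\
  continuity_2d_pt (fun s t => c3 (f s t)) u v.
Proof.
  intros [h1 [h2 h3]] h. repeat split; [apply (h1 O)|apply (h2 O)|apply (h3 O)]; exact h.
Qed.

(** * The change of coordinates *)

Lemma is_derive_half_sqr (x : R) : is_derive (fun t => (t / 2) ^ 2) x (x / 2).
Proof. auto_derive; [exact I | field]. Qed.

Lemma locally_half_sqr (d : posreal) (x : R) :
  locally x (fun s => Rabs ((s / 2) ^ 2 - (x / 2) ^ 2) < d).
Proof.
  assert (hc : continuous (fun t => (t / 2) ^ 2) x).
  { apply (ex_derive_continuous (fun t : R => (t / 2) ^ 2)).
    eexists. apply is_derive_half_sqr. }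
  exact (proj1 (filterlim_locally _ _) hc d).
Qed.

Lemma locally_2d_of_1d (P Q : R -> Prop) (x y : R) :
  locally x P -> locally y Q -> locally_2d (fun s t => P s /\ Q t) x y.
Proof.
  intros [d1 h1] [d2 h2].
  assert (hd : 0 < Rmin d1 d2) by (apply Rmin_pos; apply cond_pos).
  exists (mkposreal _ hd). cbn. intros u v hu hv. split.
  - apply h1. apply Rlt_le_trans with (1 := hu), Rmin_l.
  - apply h2. apply Rlt_le_trans with (1 := hv), Rmin_r.
Qed.

Lemma locally_2d_tilde (P : R -> R -> Prop) (x y : R) :
  locally_2d P ((x / 2) ^ 2) ((y / 2) ^ 2) -> locally_2d (tilde P) x y.
Proof.
  intros [d hd].
  apply locally_2d_impl with
    (2 := locally_2d_of_1d _ _ x y (locally_half_sqr d x) (locally_half_sqr d y)),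
    locally_2d_forall.
  intros s t [h1 h2]. apply hd; assumption.
Qed.

Lemma locally_pos (x : R) : 0 < x -> locally x (fun t => 0 < t).
Proof. intros h. exact (open_gt 0 x h). Qed.

Lemma open2_tilde_dom (D : R -> R -> Prop) : open2 D -> open2 (tilde_dom D).
Proof.
  intros hD x y [hx [hy h]].
  apply locally_2d_impl with
    (2 := locally_2d_and _ _ x y
            (locally_2d_of_1d _ _ x y (locally_pos x hx) (locally_pos y hy))
            (locally_2d_tilde D x y (hD _ _ h))), locally_2d_forall.
  intros s t [[h1 h2] h3]. exact (conj h1 (conj h2 h3)).
Qed.

Lemma is_derive_tilde_u (f : R -> R -> R) (x y l : R) :
  is_derive (fun t => f t ((y / 2) ^ 2)) ((x / 2) ^ 2) l ->
  is_derive (fun t => tilde f t y) x (x / 2 * l).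
Proof.
  intros h.
  exact (is_derive_comp (fun t => f t ((y / 2) ^ 2)) (fun t => (t / 2) ^ 2) x l (x / 2)
           h (is_derive_half_sqr x)).
Qed.

Lemma is_derive_tilde_v (f : R -> R -> R) (x y l : R) :
  is_derive (fun t => f ((x / 2) ^ 2) t) ((y / 2) ^ 2) l ->
  is_derive (fun t => tilde f x t) y (y / 2 * l).
Proof.
  intros h.
  exact (is_derive_comp (fun t => f ((x / 2) ^ 2) t) (fun t => (t / 2) ^ 2) y l (y / 2)
           h (is_derive_half_sqr y)).
Qed.

(** The chain rule turns [pu (tilde f)] into [x / 2 * tilde (pu f)], a polynomial times the pullback
    of a derivative of [f], so the induction closes under products. *)
Lemma Ck_tilde (n : nat) (D : R -> R -> Prop) (f : R -> R -> R) :
  open2 D -> Ck n D f -> Ck n (tilde_dom D) (tilde f).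
Proof.
  intros hD. pose proof (open2_tilde_dom D hD) as hT.
  assert (hc : forall n, Ck n (tilde_dom D) (fun x _ => x / 2)).
  { intros m. apply Ck_mult; auto using Ck_fst, Ck_const. }
  assert (hc' : forall n, Ck n (tilde_dom D) (fun _ y => y / 2)).
  { intros m. apply Ck_mult; auto using Ck_snd, Ck_const. }
  assert (hcont : forall g, (forall u v, D u v -> continuity_2d_pt g u v) ->
      forall x y, tilde_dom D x y -> continuity_2d_pt (tilde g) x y).
  { intros g hg x y [_ [_ h]] eps. apply (locally_2d_tilde _ x y (hg _ _ h eps)). }
  revert f. induction n as [|n IH]; intros f [h0 h'].
  - split; [exact (hcont f h0)|exact I].
  - destruct h' as [h1 [h2 h3]].
    assert (du1 : forall x y, tilde_dom D x y ->
        is_derive (fun t => tilde f t y) x (x / 2 * tilde (pu f) x y)).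
    { intros x y [_ [_ h]]. apply is_derive_tilde_u.
      apply Derive_correct. exact (proj1 (h1 _ _ h)). }
    assert (dv1 : forall x y, tilde_dom D x y ->
        is_derive (fun t => tilde f x t) y (y / 2 * tilde (pv f) x y)).
    { intros x y [_ [_ h]]. apply is_derive_tilde_v.
      apply Derive_correct. exact (proj2 (h1 _ _ h)). }
    split; [exact (hcont f h0)|]. split; [|split].
    + intros x y h. split; eexists; [exact (du1 x y h)|exact (dv1 x y h)].
    + apply Ck_ext with (f := fun x y => x / 2 * tilde (pu f) x y); auto.
      * intros x y h. symmetry. exact (is_derive_unique _ _ _ (du1 x y h)).
      * apply Ck_mult; auto.
    + apply Ck_ext with (f := fun x y => y / 2 * tilde (pv f) x y); auto.
      * intros x y h. symmetry. exact (is_derive_unique _ _ _ (dv1 x y h)).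
      * apply Ck_mult; auto.
Qed.

Lemma smooth3_tilde (D : R -> R -> Prop) (f : R -> R -> V3) :
  open2 D -> smooth3 D f -> smooth3 (tilde_dom D) (tilde f).
Proof.
  intros hD [h1 [h2 h3]]. split; [|split]; intro n.
  - exact (Ck_tilde n D (fun u v => c1 (f u v)) hD (h1 n)).
  - exact (Ck_tilde n D (fun u v => c2 (f u v)) hD (h2 n)).
  - exact (Ck_tilde n D (fun u v => c3 (f u v)) hD (h3 n)).
Qed.

Lemma is_derive3_tilde_u (f : R -> R -> V3) (x y : R) (w : V3) :
  is_derive3 (fun t => f t ((y / 2) ^ 2)) ((x / 2) ^ 2) w ->
  is_derive3 (fun t => tilde f t y) x (vscal (x / 2) w).
Proof.
  intros [h1 [h2 h3]]. split; [|split].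
  - exact (is_derive_tilde_u (fun u v => c1 (f u v)) x y _ h1).
  - exact (is_derive_tilde_u (fun u v => c2 (f u v)) x y _ h2).
  - exact (is_derive_tilde_u (fun u v => c3 (f u v)) x y _ h3).
Qed.

Lemma is_derive3_tilde_v (f : R -> R -> V3) (x y : R) (w : V3) :
  is_derive3 (fun t => f ((x / 2) ^ 2) t) ((y / 2) ^ 2) w ->
  is_derive3 (fun t => tilde f x t) y (vscal (y / 2) w).
Proof.
  intros [h1 [h2 h3]]. split; [|split].
  - exact (is_derive_tilde_v (fun u v => c1 (f u v)) x y _ h1).
  - exact (is_derive_tilde_v (fun u v => c2 (f u v)) x y _ h2).
  - exact (is_derive_tilde_v (fun u v => c3 (f u v)) x y _ h3).
Qed.

Lemma du_tilde (D : R -> R -> Prop) (f : R -> R -> V3) (x y : R) :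
  smooth3 D f -> tilde_dom D x y -> du (tilde f) x y = vscal (x / 2) (tilde (du f) x y).
Proof.
  intros hf [_ [_ h]]. apply is_derive3_du, is_derive3_tilde_u.
  exact (smooth3_is_derive_u D f _ _ hf h).
Qed.

Lemma dv_tilde (D : R -> R -> Prop) (f : R -> R -> V3) (x y : R) :
  smooth3 D f -> tilde_dom D x y -> dv (tilde f) x y = vscal (y / 2) (tilde (dv f) x y).
Proof.
  intros hf [_ [_ h]]. apply is_derive3_dv, is_derive3_tilde_v.
  exact (smooth3_is_derive_v D f _ _ hf h).
Qed.

Lemma locally_tilde_u (D : R -> R -> Prop) (x y : R) :
  open2 D -> tilde_dom D x y -> locally x (fun t => tilde_dom D t y).
Proof. intros hD h. apply locally_2d_1d_const_y. exact (open2_tilde_dom D hD x y h). Qed.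

Lemma locally_tilde_v (D : R -> R -> Prop) (x y : R) :
  open2 D -> tilde_dom D x y -> locally y (fun t => tilde_dom D x t).
Proof. intros hD h. apply locally_2d_1d_const_x. exact (open2_tilde_dom D hD x y h). Qed.

Lemma is_derive_half (x : R) : is_derive (fun t => t / 2) x (1 / 2).
Proof. auto_derive; [exact I | field]. Qed.

Lemma vadd_zero_vscal (a c : R) (v w : V3) :
  vadd (vscal 0 v) (vscal a (vscal c w)) = vscal (a * c) w.
Proof. apply V3_eq; unfold vadd, vscal, c1, c2, c3; cbn; ring. Qed.

(** The summand with [1 / 2], produced by differentiating the factor [t / 2], is tangent to the
    coordinate line. It therefore disappears from second fundamental forms and from geodesic
    curvature. *)
Lemma du_du_tilde (D : R -> R -> Prop) (f : R -> R -> V3) (x y : R) :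
  open2 D -> smooth3 D f -> tilde_dom D x y ->
  du (du (tilde f)) x y =
  vadd (vscal (1 / 2) (tilde (du f) x y))
       (vscal (x / 2 * (x / 2)) (tilde (du (du f)) x y)).
Proof.
  intros hD hf h. apply is_derive3_du.
  apply is_derive3_ext_loc with (f := fun t => vscal (t / 2) (tilde (du f) t y)).
  - apply filter_imp with (2 := locally_tilde_u D x y hD h).
    intros t ht. symmetry. exact (du_tilde D f t y hf ht).
  - replace (vscal (x / 2 * (x / 2)) (tilde (du (du f)) x y))
      with (vscal (x / 2) (vscal (x / 2) (tilde (du (du f)) x y)))
      by (apply V3_eq; unfold vscal, c1, c2, c3; cbn; ring).
    apply (is_derive3_vscal (fun t => t / 2) (fun t => tilde (du f) t y));
      [apply is_derive_half|].
    apply is_derive3_tilde_u.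
    exact (smooth3_is_derive_u D (du f) _ _ (smooth3_du D f hf) (proj2 (proj2 h))).
Qed.

Lemma dv_dv_tilde (D : R -> R -> Prop) (f : R -> R -> V3) (x y : R) :
  open2 D -> smooth3 D f -> tilde_dom D x y ->
  dv (dv (tilde f)) x y =
  vadd (vscal (1 / 2) (tilde (dv f) x y))
       (vscal (y / 2 * (y / 2)) (tilde (dv (dv f)) x y)).
Proof.
  intros hD hf h. apply is_derive3_dv.
  apply is_derive3_ext_loc with (f := fun t => vscal (t / 2) (tilde (dv f) x t)).
  - apply filter_imp with (2 := locally_tilde_v D x y hD h).
    intros t ht. symmetry. exact (dv_tilde D f x t hf ht).
  - replace (vscal (y / 2 * (y / 2)) (tilde (dv (dv f)) x y))
      with (vscal (y / 2) (vscal (y / 2) (tilde (dv (dv f)) x y)))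
      by (apply V3_eq; unfold vscal, c1, c2, c3; cbn; ring).
    apply (is_derive3_vscal (fun t => t / 2) (fun t => tilde (dv f) x t));
      [apply is_derive_half|].
    apply is_derive3_tilde_v.
    exact (smooth3_is_derive_v D (dv f) _ _ (smooth3_dv D f hf) (proj2 (proj2 h))).
Qed.

Lemma dv_du_tilde (D : R -> R -> Prop) (f : R -> R -> V3) (x y : R) :
  open2 D -> smooth3 D f -> tilde_dom D x y ->
  dv (du (tilde f)) x y = vscal (x / 2 * (y / 2)) (tilde (dv (du f)) x y).
Proof.
  intros hD hf h. apply is_derive3_dv.
  apply is_derive3_ext_loc with (f := fun t => vscal (x / 2) (tilde (du f) x t)).
  - apply filter_imp with (2 := locally_tilde_v D x y hD h).
    intros t ht. symmetry. exact (du_tilde D f x t hf ht).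
  - rewrite <- (vadd_zero_vscal _ _ (tilde (du f) x y)).
    apply (is_derive3_vscal (fun _ => x / 2) (fun t => tilde (du f) x t));
      [exact (is_derive_const (x / 2) y)|].
    apply is_derive3_tilde_v.
    exact (smooth3_is_derive_v D (du f) _ _ (smooth3_du D f hf) (proj2 (proj2 h))).
Qed.

(** * Normal, fundamental forms and V-nets under the change of coordinates *)

Ltac vec := unfold dot, cross, vadd, vscal, c1, c2, c3; cbn.

Lemma vscal_vscal (a b : R) (v : V3) : vscal a (vscal b v) = vscal (a * b) v.
Proof. apply V3_eq; vec; ring. Qed.

Lemma norm3_vscal (t : R) (a : V3) : 0 <= t -> norm3 (vscal t a) = t * norm3 a.
Proof.
  intros ht. unfold norm3.
  replace (dot (vscal t a) (vscal t a)) with (t ^ 2 * dot a a) by (vec; ring).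
  rewrite sqrt_mult_alt by nra. f_equal. apply sqrt_pow2. exact ht.
Qed.

Lemma dot_self_ge0 (a : V3) : 0 <= dot a a.
Proof. vec. nra. Qed.

Lemma dot_self_eq0 (a : V3) : dot a a = 0 -> a = (0, 0, 0).
Proof. destruct a as [[a b] c]. vec. intros h. repeat f_equal; nra. Qed.

Lemma norm3_pos (a : V3) : a <> (0, 0, 0) -> 0 < norm3 a.
Proof.
  intros ha. apply sqrt_lt_R0. destruct (dot_self_ge0 a) as [h|h]; [exact h|].
  destruct ha. now apply dot_self_eq0.
Qed.

(** The cross product of the partial derivatives is multiplied by [x / 2 * (y / 2)], which is
    positive on [tilde_dom]: the orientation is kept, and with it the signs of [L], [M], [N] and of
    the mean curvature. *)
Lemma normal_tilde (D : R -> R -> Prop) (f : R -> R -> V3) (x y : R) :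
  immersion D f -> tilde_dom D x y -> normal (tilde f) x y = tilde (normal f) x y.
Proof.
  intros [_ [hf hi]] h. 
  change (tilde (normal f) x y) with (normal f ((x / 2) ^ 2) ((y / 2) ^ 2)).
  unfold normal. cbv zeta.
  rewrite (du_tilde D f x y hf h), (dv_tilde D f x y hf h).
  destruct h as [hx [hy h]]. specialize (hi _ _ h). unfold tilde.
  set (X := du f _ _) in *. set (Y := dv f _ _) in *.
  replace (cross (vscal (x / 2) X) (vscal (y / 2) Y))
    with (vscal (x / 2 * (y / 2)) (cross X Y))
    by (apply V3_eq; vec; ring).
  pose proof (norm3_pos _ hi).
  rewrite norm3_vscal by nra.
  rewrite vscal_vscal. f_equal. field. lra.
Qed.

Lemma dot_normal_du (f : R -> R -> V3) (u v : R) : dot (du f u v) (normal f u v) = 0.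
Proof. unfold normal. set (k := / _). vec. ring. Qed.

Lemma dot_normal_dv (f : R -> R -> V3) (u v : R) : dot (dv f u v) (normal f u v) = 0.
Proof. unfold normal. set (k := / _). vec. ring. Qed.

Lemma dot_vadd_l (a b c : V3) : dot (vadd a b) c = dot a c + dot b c.
Proof. vec. ring. Qed.

Lemma dot_vscal_l (t : R) (a b : V3) : dot (vscal t a) b = t * dot a b.
Proof. vec. ring. Qed.

Lemma I_form_tilde (D : R -> R -> Prop) (f : R -> R -> V3) (x y a b : R) :
  immersion D f -> tilde_dom D x y ->
  I_form (tilde f) x y a b = tilde (I_form f) x y (x / 2 * a) (y / 2 * b).
Proof.
  intros [_ [hf _]] h.
  change (tilde (I_form f) x y) with (I_form f ((x / 2) ^ 2) ((y / 2) ^ 2)).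
  unfold I_form, fE, fF, fG.
  rewrite (du_tilde D f x y hf h), (dv_tilde D f x y hf h). unfold tilde.
  vec. field.
Qed.

Lemma II_form_tilde (D : R -> R -> Prop) (f : R -> R -> V3) (x y a b : R) :
  immersion D f -> tilde_dom D x y ->
  II_form (tilde f) x y a b = tilde (II_form f) x y (x / 2 * a) (y / 2 * b).
Proof.
  intros hi h.
  change (tilde (II_form f) x y) with (II_form f ((x / 2) ^ 2) ((y / 2) ^ 2)).
  unfold II_form, fL, fM, fN.
  rewrite (normal_tilde D f x y hi h).
  destruct hi as [[_ hD] [hf _]].
  rewrite (du_du_tilde D f x y hD hf h), (dv_dv_tilde D f x y hD hf h),
    (dv_du_tilde D f x y hD hf h).
  unfold tilde. rewrite !dot_vadd_l, !dot_vscal_l, dot_normal_du, dot_normal_dv. ring.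
Qed.

(** [tilde_dom] sees only the points of [D] in the open quadrant, hence the request for a point of
    [D] there. *)
Lemma immersion_tilde (D : R -> R -> Prop) (f : R -> R -> V3) :
  (exists u v, 0 < u /\ 0 < v /\ D u v) ->
  immersion D f -> immersion (tilde_dom D) (tilde f).
Proof.
  intros [u [v [hu [hv huv]]]] [[_ hD] [hf hi]]. split; [split|split].
  - exists (2 * sqrt u), (2 * sqrt v).
    pose proof (sqrt_lt_R0 u hu). pose proof (sqrt_lt_R0 v hv).
    split; [lra|]. split; [lra|]. rewrite tildeE; [exact huv|lra|lra].
  - exact (open2_tilde_dom D hD).
  - exact (smooth3_tilde D f hD hf).
  - intros x y h. rewrite (du_tilde D f x y hf h), (dv_tilde D f x y hf h).
    destruct h as [hx [hy h]]. specialize (hi _ _ h). unfold tilde.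
    set (X := du f _ _) in *. set (Y := dv f _ _) in *.
    replace (cross (vscal (x / 2) X) (vscal (y / 2) Y))
      with (vscal (x / 2 * (y / 2)) (cross X Y))
      by (apply V3_eq; vec; ring).
    assert (hxy : x / 2 * (y / 2) <> 0) by nra.
    set (c := cross X Y) in *. set (t := x / 2 * (y / 2)) in *.
    intros e. apply hi.
    destruct c as [[p q] r]. unfold vscal, c1, c2, c3 in e. cbn in e.
    injection e as e1 e2 e3.
    apply Rmult_integral in e1, e2, e3.
    repeat f_equal; tauto.
Qed.

Lemma conjugate_net_tilde (D : R -> R -> Prop) (f : R -> R -> V3) :
  open2 D -> smooth3 D f -> conjugate_net D f -> conjugate_net (tilde_dom D) (tilde f).
Proof.
  intros hD hf hc x y h. pose proof h as [hx [hy h']].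
  destruct (hc _ _ h') as [a [b e]]. exists (y / 2 * a), (x / 2 * b).
  rewrite (du_tilde D f x y hf h), (dv_tilde D f x y hf h), (dv_du_tilde D f x y hD hf h).
  unfold tilde. rewrite e. apply V3_eq; vec; ring.
Qed.

Lemma geodesic_curv_eq0 (n x y : V3) :
  x <> (0, 0, 0) -> geodesic_curv n x y = 0 -> dot n (cross x y) = 0.
Proof.
  intros hx. unfold geodesic_curv. intros e. pose proof (norm3_pos x hx).
  assert (0 < norm3 x ^ 3) by now apply pow_lt.
  apply (f_equal (fun t => t * norm3 x ^ 3)) in e. unfold Rdiv in e.
  rewrite Rmult_assoc, Rinv_l in e by lra. lra.
Qed.

Lemma immersion_du_neq0 (D : R -> R -> Prop) (f : R -> R -> V3) (u v : R) :
  immersion D f -> D u v -> du f u v <> (0, 0, 0) /\ dv f u v <> (0, 0, 0).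
Proof.
  intros [_ [_ hi]] h. specialize (hi u v h).
  split; intros e; apply hi; rewrite e; apply V3_eq; vec; ring.
Qed.

Lemma geodesic_coordinate_lines_tilde (D : R -> R -> Prop) (f : R -> R -> V3) :
  immersion D f -> geodesic_coordinate_lines D f ->
  geodesic_coordinate_lines (tilde_dom D) (tilde f).
Proof.
  intros hi hg x y h. pose proof h as [hx [hy h']].
  rewrite (normal_tilde D f x y hi h).
  destruct (immersion_du_neq0 D f _ _ hi h') as [nu nv].
  destruct (hg _ _ h') as [gu gv].
  apply geodesic_curv_eq0 in gu; [|exact nu].
  apply geodesic_curv_eq0 in gv; [|exact nv].
  destruct hi as [[_ hD] [hf _]].
  rewrite (du_tilde D f x y hf h), (dv_tilde D f x y hf h),
    (du_du_tilde D f x y hD hf h), (dv_dv_tilde D f x y hD hf h).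
  unfold geodesic_curv, tilde.
  split; unfold Rdiv at 1; apply Rmult_eq_0_compat_r.
  (* The velocity contributes one factor [x / 2] and the acceleration two; the remaining summand of
     the acceleration is parallel to the velocity and dies in the cross product. *)
  - transitivity ((x / 2) ^ 3 *
      dot (normal f ((x / 2) ^ 2) ((y / 2) ^ 2))
        (cross (du f ((x / 2) ^ 2) ((y / 2) ^ 2)) (du (du f) ((x / 2) ^ 2) ((y / 2) ^ 2)))).
    + generalize (normal f ((x / 2) ^ 2) ((y / 2) ^ 2)). intros n.
      generalize (du f ((x / 2) ^ 2) ((y / 2) ^ 2)) (du (du f) ((x / 2) ^ 2) ((y / 2) ^ 2)).
      intros p q. vec. field.
    + rewrite gu. ring.
  - transitivity ((y / 2) ^ 3 *
      dot (normal f ((x / 2) ^ 2) ((y / 2) ^ 2))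
        (cross (dv f ((x / 2) ^ 2) ((y / 2) ^ 2)) (dv (dv f) ((x / 2) ^ 2) ((y / 2) ^ 2)))).
    + generalize (normal f ((x / 2) ^ 2) ((y / 2) ^ 2)). intros n.
      generalize (dv f ((x / 2) ^ 2) ((y / 2) ^ 2)) (dv (dv f) ((x / 2) ^ 2) ((y / 2) ^ 2)).
      intros p q. vec. field.
    + rewrite gv. ring.
Qed.

(** * The equation of the angle *)

Lemma is_derive_zero_const (f : R -> R) (z0 z1 : R) :
  (forall z, z0 < z < z1 -> is_derive f z 0) ->
  forall a b, z0 < a < z1 -> z0 < b < z1 -> f a = f b.
Proof.
  intros hf a b ha hb.
  destruct (MVT_gen f a b (fun _ => 0)) as [c [_ hc]].
  - intros x hx. apply hf.
    revert hx. unfold Rmin, Rmax. destruct (Rle_dec a b); lra.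
  - intros x hx. apply continuity_pt_filterlim, (ex_derive_continuous f).
    exists 0. apply hf.
    revert hx. unfold Rmin, Rmax. destruct (Rle_dec a b); lra.
  - lra.
Qed.

(** [K (x * y)] stands for [cos (theta / 2) ^ 2], where [theta] is the angle between the
    coordinate lines; [eps] is the sign in [II = L (dx ^ 2 + eps dy ^ 2)].  The last
    equation is the equation of [W] rewritten for [K]. *)
Record angle_profile (eps zm : R) (K K1 K2 : R -> R) : Prop := {
  ap_eps : eps = 1 \/ eps = -1;
  ap_derive : forall z, 0 < z < zm -> is_derive K z (K1 z);
  ap_derive2 : forall z, 0 < z < zm -> is_derive K1 z (K2 z);
  ap_continuous : forall z, 0 < z < zm -> continuity_pt K2 z;
  ap_range : forall z, 0 < z < zm -> 0 < K z < 1;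
  ap_ode : forall z, 0 < z < zm ->
    2 * K z * (1 - K z) * (K2 z + K1 z / z) =
    (1 - 2 * K z) * K1 z ^ 2 - eps * K z ^ 2 * (1 - K z) ^ 2 }.

(** With [h x y = H (x * y)], one has [- (log h)_x = 2 Gamma^2_12 - Gamma^1_11] and
    [- (log h)_y = 2 Gamma^1_12 - Gamma^2_22] for the Christoffel symbols of the nets below.
    [prof_H1] and [prof_H2] are the first two derivatives of this integrating factor. *)
Definition prof_H (K : R -> R) (z : R) : R := / (z * K z).
Definition prof_H1 (K K1 : R -> R) (z : R) : R := - (K z + z * K1 z) / (z * K z) ^ 2.
Definition prof_H2 (K K1 K2 : R -> R) (z : R) : R :=
  (2 * (K z + z * K1 z) ^ 2 - (2 * K1 z + z * K2 z) * (z * K z)) / (z * K z) ^ 3.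

Lemma prof_H_derive (eps zm : R) (K K1 K2 : R -> R) (z : R) :
  angle_profile eps zm K K1 K2 -> 0 < z < zm -> is_derive (prof_H K) z (prof_H1 K K1 z).
Proof.
  intros A hz. pose proof (ap_derive _ _ _ _ _ A z hz) as d1.
  pose proof (ap_range _ _ _ _ _ A z hz) as r.
  assert (hn : z * K z <> 0) by nra.
  unfold prof_H, prof_H1. auto_derive.
  - split; [eexists; exact d1|]. split; [exact hn|exact I].
  - replace (Derive (fun x => K x) z) with (K1 z)
      by (symmetry; apply is_derive_unique; exact d1).
    field. split; lra.
Qed.

Lemma prof_H1_derive (eps zm : R) (K K1 K2 : R -> R) (z : R) :
  angle_profile eps zm K K1 K2 -> 0 < z < zm ->
  is_derive (prof_H1 K K1) z (prof_H2 K K1 K2 z).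
Proof.
  intros A hz. pose proof (ap_derive _ _ _ _ _ A z hz) as d1.
  pose proof (ap_derive2 _ _ _ _ _ A z hz) as d2.
  pose proof (ap_range _ _ _ _ _ A z hz) as r.
  assert (hn : z * K z <> 0) by nra.
  unfold prof_H1, prof_H2. auto_derive.
  - repeat split; try (eexists; eassumption).
    apply Rmult_integral_contrapositive_currified; [exact hn|].
    rewrite Rmult_1_r. exact hn.
  - replace (Derive (fun x => K x) z) with (K1 z)
      by (symmetry; apply is_derive_unique; exact d1).
    replace (Derive (fun x => K1 x) z) with (K2 z)
      by (symmetry; apply is_derive_unique; exact d2).
    field. split; lra.
Qed.

(* The numerator of the equation of [K] for [K = 1 / P], [P = a z ^ 2 + b z]. *)
Definition prof_poly (eps a b z : R) : R :=
  let P := a * z ^ 2 + b * z in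
  let P' := 2 * a * z + b in
  2 * (P - 1) * (2 * P' ^ 2 - P * (2 * a) - (a * z + b) * P')
  - (P - 2) * P' ^ 2 + eps * P * (P - 1) ^ 2.

(** If [H'' = 0], then [H z = a * z + b], and [1 / K z = z * H z] is the polynomial
    [a * z ^ 2 + b * z]. Substituted into [ap_ode], it makes [prof_poly] vanish on the whole
    interval. The term carrying [eps], which stems from [sin W], has the highest degree and nothing
    cancels it. *)
Lemma prof_H2_nonzero (eps zm : R) (K K1 K2 : R -> R) (z0 z1 : R) :
  angle_profile eps zm K K1 K2 -> 0 <= z0 < z1 -> z1 <= zm ->
  ~ (forall z, z0 < z < z1 -> prof_H2 K K1 K2 z = 0).
Proof.
  intros A h0 h1 hz.
  assert (hin : forall z, z0 < z < z1 -> 0 < z < zm) by (intros; lra).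
  set (m := (z0 + z1) / 2).
  assert (hm : z0 < m < z1) by (unfold m; lra).
  set (a := prof_H1 K K1 m). set (b := prof_H K m - a * m).
  assert (e1 : forall z, z0 < z < z1 -> prof_H1 K K1 z = a).
  { intros z h. apply (is_derive_zero_const (prof_H1 K K1) z0 z1); auto.
    intros t ht. rewrite <- (hz t ht). apply (prof_H1_derive eps zm K K1 K2); auto. }
  assert (e0 : forall z, z0 < z < z1 -> prof_H K z = a * z + b).
  { intros z h.
    enough (prof_H K z - a * z = prof_H K m - a * m) by (unfold b; lra).
    apply (is_derive_zero_const (fun z => prof_H K z - a * z) z0 z1); auto.
    intros t ht. eapply is_derive_eq.
    - apply is_derive_subR; [apply (prof_H_derive eps zm K K1 K2); auto|].
      apply (is_derive_mulR (fun _ => a) (fun z => z));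
        [exact (is_derive_const a t)|exact (is_derive_id t)].
    - change (@zero R_NormedModule) with 0. change (@one R_AbsRing) with 1.
      rewrite e1 by exact ht. ring. }
  assert (poly : forall z, z0 < z < z1 -> prof_poly eps a b z = 0).
  { intros z h. specialize (e0 z h). specialize (e1 z h). specialize (hz z h).
    pose proof (ap_range _ _ _ _ _ A z (hin z h)) as r.
    pose proof (ap_ode _ _ _ _ _ A z (hin z h)) as ode.
    specialize (hin z h). clearbody a b.
    unfold prof_H in e0. unfold prof_H1 in e1. unfold prof_H2 in hz.
    revert e0 e1 hz r ode. generalize (K z) (K1 z) (K2 z). intros k k1 k2 e0 e1 hz r ode.
    assert (hzk : 0 < z * k) by nra.
    assert (eb : b = / (z * k) - a * z) by lra.
    assert (ek1 : k1 = (- a * (z * k) ^ 2 - k) / z) by (rewrite <- e1; field; lra).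
    assert (ek2 : k2 = (2 * (k + z * k1) ^ 2 / (z * k) - 2 * k1) / z).
    { assert (hn : 2 * (k + z * k1) ^ 2 - (2 * k1 + z * k2) * (z * k) = 0).
      { unfold Rdiv in hz. apply Rmult_integral in hz as [hz|hz]; [exact hz|].
        destruct (Rinv_neq_0_compat ((z * k) ^ 3)); [apply pow_nonzero; lra|exact hz]. }
      apply (Rmult_eq_reg_l (z * (z * k))); [|nra].
      transitivity (2 * (k + z * k1) ^ 2 - 2 * k1 * (z * k)); [lra|field; split; lra]. }
    subst k2. subst k1.
    unfold prof_poly. subst b.
    apply Rminus_diag_eq in ode.
    (* With [k = 1 / P], the two sides of [ap_ode] differ by [prof_poly / P ^ 5]. *)
    apply (Rmult_eq_reg_l (k ^ 5)); [|apply pow_nonzero; lra]. rewrite Rmult_0_r.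
    etransitivity; [|exact ode]. field. split; lra. }
  clearbody a b.
  assert (hE : eps <> 0) by (destruct (ap_eps _ _ _ _ _ A); lra).
  (* An eighth of the length: the points [z0 + t * d] with [t = 1, ..., 7] lie inside the interval,
     and a sixth difference needs seven of them. *)
  set (d := (z1 - z0) / 8).
  assert (hd : d <> 0) by (unfold d; lra).
  assert (pt : forall t, 0 < t < 8 -> prof_poly eps a b (z0 + t * d) = 0).
  { intros t ht. apply poly. unfold d. split; nra. }
  assert (p1 := pt 1 ltac:(lra)). assert (p2 := pt 2 ltac:(lra)).
  assert (p3 := pt 3 ltac:(lra)). assert (p4 := pt 4 ltac:(lra)).
  assert (p5 := pt 5 ltac:(lra)). assert (p6 := pt 6 ltac:(lra)).
  assert (p7 := pt 7 ltac:(lra)).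
  (* sixth finite difference of a polynomial of degree 6 with leading coefficient eps a ^ 3 *)
  assert (ha : 720 * eps * (a * d ^ 2) ^ 3 = 0).
  { transitivity (prof_poly eps a b (z0 + 7 * d) - 6 * prof_poly eps a b (z0 + 6 * d)
      + 15 * prof_poly eps a b (z0 + 5 * d) - 20 * prof_poly eps a b (z0 + 4 * d)
      + 15 * prof_poly eps a b (z0 + 3 * d) - 6 * prof_poly eps a b (z0 + 2 * d)
      + prof_poly eps a b (z0 + 1 * d)); [unfold prof_poly; ring|].
    rewrite p1, p2, p3, p4, p5, p6, p7. ring. }
  assert (a0 : a = 0).
  { apply Rmult_integral in ha as [ha|ha]; [nra|].
    assert (a * d ^ 2 = 0) by (apply NNPP; intro n; exact (pow_nonzero _ 3 n ha)).
    assert (0 < d ^ 2) by (apply pow2_gt_0; exact hd). nra. }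
  subst a.
  (* For [a = 0] the degree drops to 3, with leading coefficient [eps * b ^ 3], and a third
     difference isolates it. *)
  assert (hb : 6 * eps * (b * d) ^ 3 = 0).
  { transitivity (prof_poly eps 0 b (z0 + 4 * d) - 3 * prof_poly eps 0 b (z0 + 3 * d)
      + 3 * prof_poly eps 0 b (z0 + 2 * d) - prof_poly eps 0 b (z0 + 1 * d));
      [unfold prof_poly; ring|].
    rewrite p1, p2, p3, p4. ring. }
  assert (b0 : b = 0).
  { apply Rmult_integral in hb as [hb|hb]; [nra|].
    assert (b * d = 0) by (apply NNPP; intro n; exact (pow_nonzero _ 3 n hb)).
    nra. }
  (* Now [H] would vanish identically, whereas it is positive. *)
  subst b. specialize (e0 m hm). unfold prof_H in e0.
  pose proof (ap_range _ _ _ _ _ A m (hin m hm)) as r. specialize (hin m hm).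
  assert (0 < / (m * K m)) by (apply Rinv_0_lt_compat; nra). lra.
Qed.

(** A constant [K] would reduce [ap_ode] to [0 = - eps * K ^ 2 * (1 - K) ^ 2]. The lemma supplies
    points where the angle really varies, as [chebyshev_not_revolution] requires. *)
Lemma prof_derive_nonzero (eps zm : R) (K K1 K2 : R -> R) (z0 z1 : R) :
  angle_profile eps zm K K1 K2 -> 0 <= z0 < z1 -> z1 <= zm ->
  ~ (forall z, z0 < z < z1 -> K1 z = 0).
Proof.
  intros A h0 h1 hz.
  set (m := (z0 + z1) / 2).
  assert (hm : z0 < m < z1) by (unfold m; lra).
  assert (hm' : 0 < m < zm) by lra.
  assert (e2 : K2 m = 0).
  { apply (is_derive_unique_eq K1 m); [exact (ap_derive2 _ _ _ _ _ A m hm')|].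
    apply is_derive_ext_loc with (f := fun _ => 0); [|exact (is_derive_const 0 m)].
    apply (filter_imp (fun t => z0 < t < z1)).
    - intros t ht. symmetry. exact (hz t ht).
    - apply (open_and _ _ (open_gt z0) (open_lt z1)). exact hm. }
  pose proof (ap_ode _ _ _ _ _ A m hm') as ode. rewrite e2, (hz m hm) in ode.
  pose proof (ap_range _ _ _ _ _ A m hm') as r.
  assert (hp : 0 < K m * (1 - K m)) by nra.
  assert (h : (K m * (1 - K m)) ^ 2 = 0).
  { destruct (ap_eps _ _ _ _ _ A) as [-> | ->]; [transitivity (1 * K m ^ 2 * (1 - K m) ^ 2)|
      transitivity (- (-1 * K m ^ 2 * (1 - K m) ^ 2))]; try ring;
      unfold Rdiv in ode; nra. }
  nra.
Qed.

(** * Algebra of a tangent frame *)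

Lemma dot_cross_cross (X Y : V3) :
  dot (cross X Y) (cross X Y) = dot X X * dot Y Y - dot X Y ^ 2.
Proof. vec. ring. Qed.

(** Cramer's rule in the frame [X], [Y], [cross X Y], kept free of denominators and paired with an
    arbitrary [v]: the products of [z] with the frame determine all its other products. *)
Lemma dot_gram (X Y v z : V3) :
  dot (cross X Y) (cross X Y) * dot v z =
  (dot z X * dot Y Y - dot z Y * dot X Y) * dot v X +
  (dot z Y * dot X X - dot z X * dot X Y) * dot v Y +
  dot v (cross X Y) * dot z (cross X Y).
Proof. vec. ring. Qed.

Lemma dot_self_gt0 (a : V3) : a <> (0, 0, 0) -> 0 < dot a a.
Proof.
  intros h. destruct (dot_self_ge0 a) as [p|p]; [exact p|].
  destruct h. apply dot_self_eq0. symmetry. exact p.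
Qed.

Lemma norm3_sqr (a : V3) : norm3 a ^ 2 = dot a a.
Proof. apply pow2_sqrt, dot_self_ge0. Qed.

Lemma dot_comm (a b : V3) : dot a b = dot b a.
Proof. vec. ring. Qed.

Lemma dot_normal (f : R -> R -> V3) (u v : R) (z : V3) :
  dot z (normal f u v) =
  dot z (cross (du f u v) (dv f u v)) / norm3 (cross (du f u v) (dv f u v)).
Proof.
  unfold normal. cbv zeta. rewrite dot_comm, dot_vscal_l, dot_comm. unfold Rdiv. ring.
Qed.

(** Replacing the unit normal by [w] multiplies each of [L], [M], [N] by [norm3 w], and
    [E G - F ^ 2] is [dot w w]; this removes the square roots. *)
Lemma gauss_curv_cross (f : R -> R -> V3) (u v : R) :
  let w := cross (du f u v) (dv f u v) in
  w <> (0, 0, 0) ->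
  gauss_curv f u v * dot w w ^ 2 =
  dot (du (du f) u v) w * dot (dv (dv f) u v) w - dot (dv (du f) u v) w ^ 2.
Proof.
  intros w hw. unfold gauss_curv, fL, fM, fN, fE, fF, fG.
  rewrite !dot_normal. fold w.
  rewrite <- dot_cross_cross. fold w. rewrite <- !norm3_sqr.
  pose proof (norm3_pos w hw). field. lra.
Qed.

(** * Surfaces of revolution *)

Lemma is_derive3_cross_const (e q : V3) (f : R -> V3) (t : R) (v : V3) :
  is_derive3 f t v -> is_derive3 (fun s => vadd (cross e (f s)) q) t (cross e v).
Proof.
  intros h.
  replace (cross e v)
    with (vadd (vadd (cross (0, 0, 0) (f t)) (cross e v)) (0, 0, 0))
    by (apply V3_eq; vec; ring).
  apply (is_derive3_vadd (fun s => cross e (f s)) (fun _ => q)).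
  - apply (is_derive3_cross (fun _ => e)); [apply is_derive3_const|exact h].
  - apply is_derive3_const.
Qed.

Lemma revolution_point_derive (p e1 e2 e3 : V3) (f g s th : R -> R) (t f' g' s' th' : R) :
  is_derive f (s t) f' -> is_derive g (s t) g' ->
  is_derive s t s' -> is_derive th t th' ->
  is_derive3
    (fun t => vadd p (vadd (vscal (f (s t)) (vadd (vscal (cos (th t)) e1)
                                                  (vscal (sin (th t)) e2)))
                           (vscal (g (s t)) e3))) t
    (vadd
       (vscal s' (vadd (vscal f' (vadd (vscal (cos (th t)) e1) (vscal (sin (th t)) e2)))
                       (vscal g' e3)))
       (vscal th' (vscal (f (s t))
         (vadd (vscal (- sin (th t)) e1) (vscal (cos (th t)) e2))))).
Proof.
  intros hf hg hs hth.
  pose proof (is_derive_comp f s t f' s' hf hs) as hfs.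
  pose proof (is_derive_comp g s t g' s' hg hs) as hgs.
  pose proof (is_derive_comp cos th t _ th' (is_derive_cos (th t)) hth) as hc.
  pose proof (is_derive_comp sin th t _ th' (is_derive_sin (th t)) hth) as hsn.
  pose proof (is_derive3_vscal _ _ t _ _ hc (is_derive3_const e1 t)) as k1.
  pose proof (is_derive3_vscal _ _ t _ _ hsn (is_derive3_const e2 t)) as k2.
  pose proof (is_derive3_vscal _ _ t _ _ hgs (is_derive3_const e3 t)) as k3.
  pose proof (is_derive3_vscal _ _ t _ _ hfs (is_derive3_vadd _ _ t _ _ k1 k2)) as k4.
  pose proof (is_derive3_vadd _ _ t _ _ (is_derive3_const p t)
                (is_derive3_vadd _ _ t _ _ k4 k3)) as k.
  match type of k with is_derive3 _ _ ?w => match goal with |- is_derive3 _ _ ?w' =>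
    replace w' with w; [exact k|] end end.
  unfold scal; cbn. unfold mult; cbn.
  apply V3_eq; vec; ring.
Qed.

(* The velocity of the rotation about the axis is the vector field [e x psi + q]. *)
Lemma revolution_killing_field (U : R -> R -> Prop) (psi : R -> R -> V3) :
  open2 U -> of_revolution U psi ->
  exists e q, dot e e = 1 /\
    forall u v, U u v ->
      dot (vadd (cross e (psi u v)) q) (cross (du psi u v) (dv psi u v)) = 0.
Proof.
  intros hU [p [e1 [e2 [e3 [I [f [g [s [th [ho [hI [hfg [hs [hth h]]]]]]]]]]]]]].
  destruct ho as [o11 [o22 [o33 [o12 [o13 o23]]]]].
  (* The axis is directed by [cross e1 e2] rather than [e3] because the orthonormal frame may be
     left-handed. *)
  exists (cross e1 e2), (vscal (-1) (cross (cross e1 e2) p)). split.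
  - rewrite dot_cross_cross, o11, o22, o12. ring.
  - intros u v huv. destruct (h u v huv) as [hsI hpsi].
    destruct (hfg _ hsI 1%nat) as [[f' hf'] [g' hg']].
    eassert (hu : du psi u v = _).
    { apply is_derive3_du.
      apply is_derive3_ext_loc with (f := fun t =>
        vadd p (vadd (vscal (f (s t v)) (vadd (vscal (cos (th t v)) e1)
                                              (vscal (sin (th t v)) e2)))
                     (vscal (g (s t v)) e3))).
      - apply filter_imp with (2 := locally_2d_1d_const_y U u v (hU u v huv)).
        intros t ht. symmetry. exact (proj2 (h t v ht)).
      - apply (revolution_point_derive p e1 e2 e3 f g (fun t => s t v) (fun t => th t v)
                 u f' g' _ _ hf' hg' (smooth_is_derive_u U s u v hs huv)
                 (smooth_is_derive_u U th u v hth huv)). }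
    eassert (hv : dv psi u v = _).
    { apply is_derive3_dv.
      apply is_derive3_ext_loc with (f := fun t =>
        vadd p (vadd (vscal (f (s u t)) (vadd (vscal (cos (th u t)) e1)
                                              (vscal (sin (th u t)) e2)))
                     (vscal (g (s u t)) e3))).
      - apply filter_imp with (2 := locally_2d_1d_const_x U u v (hU u v huv)).
        intros t ht. symmetry. exact (proj2 (h u t ht)).
      - apply (revolution_point_derive p e1 e2 e3 f g (fun t => s u t) (fun t => th u t)
                 v f' g' _ _ hf' hg' (smooth_is_derive_v U s u v hs huv)
                 (smooth_is_derive_v U th u v hth huv)). }
    set (B := vscal (f (s u v)) (vadd (vscal (- sin (th u v)) e1) (vscal (cos (th u v)) e2))).
    (* [B] is the derivative of the parametrization with respect to the angle [th]. *)
    assert (e : vadd (cross (cross e1 e2) (psi u v)) (vscal (-1) (cross (cross e1 e2) p)) = B).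
    { rewrite hpsi. set (fs := f (s u v)) in *. set (gs := g (s u v)).
      set (c := cos (th u v)) in *. set (d := sin (th u v)) in *.
      transitivity (vadd
        (vscal (fs * c * dot e1 e1 + fs * d * dot e1 e2 + gs * dot e1 e3) e2)
        (vscal (- (fs * c * dot e1 e2 + fs * d * dot e2 e2 + gs * dot e2 e3)) e1)).
      - apply V3_eq; vec; ring.
      - rewrite o11, o12, o22, o13, o23. unfold B. apply V3_eq; vec; ring. }
    rewrite e, hu, hv. fold B. clearbody B.
    (* Both partial derivatives of [psi] combine the same meridian velocity with [B], so they are
       coplanar with [B]. *)
    match goal with |- dot _ (cross (vadd (vscal ?a ?A) _) (vadd (vscal ?b ?A') _)) = 0 =>
      generalize A end.
    intros A. vec. ring.
Qed.

(** * Chebyshev nets on pseudospherical surfaces *)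

Definition square (x0 y0 d x y : R) : Prop := Rabs (x - x0) < d /\ Rabs (y - y0) < d.

Lemma locally_Rabs_lt (x0 d x : R) :
  Rabs (x - x0) < d -> locally x (fun t => Rabs (t - x0) < d).
Proof.
  intros h. assert (hd : 0 < d - Rabs (x - x0)) by lra.
  exists (mkposreal _ hd). intros t ht.
  change (Rabs (t - x) < d - Rabs (x - x0)) in ht.
  replace (t - x0) with ((t - x) + (x - x0)) by ring.
  apply Rle_lt_trans with (1 := Rabs_triang _ _). lra.
Qed.

Lemma open2_square (x0 y0 d : R) : open2 (square x0 y0 d).
Proof.
  intros x y [hx hy].
  exact (locally_2d_of_1d _ _ x y (locally_Rabs_lt x0 d x hx) (locally_Rabs_lt y0 d y hy)).
Qed.

Lemma square_center (x0 y0 : R) (d : posreal) : square x0 y0 d x0 y0.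
Proof. unfold square. rewrite !Rminus_diag, Rabs_R0. split; apply cond_pos. Qed.

Definition cont3 (f : R -> R -> V3) (x y : R) : Prop :=
  continuity_2d_pt (fun s t => c1 (f s t)) x y /\
  continuity_2d_pt (fun s t => c2 (f s t)) x y /\
  continuity_2d_pt (fun s t => c3 (f s t)) x y.

Lemma cont3_dot (f g : R -> R -> V3) (x y : R) :
  cont3 f x y -> cont3 g x y -> continuity_2d_pt (fun s t => dot (f s t) (g s t)) x y.
Proof.
  intros [f1 [f2 f3]] [g1 [g2 g3]].
  apply continuity_2d_pt_plus; [apply continuity_2d_pt_plus|];
    apply continuity_2d_pt_mult; assumption.
Qed.

Lemma cont3_cross (f g : R -> R -> V3) (x y : R) :
  cont3 f x y -> cont3 g x y -> cont3 (fun s t => cross (f s t) (g s t)) x y.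
Proof.
  intros [f1 [f2 f3]] [g1 [g2 g3]].
  split; [|split]; apply continuity_2d_pt_minus; apply continuity_2d_pt_mult; assumption.
Qed.

(* [K = -1] makes [psi_xy] a unit multiple of the normal field [psi_x x psi_y] of a
   Chebyshev net; the multiple is [1] or [-1], hence constant near each point. *)
Lemma chebyshev_sign (U : R -> R -> Prop) (psi : R -> R -> V3) (x0 y0 : R) :
  immersion U psi ->
  (forall x y, U x y -> gauss_curv psi x y = -1 /\
     let w := cross (du psi x y) (dv psi x y) in
     dot (du (du psi) x y) w = 0 /\ dot (dv (dv psi) x y) w = 0) ->
  U x0 y0 ->
  exists delta (d : posreal), delta ^ 2 = 1 /\
    forall x y, square x0 y0 d x y -> U x y /\
      let w := cross (du psi x y) (dv psi x y) in
      dot (dv (du psi) x y) w = delta * dot w w.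
Proof.
  intros [[_ hU] [hs hi]] h h0.
  set (w := fun x y => cross (du psi x y) (dv psi x y)).
  set (m := fun x y => dot (dv (du psi) x y) (w x y) * / dot (w x y) (w x y)).
  assert (hw : forall x y, U x y -> 0 < dot (w x y) (w x y)).
  { intros x y hxy. apply dot_self_gt0. exact (hi x y hxy). }
  assert (hm : forall x y, U x y -> m x y ^ 2 = 1).
  { intros x y hxy. destruct (h x y hxy) as [hK [hL hN]].
    pose proof (gauss_curv_cross psi x y (hi x y hxy)) as g. cbv zeta in g, hL, hN.
    rewrite hK, hL, hN in g. fold (w x y) in g.
    pose proof (hw x y hxy) as p. unfold m.
    transitivity (dot (dv (du psi) x y) (w x y) ^ 2 / dot (w x y) (w x y) ^ 2).
    - field. lra.
    - replace (dot (dv (du psi) x y) (w x y) ^ 2) with (dot (w x y) (w x y) ^ 2) by lra.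
      field. lra. }
  assert (hc : continuity_2d_pt m x0 y0).
  { assert (cw : cont3 w x0 y0).
    { apply cont3_cross; apply (smooth3_continuity U);
        auto using smooth3_du, smooth3_dv. }
    apply continuity_2d_pt_mult.
    - apply cont3_dot; [|exact cw].
      apply (smooth3_continuity U); auto using smooth3_du, smooth3_dv.
    - apply continuity_2d_pt_inv; [apply cont3_dot; exact cw|].
      pose proof (hw x0 y0 h0). lra. }
  destruct (locally_2d_and _ _ x0 y0 (hc (mkposreal 1 Rlt_0_1)) (hU x0 y0 h0)) as [d hd].
  exists (m x0 y0), d. split; [exact (hm x0 y0 h0)|].
  intros x y [hx hy]. destruct (hd x y hx hy) as [hlt hxy]. cbn in hlt.
  split; [exact hxy|].
  (* Two square roots of [1] at distance less than [1] coincide. *)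
  assert (e : m x y = m x0 y0).
  { pose proof (hm x y hxy). pose proof (hm x0 y0 h0). apply Rabs_def2 in hlt.
    assert (hz : (m x y - m x0 y0) * (m x y + m x0 y0) = 0) by lra.
    apply Rmult_integral in hz as [hz|hz]; [lra|].
    assert (m x y = - m x0 y0) by lra. nra. }
  cbv zeta. fold (w x y). rewrite <- e. unfold m. pose proof (hw x y hxy). field. lra.
Qed.

Lemma is_derive_mul_l (y x : R) : is_derive (fun t => t * y) x y.
Proof. auto_derive; [exact I|]. apply Rmult_1_l. Qed.

Lemma is_derive_mul_r (x y : R) : is_derive (fun t => x * t) y x.
Proof. auto_derive; [exact I|]. apply Rmult_1_r. Qed.

Lemma is_derive_xy_u (C : R -> R) (x y l : R) :
  is_derive C (x * y) l -> is_derive (fun t => C (t * y)) x (y * l).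
Proof.
  intros h. apply (is_derive_comp C (fun t => t * y) x l y h).
  apply is_derive_mul_l.
Qed.

Lemma is_derive_xy_v (C : R -> R) (x y l : R) :
  is_derive C (x * y) l -> is_derive (fun t => C (x * t)) y (x * l).
Proof.
  intros h. apply (is_derive_comp C (fun t => x * t) y l x h).
  apply is_derive_mul_r.
Qed.

Lemma is_derive_quarter_sqr (x : R) : is_derive (fun t => t ^ 2 / 4) x (x / 2).
Proof. auto_derive; [exact I|field]. Qed.

Lemma is_derive_chebyshev_F_u (C : R -> R) (x y l : R) :
  is_derive C (x * y) l ->
  is_derive (fun t => C (t * y) * (t * y) / 4) x (y * l * (x * y) / 4 + C (x * y) * y / 4).
Proof.
  intros h. pose proof (is_derive_xy_u C x y l h) as h'.
  assert (k : is_derive (fun t => t * y / 4) x (y / 4)) by (auto_derive; [exact I|field]).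
  eapply is_derive_eq.
  - apply is_derive_ext with (f := fun t => C (t * y) * (t * y / 4)).
    + intros t. symmetry. apply Rmult_assoc.
    + apply (is_derive_mulR _ _ x _ _ h' k).
  - cbv beta. field.
Qed.

Lemma is_derive_chebyshev_F_v (C : R -> R) (x y l : R) :
  is_derive C (x * y) l ->
  is_derive (fun t => C (x * t) * (x * t) / 4) y (x * l * (x * y) / 4 + C (x * y) * x / 4).
Proof.
  intros h. pose proof (is_derive_xy_v C x y l h) as h'.
  assert (k : is_derive (fun t => x * t / 4) y (x / 4)) by (auto_derive; [exact I|field]).
  eapply is_derive_eq.
  - apply is_derive_ext with (f := fun t => C (x * t) * (x * t / 4)).
    + intros t. symmetry. apply Rmult_assoc.
    + apply (is_derive_mulR _ _ y _ _ h' k).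
  - cbv beta. field.
Qed.

Lemma is_derive3_affine (e : V3) (k : R) (f : R -> V3) (t : R) (v : V3) :
  is_derive3 f t v -> is_derive3 (fun s => vadd e (vscal k (f s))) t (vscal k v).
Proof.
  intros h.
  replace (vscal k v) with (vadd (0, 0, 0) (vadd (vscal 0 (f t)) (vscal k v)))
    by (apply V3_eq; vec; ring).
  apply (is_derive3_vadd (fun _ => e)); [apply is_derive3_const|].
  apply (is_derive3_vscal (fun _ => k)); [exact (is_derive_const k t)|exact h].
Qed.

Lemma is_derive_ext_open_u (f g : R -> R) (x y l : R) (U : R -> R -> Prop) :
  open2 U -> U x y -> (forall t, U t y -> f t = g t) -> is_derive f x l -> is_derive g x l.
Proof.
  intros hU h e. apply is_derive_ext_loc.
  apply filter_imp with (2 := locally_2d_1d_const_y U x y (hU x y h)). exact e.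
Qed.

Lemma is_derive_ext_open_v (f g : R -> R) (x y l : R) (U : R -> R -> Prop) :
  open2 U -> U x y -> (forall t, U x t -> f t = g t) -> is_derive f y l -> is_derive g y l.
Proof.
  intros hU h e. apply is_derive_ext_loc.
  apply filter_imp with (2 := locally_2d_1d_const_x U x y (hU x y h)). exact e.
Qed.

Lemma basis_orthogonal (X Y e : V3) :
  cross X Y <> (0, 0, 0) -> dot e X = 0 -> dot e Y = 0 -> dot e (cross X Y) = 0 ->
  dot e e = 0.
Proof.
  intros hw h1 h2 h3. pose proof (dot_gram X Y e e) as g. rewrite h1, h2, h3 in g.
  pose proof (dot_self_gt0 _ hw). nra.
Qed.

(** [v], [z] and [Y] all lie in the plane orthogonal to [cross X Y], so their triple product
    vanishes. *)
Lemma dot_cross_tangent_l (X Y v z : V3) :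
  cross X Y <> (0, 0, 0) -> dot v (cross X Y) = 0 -> dot z (cross X Y) = 0 ->
  dot v (cross z Y) = 0.
Proof.
  intros hw hv hz. pose proof (dot_self_gt0 _ hw) as p.
  assert (e : dot (cross X Y) (cross X Y) * dot v (cross z Y) =
    (dot z X * dot Y Y - dot z Y * dot X Y) * dot v (cross X Y) +
    dot z (cross X Y) * dot v (cross (cross X Y) Y)) by (vec; ring).
  rewrite hv, hz in e. nra.
Qed.

Lemma dot_cross_tangent_r (X Y v z : V3) :
  cross X Y <> (0, 0, 0) -> dot v (cross X Y) = 0 -> dot z (cross X Y) = 0 ->
  dot v (cross X z) = 0.
Proof.
  intros hw hv hz. pose proof (dot_self_gt0 _ hw) as p.
  assert (e : dot (cross X Y) (cross X Y) * dot v (cross X z) =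
    (dot z Y * dot X X - dot z X * dot X Y) * dot v (cross X Y) +
    dot z (cross X Y) * dot v (cross X (cross X Y))) by (vec; ring).
  rewrite hv, hz in e. nra.
Qed.

(** The metric says that [x ^ 2 / 4] and [y ^ 2 / 4] are arc lengths on the asymptotic lines and
    that [C (x * y)] is the cosine of their angle. Products with [psi_x] and [psi_y], divided by the
    speeds [x / 2] and [y / 2], are components along the unit asymptotic directions. *)
Lemma chebyshev_not_revolution (U : R -> R -> Prop) (psi : R -> R -> V3) (C C1 : R -> R)
    (x0 y0 : R) :
  immersion U psi -> of_revolution U psi -> U x0 y0 ->
  (forall x y, U x y ->
     (0 < x /\ 0 < y /\ is_derive C (x * y) (C1 (x * y)) /\ C1 (x * y) <> 0) /\
     (fE psi x y = x ^ 2 / 4 /\ fF psi x y = C (x * y) * (x * y) / 4 /\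
      fG psi x y = y ^ 2 / 4) /\
     gauss_curv psi x y = -1 /\
     let w := cross (du psi x y) (dv psi x y) in
     dot (du (du psi) x y) w = 0 /\ dot (dv (dv psi) x y) w = 0) ->
  False.
Proof.
  intros hi hrev h0 h.
  destruct (chebyshev_sign U psi x0 y0 hi) as [delta [d [hdelta hd]]];
    [intros x y hxy; apply (h x y hxy) | exact h0 |].
  destruct hi as [[_ hU] [hs hi]].
  destruct (revolution_killing_field U psi hU hrev) as [e [q [he hq]]].
  set (S := square x0 y0 d). pose proof (open2_square x0 y0 d) as hS. fold S in hS.
  assert (hSU : forall x y, S x y -> U x y) by (intros x y k; apply (hd x y k)).
  set (tau := fun x y => vadd (cross e (psi x y)) q).
  set (P := du psi). set (Q := dv psi). set (w := fun x y => cross (P x y) (Q x y)).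
  (* With [k = delta] and [k = - delta], these are [e + tau] and [e - tau] up to the sign of
     [tau]. *)
  set (s := fun k x y => vadd e (vscal k (tau x y))).
  pose proof (smooth3_du U psi hs) as hsP. pose proof (smooth3_dv U psi hs) as hsQ.
  assert (sw : forall x y, S x y -> dv P x y = du Q x y).
  { intros x y k. apply (smooth3_schwarz U); auto. }
  assert (dPx : forall x y, S x y -> is_derive3 (fun t => P t y) x (du P x y))
    by (intros; apply (smooth3_is_derive_u U); auto).
  assert (dPy : forall x y, S x y -> is_derive3 (fun t => P x t) y (dv P x y))
    by (intros; apply (smooth3_is_derive_v U); auto).
  assert (dQx : forall x y, S x y -> is_derive3 (fun t => Q t y) x (dv P x y)).
  { intros x y k. rewrite sw by exact k. apply (smooth3_is_derive_u U); auto. }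
  assert (dQy : forall x y, S x y -> is_derive3 (fun t => Q x t) y (dv Q x y))
    by (intros; apply (smooth3_is_derive_v U); auto).
  assert (dsx : forall k x y, S x y ->
      is_derive3 (fun t => s k t y) x (vscal k (cross e (P x y)))).
  { intros k x y hxy. apply (is_derive3_affine e k (fun t => tau t y)), is_derive3_cross_const.
    apply (smooth3_is_derive_u U); auto. }
  assert (dsy : forall k x y, S x y ->
      is_derive3 (fun t => s k x t) y (vscal k (cross e (Q x y)))).
  { intros k x y hxy. apply (is_derive3_affine e k (fun t => tau x t)), is_derive3_cross_const.
    apply (smooth3_is_derive_v U); auto. }
  assert (met : forall x y, S x y ->
      dot (P x y) (P x y) = x ^ 2 / 4 /\ dot (P x y) (Q x y) = C (x * y) * (x * y) / 4 /\
      dot (Q x y) (Q x y) = y ^ 2 / 4) by (intros x y k; apply (h x y); auto).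
  assert (hw : forall x y, S x y -> 0 < dot (w x y) (w x y)).
  { intros x y k. apply dot_self_gt0. apply hi. auto. }
  assert (Pxx : forall x y, S x y -> dot (du P x y) (P x y) = x / 4).
  { intros x y k.
    pose proof (is_derive_dot _ _ x _ _ (dPx x y k) (dPx x y k)) as a.
    apply (is_derive_ext_open_u _ (fun t => t ^ 2 / 4) x y _ S hS k) in a;
      [|intros t ht; apply (met t y ht)].
    pose proof (is_derive_unique_eq _ _ _ _ a (is_derive_quarter_sqr x)) as b.
    rewrite (dot_comm (P x y)) in b. lra. }
  assert (Qyy : forall x y, S x y -> dot (dv Q x y) (Q x y) = y / 4).
  { intros x y k.
    pose proof (is_derive_dot _ _ y _ _ (dQy x y k) (dQy x y k)) as a.
    apply (is_derive_ext_open_v _ (fun t => t ^ 2 / 4) x y _ S hS k) in a;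
      [|intros t ht; apply (met x t ht)].
    pose proof (is_derive_unique_eq _ _ _ _ a (is_derive_quarter_sqr y)) as b.
    rewrite (dot_comm (Q x y)) in b. lra. }
  assert (Pxy : forall x y, S x y -> dot (dv P x y) (P x y) = 0).
  { intros x y k.
    pose proof (is_derive_dot _ _ y _ _ (dPy x y k) (dPy x y k)) as a.
    apply (is_derive_ext_open_v _ (fun t => x ^ 2 / 4) x y _ S hS k) in a;
      [|intros t ht; apply (met x t ht)].
    pose proof (is_derive_unique_eq _ _ _ _ a (is_derive_const (x ^ 2 / 4) y)) as b.
    change (@zero R_NormedModule) with 0 in b.
    rewrite (dot_comm (P x y)) in b. lra. }
  assert (Qxy : forall x y, S x y -> dot (dv P x y) (Q x y) = 0).
  { intros x y k.
    pose proof (is_derive_dot _ _ x _ _ (dQx x y k) (dQx x y k)) as a.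
    apply (is_derive_ext_open_u _ (fun t => y ^ 2 / 4) x y _ S hS k) in a;
      [|intros t ht; apply (met t y ht)].
    pose proof (is_derive_unique_eq _ _ _ _ a (is_derive_const (y ^ 2 / 4) x)) as b.
    change (@zero R_NormedModule) with 0 in b.
    rewrite (dot_comm (Q x y)) in b. lra. }
  assert (Wxy : forall x y, S x y -> dot (dv P x y) (w x y) = delta * dot (w x y) (w x y))
    by (intros x y k; apply (hd x y k)).
  assert (Wxx : forall x y, S x y -> dot (du P x y) (w x y) = 0)
    by (intros x y k; apply (h x y); auto).
  assert (Wyy : forall x y, S x y -> dot (dv Q x y) (w x y) = 0)
    by (intros x y k; apply (h x y); auto).
  (* [psi_xy] is orthogonal to both tangents because each of the speeds [x / 2], [y / 2] depends on
     one variable only. Hence it equals [delta * w]. *)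
  assert (mixed : forall x y v, S x y -> dot v (dv P x y) = delta * dot v (w x y)).
  { intros x y v k. pose proof (dot_gram (P x y) (Q x y) v (dv P x y)) as g.
    fold (w x y) in g. rewrite (Pxy x y k), (Qxy x y k), (Wxy x y k) in g.
    pose proof (hw x y k). apply (Rmult_eq_reg_l (dot (w x y) (w x y))); [|lra]. lra. }
  assert (tw : forall x y, S x y -> dot (tau x y) (w x y) = 0)
    by (intros x y k; apply (hq x y); auto).
  assert (sgw : forall k x y, S x y -> dot (s k x y) (w x y) = dot e (w x y)).
  { intros k x y hxy. unfold s. rewrite dot_vadd_l, dot_vscal_l, tw by exact hxy. ring. }
  assert (dtx : forall x y, S x y -> is_derive3 (fun t => tau t y) x (cross e (P x y))).
  { intros x y k. apply is_derive3_cross_const, (smooth3_is_derive_u U); auto. }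
  assert (dty : forall x y, S x y -> is_derive3 (fun t => tau x t) y (cross e (Q x y))).
  { intros x y k. apply is_derive3_cross_const, (smooth3_is_derive_v U); auto. }
  (* In other words [F * dot s P = E * dot s Q]: the tangential part of [s delta] is parallel to
     [psi_x]. This is the derivative of [dot tau w = 0] along [x]; the term with [psi_xx] drops out
     because the [x]-lines are asymptotic. *)
  assert (rel1 : forall x y, S x y ->
      C (x * y) * (x * y) / 4 * dot (s delta x y) (P x y) =
      x ^ 2 / 4 * dot (s delta x y) (Q x y)).
  { intros x y k. destruct (met x y k) as [m1 [m2 m3]]. rewrite <- m1, <- m2.
    pose proof (is_derive_dot _ _ x _ _ (dtx x y k)
                  (is_derive3_cross _ _ x _ _ (dPx x y k) (dQx x y k))) as a.
    apply (is_derive_ext_open_u _ (fun t => 0) x y _ S hS k) in a;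
      [|intros t ht; apply (tw t y ht)].
    pose proof (is_derive_unique_eq _ _ _ _ a (is_derive_const 0 x)) as b.
    change (@zero R_NormedModule) with 0 in b.
    pose proof (dot_cross_tangent_l (P x y) (Q x y) (tau x y) (du P x y)
                  (hi x y (hSU x y k)) (tw x y k) (Wxx x y k)) as t0.
    pose proof (mixed x y (cross (tau x y) (P x y)) k) as t1.
    unfold s. unfold w in t1, b. cbv beta in b.
    revert b t0 t1.
    generalize (tau x y) (P x y) (Q x y) (du P x y) (dv P x y).
    intros T p r p1 p2 b t0 t1.
    assert (c : dot (cross e p) (cross p r) + delta * dot (cross T p) (cross p r) = 0).
    { assert (i : dot T (vadd (cross p1 r) (cross p p2)) =
                  dot T (cross p1 r) + dot (cross T p) p2) by (vec; ring). lra. }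
    assert (i : dot p r * dot (vadd e (vscal delta T)) p -
                dot p p * dot (vadd e (vscal delta T)) r =
                dot (cross e p) (cross p r) + delta * dot (cross T p) (cross p r))
      by (vec; ring). lra. }
  (* Differentiating along [y] instead exchanges the factors of the cross product, which replaces
     [delta] by [- delta]. *)
  assert (rel2 : forall x y, S x y ->
      y ^ 2 / 4 * dot (s (- delta) x y) (P x y) =
      C (x * y) * (x * y) / 4 * dot (s (- delta) x y) (Q x y)).
  { intros x y k. destruct (met x y k) as [m1 [m2 m3]]. rewrite <- m3, <- m2.
    pose proof (is_derive_dot _ _ y _ _ (dty x y k)
                  (is_derive3_cross _ _ y _ _ (dPy x y k) (dQy x y k))) as a.
    apply (is_derive_ext_open_v _ (fun t => 0) x y _ S hS k) in a;
      [|intros t ht; apply (tw x t ht)].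
    pose proof (is_derive_unique_eq _ _ _ _ a (is_derive_const 0 y)) as b.
    change (@zero R_NormedModule) with 0 in b.
    pose proof (dot_cross_tangent_r (P x y) (Q x y) (tau x y) (dv Q x y)
                  (hi x y (hSU x y k)) (tw x y k) (Wyy x y k)) as t0.
    pose proof (mixed x y (cross (Q x y) (tau x y)) k) as t1.
    unfold s. unfold w in t1, b. cbv beta in b.
    revert b t0 t1.
    generalize (tau x y) (P x y) (Q x y) (dv Q x y) (dv P x y).
    intros T p r p1 p2 b t0 t1.
    assert (c : dot (cross e r) (cross p r) + delta * dot (cross r T) (cross p r) = 0).
    { assert (i : dot T (vadd (cross p2 r) (cross p p1)) =
                  dot (cross r T) p2 + dot T (cross p p1)) by (vec; ring). lra. }
    assert (i : dot r r * dot (vadd e (vscal (- delta) T)) p -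
                dot p r * dot (vadd e (vscal (- delta) T)) r =
                dot (cross e r) (cross p r) + delta * dot (cross r T) (cross p r))
      by (vec; ring). lra. }
  (* [psi_xx] is tangent and the tangential part of [s delta] is along [psi_x], so only the growth
     of the speed [x / 2] is felt: the component along the unit direction does not change with
     [x]. *)
  assert (dAx : forall x y, S x y -> is_derive (fun t => dot (s delta t y) (P t y)) x
      (dot (s delta x y) (P x y) / x)).
  { intros x y k. destruct (met x y k) as [m1 [m2 m3]].
    destruct (h x y (hSU x y k)) as [[hx _] _].
    eapply is_derive_eq; [exact (is_derive_dot _ _ x _ _ (dsx delta x y k) (dPx x y k))|cbv beta].
    pose proof (dot_gram (P x y) (Q x y) (s delta x y) (du P x y)) as g.
    pose proof (dot_cross_cross (P x y) (Q x y)) as g'.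
    pose proof (rel1 x y k) as r1. rewrite <- m1, <- m2 in r1.
    fold (w x y) in g, g'. rewrite (Wxx x y k), (Pxx x y k) in g.
    pose proof (hw x y k) as p.
    assert (z : dot (vscal delta (cross e (P x y))) (P x y) = 0) by (vec; ring).
    rewrite z, Rplus_0_l.
    apply (Rmult_eq_reg_l (dot (P x y) (P x y))); [|rewrite m1; nra].
    apply (Rmult_eq_reg_l (dot (w x y) (w x y))); [|lra].
    transitivity (dot (w x y) (w x y) * (x / 4 * dot (s delta x y) (P x y))).
    - transitivity (dot (P x y) (P x y) *
        (dot (w x y) (w x y) * dot (s delta x y) (du P x y))); [ring|].
      rewrite g, g'.
      transitivity (
        (x / 4 * dot (Q x y) (Q x y) - dot (du P x y) (Q x y) * dot (P x y) (Q x y)) *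
        dot (s delta x y) (P x y) * dot (P x y) (P x y) +
        (dot (du P x y) (Q x y) * dot (P x y) (P x y) - x / 4 * dot (P x y) (Q x y)) *
        (dot (P x y) (P x y) * dot (s delta x y) (Q x y))); [ring|].
      rewrite <- r1. ring.
    - rewrite m1. field. lra. }
  assert (dBy : forall x y, S x y -> is_derive (fun t => dot (s (- delta) x t) (Q x t)) y
      (dot (s (- delta) x y) (Q x y) / y)).
  { intros x y k. destruct (met x y k) as [m1 [m2 m3]].
    destruct (h x y (hSU x y k)) as [[_ [hy _]] _].
    eapply is_derive_eq; [exact (is_derive_dot _ _ y _ _ (dsy (- delta) x y k) (dQy x y k))|cbv beta].
    pose proof (dot_gram (P x y) (Q x y) (s (- delta) x y) (dv Q x y)) as g.
    pose proof (dot_cross_cross (P x y) (Q x y)) as g'.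
    pose proof (rel2 x y k) as r1. rewrite <- m3, <- m2 in r1.
    fold (w x y) in g, g'. rewrite (Wyy x y k), (Qyy x y k) in g.
    pose proof (hw x y k) as p.
    assert (z : dot (vscal (- delta) (cross e (Q x y))) (Q x y) = 0) by (vec; ring).
    rewrite z, Rplus_0_l.
    apply (Rmult_eq_reg_l (dot (Q x y) (Q x y))); [|rewrite m3; nra].
    apply (Rmult_eq_reg_l (dot (w x y) (w x y))); [|lra].
    transitivity (dot (w x y) (w x y) * (y / 4 * dot (s (- delta) x y) (Q x y))).
    - transitivity (dot (Q x y) (Q x y) *
        (dot (w x y) (w x y) * dot (s (- delta) x y) (dv Q x y))); [ring|].
      rewrite g, g'.
      transitivity (
        (dot (dv Q x y) (P x y) * dot (Q x y) (Q x y) - y / 4 * dot (P x y) (Q x y)) *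
        (dot (Q x y) (Q x y) * dot (s (- delta) x y) (P x y)) +
        (y / 4 * dot (P x y) (P x y) - dot (dv Q x y) (P x y) * dot (P x y) (Q x y)) *
        dot (s (- delta) x y) (Q x y) * dot (Q x y) (Q x y)); [ring|].
      rewrite r1. ring.
    - rewrite m3. field. lra. }
  (* The derivative of [s (- delta)] contributes [- delta * dot e w] and [psi_xy] contributes
     [delta * dot e w]. These cancel here, and the corresponding contributions add up in the two
     pairings below. *)
  assert (dBx : forall x y, S x y ->
      is_derive (fun t => dot (s (- delta) t y) (Q t y)) x 0).
  { intros x y k.
    eapply is_derive_eq; [exact (is_derive_dot _ _ x _ _ (dsx (- delta) x y k) (dQx x y k))|cbv beta].
    rewrite (mixed x y _ k), (sgw _ x y k). unfold w. vec. ring. }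
  assert (dA2 : forall x y, S x y -> is_derive (fun t => dot (s delta t y) (Q t y)) x
      (2 * delta * dot e (w x y))).
  { intros x y k.
    eapply is_derive_eq; [exact (is_derive_dot _ _ x _ _ (dsx delta x y k) (dQx x y k))|cbv beta].
    rewrite (mixed x y _ k), (sgw _ x y k). unfold w. vec. ring. }
  assert (dB1 : forall x y, S x y -> is_derive (fun t => dot (s (- delta) x t) (P x t)) y
      (2 * delta * dot e (w x y))).
  { intros x y k.
    eapply is_derive_eq; [exact (is_derive_dot _ _ y _ _ (dsy (- delta) x y k) (dPy x y k))|cbv beta].
    rewrite (mixed x y _ k), (sgw _ x y k). unfold w. vec. ring. }
  (* Derivative of [rel1] along [x]: the terms containing [C] itself cancel and only the variation
     [C1] of the angle is left. *)
  assert (eqA : forall x y, S x y ->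
      y ^ 2 * C1 (x * y) * dot (s delta x y) (P x y) = 2 * x * delta * dot e (w x y)).
  { intros x y k. destruct (h x y (hSU x y k)) as [[hx [hy [hC _]]] _].
    pose proof (is_derive_mulR _ _ x _ _ (is_derive_chebyshev_F_u C x y _ hC) (dAx x y k)) as a.
    pose proof (is_derive_mulR _ _ x _ _ (is_derive_quarter_sqr x) (dA2 x y k)) as b.
    apply (is_derive_ext_open_u _ _ x y _ S hS k (fun t ht => rel1 t y ht)) in a.
    pose proof (is_derive_unique_eq _ _ _ _ a b) as c. cbv beta in c.
    pose proof (rel1 x y k) as r.
    revert c r. generalize (dot (s delta x y) (P x y)) (dot (s delta x y) (Q x y)).
    intros A A2 c r.
    assert (eA2 : A2 = C (x * y) * y * A / x).
    { apply (Rmult_eq_reg_l (x ^ 2 / 4)); [|nra]. rewrite <- r. field. lra. }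
    rewrite eA2 in c. apply (Rmult_eq_reg_l (x / 4)); [|lra].
    match type of c with ?l = ?rr =>
      transitivity (l - (2 * (C (x * y) * y / 4) * A)); [field; lra|];
      rewrite c; field; lra end. }
  assert (eqB : forall x y, S x y ->
      x ^ 2 * C1 (x * y) * dot (s (- delta) x y) (Q x y) = 2 * y * delta * dot e (w x y)).
  { intros x y k. destruct (h x y (hSU x y k)) as [[hx [hy [hC _]]] _].
    pose proof (is_derive_mulR _ _ y _ _ (is_derive_chebyshev_F_v C x y _ hC) (dBy x y k)) as a.
    pose proof (is_derive_mulR _ _ y _ _ (is_derive_quarter_sqr y) (dB1 x y k)) as b.
    apply (is_derive_ext_open_v _ _ x y _ S hS k (fun t ht => rel2 x t ht)) in b.
    pose proof (is_derive_unique_eq _ _ _ _ a b) as c. cbv beta in c.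
    pose proof (rel2 x y k) as r.
    revert c r. generalize (dot (s (- delta) x y) (P x y)) (dot (s (- delta) x y) (Q x y)).
    intros B1 B c r.
    assert (eB1 : B1 = C (x * y) * x * B / y).
    { apply (Rmult_eq_reg_l (y ^ 2 / 4)); [|nra]. rewrite r. field. lra. }
    rewrite eB1 in c. apply (Rmult_eq_reg_l (y / 4)); [|lra].
    match type of c with ?l = ?rr =>
      transitivity (l - (2 * (C (x * y) * x / 4) * B)); [field; lra|];
      rewrite c; field; lra end. }
  (* [dot e w] is eliminated between [eqA] and [eqB]. Since the angle is a function of [x * y], the
     same [C1] occurs in both and can be divided out. *)
  assert (eqAB : forall x y, S x y ->
      y ^ 3 * dot (s delta x y) (P x y) = x ^ 3 * dot (s (- delta) x y) (Q x y)).
  { intros x y k. destruct (h x y (hSU x y k)) as [[_ [_ [_ hC]]] _].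
    apply (Rmult_eq_reg_l (C1 (x * y))); [|exact hC].
    pose proof (eqA x y k) as a. pose proof (eqB x y k) as b.
    transitivity (y * (y ^ 2 * C1 (x * y) * dot (s delta x y) (P x y))); [ring|].
    transitivity (x * (x ^ 2 * C1 (x * y) * dot (s (- delta) x y) (Q x y))); [|ring].
    rewrite a, b. ring. }
  assert (k0 : S x0 y0) by apply square_center.
  destruct (h x0 y0 h0) as [[hx [hy [_ hC]]] _].
  (* In [x], the left side of [eqAB] is linear and the right side cubic, by [dAx] and [dBx];
     comparing logarithmic derivatives forces both to vanish. *)
  assert (zB : dot (s (- delta) x0 y0) (Q x0 y0) = 0).
  { pose proof (is_derive_mulR (fun _ => y0 ^ 3) _ x0 _ _
                  (is_derive_const (y0 ^ 3) x0) (dAx x0 y0 k0)) as a.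
    assert (d3 : is_derive (fun t => t ^ 3) x0 (3 * x0 ^ 2))
      by (auto_derive; [exact I|ring]).
    pose proof (is_derive_mulR _ _ x0 _ _ d3 (dBx x0 y0 k0)) as b.
    apply (is_derive_ext_open_u _ _ x0 y0 _ S hS k0 (fun t ht => eqAB t y0 ht)) in a.
    pose proof (is_derive_unique_eq _ _ _ _ a b) as c. cbv beta in c.
    change (@zero R_NormedModule) with 0 in c.
    pose proof (eqAB x0 y0 k0) as r.
    assert (c' : x0 ^ 2 * dot (s (- delta) x0 y0) (Q x0 y0) =
                 3 * x0 ^ 2 * dot (s (- delta) x0 y0) (Q x0 y0)).
    { transitivity (x0 ^ 3 * dot (s (- delta) x0 y0) (Q x0 y0) / x0); [field; lra|].
      rewrite <- r. transitivity (0 * dot (s delta x0 y0) (P x0 y0) +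
        y0 ^ 3 * (dot (s delta x0 y0) (P x0 y0) / x0)); [field; lra|].
      rewrite c. ring. }
    assert (0 < x0 ^ 2) by nra. nra. }
  assert (zA : dot (s delta x0 y0) (P x0 y0) = 0).
  { pose proof (eqAB x0 y0 k0) as r. rewrite zB, Rmult_0_r in r.
    apply Rmult_integral in r as [r|r]; [|exact r].
    destruct (pow_nonzero y0 3 ltac:(lra) r). }
  assert (zg : dot e (w x0 y0) = 0).
  { pose proof (eqA x0 y0 k0) as r. rewrite zA, Rmult_0_r in r.
    assert (delta <> 0) by (intros ->; lra).
    symmetry in r. apply Rmult_integral in r as [r|r]; [nra|exact r]. }
  assert (zA2 : dot (s delta x0 y0) (Q x0 y0) = 0).
  { pose proof (rel1 x0 y0 k0) as r. rewrite zA, Rmult_0_r in r.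
    symmetry in r. apply Rmult_integral in r as [r|r]; [nra|exact r]. }
  assert (zB1 : dot (s (- delta) x0 y0) (P x0 y0) = 0).
  { pose proof (rel2 x0 y0 k0) as r. rewrite zB, Rmult_0_r in r.
    apply Rmult_integral in r as [r|r]; [nra|exact r]. }
  unfold s in zA, zA2, zB, zB1.
  rewrite dot_vadd_l, dot_vscal_l in zA, zA2, zB, zB1.
  (* [e] is half the sum of [s delta] and [s (- delta)], both of which are now orthogonal to the
     tangent plane. *)
  assert (dot e e = 0).
  { apply (basis_orthogonal (P x0 y0) (Q x0 y0)); [exact (hi x0 y0 h0)|lra|lra|exact zg]. }
  lra.
Qed.

(** * Rotation fields of pseudospherical surfaces *)

(** For the first net [K] is [cos (omega / 2) ^ 2], for the second it is [sin (omega / 2) ^ 2]. In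
    both cases [1 / (1 - K) ^ 2] is the fourth power of the cosecant or secant, and [2 * K - 1] is
    the cosine of the angle of the net. Prescribing only the square of [L] avoids following its
    sign. *)
Definition profile_net (eps zm : R) (K : R -> R) (U : R -> R -> Prop)
    (eta : R -> R -> V3) : Prop :=
  forall x y, U x y ->
    (0 < x /\ 0 < y /\ x * y < zm) /\
    fE eta x y = 4 / ((1 - K (x * y)) ^ 2 * x ^ 2) /\
    fF eta x y = 4 * (2 * K (x * y) - 1) / ((1 - K (x * y)) ^ 2 * (x * y)) /\
    fG eta x y = 4 / ((1 - K (x * y)) ^ 2 * y ^ 2) /\
    fM eta x y = 0 /\ fN eta x y = eps * fL eta x y /\
    fL eta x y ^ 2 = 4 * K (x * y) / (1 - K (x * y)).

(** Cramer coefficients of [z] in the frame [X], [Y], [cross X Y]. As explicit quotients, they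
    inherit derivability from the frame and from [z]. *)
Definition gram1 (X Y z : V3) : R :=
  (dot z X * dot Y Y - dot z Y * dot X Y) / dot (cross X Y) (cross X Y).
Definition gram2 (X Y z : V3) : R :=
  (dot z Y * dot X X - dot z X * dot X Y) / dot (cross X Y) (cross X Y).
Definition gram3 (X Y z : V3) : R :=
  dot z (cross X Y) / dot (cross X Y) (cross X Y).

Lemma frame_decomp (X Y z : V3) :
  cross X Y <> (0, 0, 0) ->
  z = vadd (vadd (vscal (gram1 X Y z) X) (vscal (gram2 X Y z) Y))
           (vscal (gram3 X Y z) (cross X Y)).
Proof.
  intros hw. pose proof (dot_self_gt0 _ hw) as p.
  assert (h : forall v, dot v z = gram1 X Y z * dot v X + gram2 X Y z * dot v Y +
                             gram3 X Y z * dot v (cross X Y)).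
  { intros v. pose proof (dot_gram X Y v z) as g. unfold gram1, gram2, gram3.
    apply (Rmult_eq_reg_l (dot (cross X Y) (cross X Y))); [|lra]. rewrite g.
    field. lra. }
  generalize dependent (gram1 X Y z). generalize dependent (gram2 X Y z).
  generalize dependent (gram3 X Y z). intros g3 g2 g1 h.
  pose proof (h (1, 0, 0)) as h1. pose proof (h (0, 1, 0)) as h2.
  pose proof (h (0, 0, 1)) as h3. revert h1 h2 h3. vec. intros h1 h2 h3.
  destruct z as [[z1 z2] z3]. cbn in *. repeat f_equal; lra.
Qed.

Lemma frame_free (X Y : V3) (s t r : R) :
  cross X Y <> (0, 0, 0) ->
  vadd (vadd (vscal s X) (vscal t Y)) (vscal r (cross X Y)) = (0, 0, 0) ->
  s = 0 /\ t = 0 /\ r = 0.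
Proof.
  intros hw h. pose proof (dot_self_gt0 _ hw) as p.
  set (z := vadd (vadd (vscal s X) (vscal t Y)) (vscal r (cross X Y))) in h.
  assert (e1 : s * dot (cross X Y) (cross X Y) = dot z X * dot Y Y - dot z Y * dot X Y)
    by (unfold z; vec; ring).
  assert (e2 : t * dot (cross X Y) (cross X Y) = dot z Y * dot X X - dot z X * dot X Y)
    by (unfold z; vec; ring).
  assert (e3 : r * dot (cross X Y) (cross X Y) = dot z (cross X Y))
    by (unfold z; vec; ring).
  rewrite h in e1, e2, e3.
  assert (n : forall v, dot (0, 0, 0) v = 0) by (intros; vec; ring).
  rewrite (n X), (n Y) in e1, e2. rewrite n in e3.
  repeat split; apply (Rmult_eq_reg_r (dot (cross X Y) (cross X Y))); lra.
Qed.

(** When [xi_x = eta x psi_x] is differentiated along [y] and [xi_y = eta x psi_y] along [x], the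
    terms [eta x psi_xy] agree and drop out. *)
Lemma rotation_field_cross (U : R -> R -> Prop) (eta psi : R -> R -> V3) :
  open2 U -> smooth3 U eta -> smooth3 U psi -> rotation_field U eta psi ->
  forall x y, U x y ->
    cross (dv eta x y) (du psi x y) = cross (du eta x y) (dv psi x y).
Proof.
  intros hU he hp [xi [hx h]] x y k.
  assert (a : dv (du xi) x y =
    vadd (cross (dv eta x y) (du psi x y)) (cross (eta x y) (dv (du psi) x y))).
  { apply is_derive3_dv.
    apply is_derive3_ext_loc with (f := fun t => cross (eta x t) (du psi x t)).
    - apply filter_imp with (2 := locally_2d_1d_const_x U x y (hU x y k)).
      intros t ht. symmetry. apply (h x t ht).
    - apply (is_derive3_cross (fun t => eta x t) (fun t => du psi x t));
        apply (smooth3_is_derive_v U); auto using smooth3_du. }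
  assert (b : du (dv xi) x y =
    vadd (cross (du eta x y) (dv psi x y)) (cross (eta x y) (du (dv psi) x y))).
  { apply is_derive3_du.
    apply is_derive3_ext_loc with (f := fun t => cross (eta t y) (dv psi t y)).
    - apply filter_imp with (2 := locally_2d_1d_const_y U x y (hU x y k)).
      intros t ht. symmetry. apply (h t y ht).
    - apply (is_derive3_cross (fun t => eta t y) (fun t => dv psi t y));
        apply (smooth3_is_derive_u U); auto using smooth3_dv. }
  rewrite (smooth3_schwarz U xi x y hU hx k), b, (smooth3_schwarz U psi x y hU hp k) in a.
  revert a. generalize (cross (dv eta x y) (du psi x y)) (cross (du eta x y) (dv psi x y))
    (cross (eta x y) (du (dv psi) x y)).
  intros p q r a. destruct p as [[p1 p2] p3], q as [[q1 q2] q3], r as [[r1 r2] r3].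
  unfold vadd, c1, c2, c3 in a. cbn in a. injection a as a1 a2 a3.
  repeat f_equal; lra.
Qed.

(** [P] is tangent because [dot P (cross X Y) = dot X (cross Y P) = dot X (cross X Q) = 0], and
    likewise [Q]. Both sides of the hypothesis are then multiples of [cross X Y], and comparing them
    links the two diagonal coefficients. *)
Lemma rotation_field_tangent (X Y P Q : V3) :
  cross X Y <> (0, 0, 0) -> cross Y P = cross X Q ->
  P = vadd (vscal (gram1 X Y P) X) (vscal (gram2 X Y P) Y) /\
  Q = vadd (vscal (gram1 X Y Q) X) (vscal (- gram1 X Y P) Y).
Proof.
  intros hw h. pose proof (dot_self_gt0 _ hw) as p.
  assert (hP : dot P (cross X Y) = 0).
  { transitivity (dot X (cross Y P)); [vec; ring|]. rewrite h. vec. ring. }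
  assert (hQ : dot Q (cross X Y) = 0).
  { transitivity (- dot Y (cross X Q)); [vec; ring|]. rewrite <- h. vec. ring. }
  pose proof (frame_decomp X Y P hw) as dP. pose proof (frame_decomp X Y Q hw) as dQ.
  assert (g3 : gram3 X Y P = 0) by (unfold gram3; rewrite hP; unfold Rdiv; ring).
  assert (g3' : gram3 X Y Q = 0) by (unfold gram3; rewrite hQ; unfold Rdiv; ring).
  rewrite g3 in dP. rewrite g3' in dQ.
  assert (dP' : P = vadd (vscal (gram1 X Y P) X) (vscal (gram2 X Y P) Y)).
  { rewrite dP at 1. apply V3_eq; vec; ring. }
  assert (dQ' : Q = vadd (vscal (gram1 X Y Q) X) (vscal (gram2 X Y Q) Y)).
  { rewrite dQ at 1. apply V3_eq; vec; ring. }
  split; [exact dP'|].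
  enough (e : gram2 X Y Q = - gram1 X Y P) by (rewrite <- e; exact dQ').
  assert (k : dot (cross Y P) (cross X Y) = dot (cross X Q) (cross X Y)) by now rewrite h.
  rewrite dP', dQ' in k.
  set (a := gram1 X Y P) in *. set (b := gram2 X Y P) in *.
  set (c := gram1 X Y Q) in *. set (d := gram2 X Y Q) in *. clearbody a b c d.
  assert (k1 : dot (cross Y (vadd (vscal a X) (vscal b Y))) (cross X Y) =
               - a * dot (cross X Y) (cross X Y)) by (vec; ring).
  assert (k2 : dot (cross X (vadd (vscal c X) (vscal d Y))) (cross X Y) =
               d * dot (cross X Y) (cross X Y)) by (vec; ring).
  nra.
Qed.

Lemma ex_derive_gram_quot (f1 f2 f3 f4 f5 : R -> R) (t : R) :
  ex_derive f1 t -> ex_derive f2 t -> ex_derive f3 t -> ex_derive f4 t -> ex_derive f5 t ->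
  f5 t <> 0 -> ex_derive (fun s => (f1 s * f2 s - f3 s * f4 s) / f5 s) t.
Proof. intros. auto_derive. repeat split; auto. Qed.

Lemma gram1_derivable (X Y z : R -> V3) (t : R) (X' Y' z' : V3) :
  cross (X t) (Y t) <> (0, 0, 0) ->
  is_derive3 X t X' -> is_derive3 Y t Y' -> is_derive3 z t z' ->
  ex_derive (fun s => gram1 (X s) (Y s) (z s)) t.
Proof.
  intros hw hX hY hz. pose proof (dot_self_gt0 _ hw).
  pose proof (is_derive3_cross _ _ t _ _ hX hY) as hc.
  apply (ex_derive_gram_quot (fun s => dot (z s) (X s)) (fun s => dot (Y s) (Y s))
    (fun s => dot (z s) (Y s)) (fun s => dot (X s) (Y s))
    (fun s => dot (cross (X s) (Y s)) (cross (X s) (Y s))));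
    try (eexists; eapply is_derive_dot; eassumption). cbv beta. lra.
Qed.

Lemma gram2_derivable (X Y z : R -> V3) (t : R) (X' Y' z' : V3) :
  cross (X t) (Y t) <> (0, 0, 0) ->
  is_derive3 X t X' -> is_derive3 Y t Y' -> is_derive3 z t z' ->
  ex_derive (fun s => gram2 (X s) (Y s) (z s)) t.
Proof.
  intros hw hX hY hz. pose proof (dot_self_gt0 _ hw).
  pose proof (is_derive3_cross _ _ t _ _ hX hY) as hc.
  apply (ex_derive_gram_quot (fun s => dot (z s) (Y s)) (fun s => dot (X s) (X s))
    (fun s => dot (z s) (X s)) (fun s => dot (X s) (Y s))
    (fun s => dot (cross (X s) (Y s)) (cross (X s) (Y s))));
    try (eexists; eapply is_derive_dot; eassumption). cbv beta. lra.
Qed.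

(* Gamma^1_11, Gamma^2_22, Gamma^1_12, Gamma^2_12 for a profile net. *)
Definition chr_xx (K K1 : R -> R) (x y : R) : R := y * K1 (x * y) / (1 - K (x * y)) - / x.
Definition chr_yy (K K1 : R -> R) (x y : R) : R := x * K1 (x * y) / (1 - K (x * y)) - / y.
Definition chr_xy1 (K K1 : R -> R) (x y : R) : R :=
  x * K1 (x * y) / (2 * K (x * y) * (1 - K (x * y))).
Definition chr_xy2 (K K1 : R -> R) (x y : R) : R :=
  y * K1 (x * y) / (2 * K (x * y) * (1 - K (x * y))).

(** Derivatives along [x] suffice: [K] depends on the product, and exchanging the variables
    exchanges [E] and [G]. *)
Lemma is_derive_profile_E (K : R -> R) (x y k1 : R) :
  K (x * y) < 1 -> 0 < x -> is_derive K (x * y) k1 ->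
  is_derive (fun t => 4 / ((1 - K (t * y)) ^ 2 * t ^ 2)) x
    (8 * y * k1 / ((1 - K (x * y)) ^ 3 * x ^ 2) - 8 / ((1 - K (x * y)) ^ 2 * x ^ 3)).
Proof.
  intros hk hx h. pose proof (is_derive_xy_u K x y k1 h) as h'.
  assert (hk' : 1 - K (x * y) <> 0) by lra.
  set (f := fun t => K (t * y)) in *. change (K (x * y)) with (f x) in *.
  apply is_derive_ext with (f := fun t => 4 / ((1 - f t) ^ 2 * t ^ 2)); [reflexivity|].
  auto_derive.
  - split; [eexists; exact h'|]. split; [|exact I].
    repeat apply Rmult_integral_contrapositive_currified; try lra.
  - replace (Derive (fun x0 => f x0) x) with (y * k1)
      by (symmetry; apply is_derive_unique; exact h').
    field. split; lra.
Qed.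

Lemma is_derive_profile_G (K : R -> R) (x y k1 : R) :
  K (x * y) < 1 -> 0 < y -> is_derive K (x * y) k1 ->
  is_derive (fun t => 4 / ((1 - K (t * y)) ^ 2 * y ^ 2)) x
    (8 * y * k1 / ((1 - K (x * y)) ^ 3 * y ^ 2)).
Proof.
  intros hk hx h. pose proof (is_derive_xy_u K x y k1 h) as h'.
  assert (hk' : 1 - K (x * y) <> 0) by lra.
  set (f := fun t => K (t * y)) in *. change (K (x * y)) with (f x) in *.
  apply is_derive_ext with (f := fun t => 4 / ((1 - f t) ^ 2 * y ^ 2)); [reflexivity|].
  auto_derive.
  - split; [eexists; exact h'|]. split; [|exact I].
    repeat apply Rmult_integral_contrapositive_currified; try lra.
  - replace (Derive (fun x0 => f x0) x) with (y * k1)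
      by (symmetry; apply is_derive_unique; exact h').
    field. split; lra.
Qed.

Lemma is_derive_profile_F (K : R -> R) (x y k1 : R) :
  K (x * y) < 1 -> 0 < x -> 0 < y -> is_derive K (x * y) k1 ->
  is_derive (fun t => 4 * (2 * K (t * y) - 1) / ((1 - K (t * y)) ^ 2 * (t * y))) x
    (8 * K (x * y) * k1 / ((1 - K (x * y)) ^ 3 * x)
     - 4 * (2 * K (x * y) - 1) / ((1 - K (x * y)) ^ 2 * (x ^ 2 * y))).
Proof.
  intros hk hx hy h. pose proof (is_derive_xy_u K x y k1 h) as h'.
  assert (hk' : 1 - K (x * y) <> 0) by lra.
  set (f := fun t => K (t * y)) in *. change (K (x * y)) with (f x) in *.
  apply is_derive_ext with (f := fun t => 4 * (2 * f t - 1) / ((1 - f t) ^ 2 * (t * y)));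
    [reflexivity|].
  auto_derive.
  - split; [eexists; exact h'|]. split; [eexists; exact h'|]. split; [|exact I].
    repeat apply Rmult_integral_contrapositive_currified; try lra.
  - replace (Derive (fun x0 => f x0) x) with (y * k1)
      by (symmetry; apply is_derive_unique; exact h').
    field. repeat split; lra.
Qed.

Lemma is_derive_sqr_norm_u (U : R -> R -> Prop) (f : R -> R -> V3) (g : R -> R) (x y l : R) :
  open2 U -> smooth3 U f -> U x y ->
  (forall t, U t y -> dot (f t y) (f t y) = g t) -> is_derive g x l ->
  dot (du f x y) (f x y) = l / 2.
Proof.
  intros hU hf k h hg. pose proof (smooth3_is_derive_u U f x y hf k) as d.
  pose proof (is_derive_dot _ _ x _ _ d d) as a.
  apply (is_derive_ext_open_u _ g x y _ U hU k h) in a.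
  pose proof (is_derive_unique_eq _ _ _ _ a hg) as b. cbv beta in b.
  rewrite (dot_comm (f x y)) in b. lra.
Qed.

Lemma is_derive_sqr_norm_v (U : R -> R -> Prop) (f : R -> R -> V3) (g : R -> R) (x y l : R) :
  open2 U -> smooth3 U f -> U x y ->
  (forall t, U x t -> dot (f x t) (f x t) = g t) -> is_derive g y l ->
  dot (dv f x y) (f x y) = l / 2.
Proof.
  intros hU hf k h hg. pose proof (smooth3_is_derive_v U f x y hf k) as d.
  pose proof (is_derive_dot _ _ y _ _ d d) as a.
  apply (is_derive_ext_open_v _ g x y _ U hU k h) in a.
  pose proof (is_derive_unique_eq _ _ _ _ a hg) as b. cbv beta in b.
  rewrite (dot_comm (f x y)) in b. lra.
Qed.

Lemma is_derive_dot_u (U : R -> R -> Prop) (f g : R -> R -> V3) (h : R -> R) (x y l : R) :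
  open2 U -> smooth3 U f -> smooth3 U g -> U x y ->
  (forall t, U t y -> dot (f t y) (g t y) = h t) -> is_derive h x l ->
  dot (du f x y) (g x y) + dot (du g x y) (f x y) = l.
Proof.
  intros hU hf hg k e hh.
  pose proof (is_derive_dot _ _ x _ _ (smooth3_is_derive_u U f x y hf k)
                (smooth3_is_derive_u U g x y hg k)) as a.
  apply (is_derive_ext_open_u _ h x y _ U hU k e) in a.
  pose proof (is_derive_unique_eq _ _ _ _ a hh) as b. cbv beta in b.
  rewrite (dot_comm (f x y)) in b. exact b.
Qed.

Lemma is_derive_dot_v (U : R -> R -> Prop) (f g : R -> R -> V3) (h : R -> R) (x y l : R) :
  open2 U -> smooth3 U f -> smooth3 U g -> U x y ->
  (forall t, U x t -> dot (f x t) (g x t) = h t) -> is_derive h y l ->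
  dot (dv f x y) (g x y) + dot (dv g x y) (f x y) = l.
Proof.
  intros hU hf hg k e hh.
  pose proof (is_derive_dot _ _ y _ _ (smooth3_is_derive_v U f x y hf k)
                (smooth3_is_derive_v U g x y hg k)) as a.
  apply (is_derive_ext_open_v _ h x y _ U hU k e) in a.
  pose proof (is_derive_unique_eq _ _ _ _ a hh) as b. cbv beta in b.
  rewrite (dot_comm (f x y)) in b. exact b.
Qed.

Section ProfileNet.

Context (eps zm : R) (K K1 K2 : R -> R) (U : R -> R -> Prop) (eta : R -> R -> V3)
  (A : angle_profile eps zm K K1 K2) (hi : immersion U eta)
  (hN : profile_net eps zm K U eta).

Let X := du eta.
Let Y := dv eta.
Let w x y := cross (X x y) (Y x y).

Lemma profile_net_z (x y : R) : U x y -> 0 < x * y < zm.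
Proof. intros k. destruct (hN x y k) as [[hx [hy hz]] _]. nra. Qed.

Lemma profile_net_area (x y : R) :
  U x y -> dot (w x y) (w x y) = 64 * K (x * y) / ((1 - K (x * y)) ^ 3 * (x * y) ^ 2).
Proof.
  intros k. pose proof (ap_range _ _ _ _ _ A _ (profile_net_z x y k)) as r.
  destruct (hN x y k) as [[hx [hy hz]] [hE [hF [hG _]]]].
  unfold w. rewrite dot_cross_cross. unfold fE, fF, fG in hE, hF, hG.
  fold X Y in hE, hF, hG. rewrite hE, hF, hG. field. repeat split; lra.
Qed.

(** Gauss formulas, with normal components measured in [w]: [l] is [L / norm3 w]. [Gamma^2_11] and
    [Gamma^1_22] are absent because the coordinate lines are geodesics, a fact recovered here from
    the metric. *)
Lemma profile_net_christoffel (x y : R) :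
  U x y -> exists l,
    du X x y = vadd (vscal (chr_xx K K1 x y) (X x y)) (vscal l (w x y)) /\
    dv X x y = vadd (vscal (chr_xy1 K K1 x y) (X x y)) (vscal (chr_xy2 K K1 x y) (Y x y)) /\
    du Y x y = vadd (vscal (chr_xy1 K K1 x y) (X x y)) (vscal (chr_xy2 K K1 x y) (Y x y)) /\
    dv Y x y = vadd (vscal (chr_yy K K1 x y) (Y x y)) (vscal (eps * l) (w x y)) /\
    l ^ 2 * dot (w x y) (w x y) = 4 * K (x * y) / (1 - K (x * y)).
Proof.
  intros k. pose proof (profile_net_z x y k) as hz.
  pose proof (ap_range _ _ _ _ _ A _ hz) as r.
  pose proof (ap_derive _ _ _ _ _ A _ hz) as dK.
  pose proof (profile_net_area x y k) as hD.
  destruct hi as [[_ hU] [hs hi']]. pose proof (hi' x y k) as hw. clear hi'.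
  destruct (hN x y k) as [[hx [hy _]] [hE [hF [hG [hM [hNN hL]]]]]].
  pose proof (smooth3_du U eta hs) as hsX. pose proof (smooth3_dv U eta hs) as hsY.
  fold X in hsX. fold Y in hsY.
  assert (sw : dv X x y = du Y x y) by (apply (smooth3_schwarz U); auto).
  assert (dK' : is_derive K (y * x) (K1 (x * y))) by (rewrite (Rmult_comm y x); exact dK).
  assert (r1 : K (x * y) < 1) by lra.
  assert (r1' : K (y * x) < 1) by (rewrite (Rmult_comm y x); exact r1).
  pose proof (is_derive_sqr_norm_u U X _ x y _ hU hsX k
    (fun t ht => proj1 (proj2 (hN t y ht))) (is_derive_profile_E K x y _ r1 hx dK)) as a1.
  pose proof (is_derive_sqr_norm_u U Y _ x y _ hU hsY k
    (fun t ht => proj1 (proj2 (proj2 (proj2 (hN t y ht)))))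
    (is_derive_profile_G K x y _ r1 hy dK)) as a2.
  pose proof (is_derive_dot_u U X Y _ x y _ hU hsX hsY k
    (fun t ht => proj1 (proj2 (proj2 (hN t y ht)))) (is_derive_profile_F K x y _ r1 hx hy dK)) as a3.
  (* Derivatives along [y] reuse the formulas for [x] with the variables exchanged, hence [t * x] in
     place of [x * t]. *)
  pose proof (fun l => is_derive_sqr_norm_v U X (fun t => 4 / ((1 - K (t * x)) ^ 2 * x ^ 2))
    x y l hU hsX k) as a4.
  specialize (a4 _ ltac:(intros t ht; cbv beta; rewrite (Rmult_comm t x); apply (hN x t ht))
    (is_derive_profile_G K y x _ r1' hx dK')).
  pose proof (fun l => is_derive_sqr_norm_v U Y (fun t => 4 / ((1 - K (t * x)) ^ 2 * t ^ 2))
    x y l hU hsY k) as a5.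
  specialize (a5 _ ltac:(intros t ht; cbv beta; rewrite (Rmult_comm t x); apply (hN x t ht))
    (is_derive_profile_E K y x _ r1' hy dK')).
  pose proof (fun l => is_derive_dot_v U X Y
    (fun t => 4 * (2 * K (t * x) - 1) / ((1 - K (t * x)) ^ 2 * (t * x)))
    x y l hU hsX hsY k) as a6.
  specialize (a6 _ ltac:(intros t ht; cbv beta; rewrite (Rmult_comm t x); apply (hN x t ht))
    (is_derive_profile_F K y x _ r1' hy hx dK')).
  rewrite (Rmult_comm y x) in a4, a5, a6.
  rewrite <- sw in a2, a3.
  change (dot (X x y) (X x y) = 4 / ((1 - K (x * y)) ^ 2 * x ^ 2)) in hE.
  change (dot (X x y) (Y x y) = 4 * (2 * K (x * y) - 1) / ((1 - K (x * y)) ^ 2 * (x * y)))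
    in hF.
  change (dot (Y x y) (Y x y) = 4 / ((1 - K (x * y)) ^ 2 * y ^ 2)) in hG.
  unfold fL, fM, fN in hM, hNN, hL. rewrite dot_normal in hM, hL. rewrite !dot_normal in hNN.
  fold X Y in hM, hNN, hL, hw. fold (w x y) in hM, hNN, hL, hw.
  pose proof (norm3_pos _ hw) as hn.
  assert (hM' : dot (dv X x y) (w x y) = 0).
  { apply (Rmult_eq_reg_r (/ norm3 (w x y))); [|apply Rinv_neq_0_compat; lra].
    rewrite Rmult_0_l. exact hM. }
  assert (hN' : dot (dv Y x y) (w x y) = eps * dot (du X x y) (w x y)).
  { apply (Rmult_eq_reg_r (/ norm3 (w x y))); [|apply Rinv_neq_0_compat; lra].
    unfold Rdiv in hNN. rewrite hNN. ring. }
  assert (hL' : (dot (du X x y) (w x y) / dot (w x y) (w x y)) ^ 2 * dot (w x y) (w x y) =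
                4 * K (x * y) / (1 - K (x * y))).
  { rewrite <- hL, <- norm3_sqr. field. lra. }
  exists (dot (du X x y) (w x y) / dot (w x y) (w x y)).
  rewrite <- sw.
  pose proof (frame_decomp (X x y) (Y x y) (du X x y) hw) as d1.
  pose proof (frame_decomp (X x y) (Y x y) (dv X x y) hw) as d2.
  pose proof (frame_decomp (X x y) (Y x y) (dv Y x y) hw) as d3.
  assert (hx0 : x <> 0) by lra. assert (hy0 : y <> 0) by lra.
  assert (hk0 : K (x * y) <> 0) by lra. assert (hk1 : 1 - K (x * y) <> 0) by lra.
  (* This is [F_x - E_y / 2], and [b2] is [F_y - G_x / 2]. *)
  assert (b1 : dot (du X x y) (Y x y) =
    8 * K (x * y) * K1 (x * y) / ((1 - K (x * y)) ^ 3 * x)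
     - 4 * (2 * K (x * y) - 1) / ((1 - K (x * y)) ^ 2 * (x ^ 2 * y))
     - 8 * x * K1 (x * y) / ((1 - K (x * y)) ^ 3 * x ^ 2) / 2) by lra.
  assert (b2 : dot (dv Y x y) (X x y) =
    8 * K (x * y) * K1 (x * y) / ((1 - K (x * y)) ^ 3 * y)
     - 4 * (2 * K (x * y) - 1) / ((1 - K (x * y)) ^ 2 * (y ^ 2 * x))
     - 8 * y * K1 (x * y) / ((1 - K (x * y)) ^ 3 * y ^ 2) / 2) by lra.
  unfold gram1, gram2, gram3 in d1, d2, d3. fold (w x y) in d1, d2, d3.
  rewrite a1, b1 in d1. rewrite a2, a4, hM' in d2. rewrite a5, b2, hN' in d3.
  unfold chr_xx, chr_yy, chr_xy1, chr_xy2.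
  set (Dw := dot (w x y) (w x y)) in *.
  assert (hD0 : Dw <> 0) by (unfold Dw; rewrite <- norm3_sqr; apply pow_nonzero; lra).
  assert (z3 : forall v v', vadd (vadd (vscal 0 v) v') (vscal 0 (w x y)) = v')
    by (intros; apply V3_eq; vec; ring).
  split; [|split; [|split; [|split]]]; [| | | |exact hL'].
  - rewrite d1 at 1. rewrite hE, hF, hG.
    match goal with |- vadd (vadd (vscal ?p _) (vscal ?q _)) _ = vadd (vscal ?p' _) _ =>
      assert (e1 : p = p'); [|assert (e2 : q = 0); [|rewrite e1, e2]] end.
    + rewrite hD. field. repeat split; lra.
    + rewrite hD. field. repeat split; lra.
    + apply V3_eq; vec; ring.
  - rewrite d2 at 1. rewrite hE, hF, hG.
    match goal with |- vadd (vadd (vscal ?p _) (vscal ?q _)) (vscal ?r _) =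
                       vadd (vscal ?p' _) (vscal ?q' _) =>
      assert (e1 : p = p'); [|assert (e2 : q = q'); [|assert (e3 : r = 0);
        [|rewrite e1, e2, e3]]] end.
    + rewrite hD. field. repeat split; lra.
    + rewrite hD. field. repeat split; lra.
    + unfold Rdiv. ring.
    + apply V3_eq; vec; ring.
  - rewrite d2 at 1. rewrite hE, hF, hG.
    match goal with |- vadd (vadd (vscal ?p _) (vscal ?q _)) (vscal ?r _) =
                       vadd (vscal ?p' _) (vscal ?q' _) =>
      assert (e1 : p = p'); [|assert (e2 : q = q'); [|assert (e3 : r = 0);
        [|rewrite e1, e2, e3]]] end.
    + rewrite hD. field. repeat split; lra.
    + rewrite hD. field. repeat split; lra.
    + unfold Rdiv. ring.
    + apply V3_eq; vec; ring.
  - rewrite d3 at 1. rewrite hE, hF, hG.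
    match goal with |- vadd (vadd (vscal ?p _) (vscal ?q _)) (vscal ?r _) =
                       vadd (vscal ?q' _) (vscal ?r' _) =>
      assert (e1 : p = 0); [|assert (e2 : q = q'); [|assert (e3 : r = r');
        [|rewrite e1, e2, e3]]] end.
    + rewrite hD. field. repeat split; lra.
    + rewrite hD. field. repeat split; lra.
    + field. exact hD0.
    + apply V3_eq; vec; ring.
Qed.

End ProfileNet.

(** * Integrability conditions for the coefficients [a] and [b] *)

Lemma du_combination (U : R -> R -> Prop) (f X Y : R -> R -> V3) (a b : R -> R -> R)
    (x y ax bx : R) :
  open2 U -> smooth3 U X -> smooth3 U Y -> U x y ->
  (forall s t, U s t -> f s t = vadd (vscal (a s t) (X s t)) (vscal (b s t) (Y s t))) ->
  is_derive (fun t => a t y) x ax -> is_derive (fun t => b t y) x bx ->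
  du f x y = vadd (vadd (vscal ax (X x y)) (vscal (a x y) (du X x y)))
                  (vadd (vscal bx (Y x y)) (vscal (b x y) (du Y x y))).
Proof.
  intros hU hX hY k h ha hb. apply is_derive3_du.
  apply is_derive3_ext_loc with
    (f := fun t => vadd (vscal (a t y) (X t y)) (vscal (b t y) (Y t y))).
  - apply filter_imp with (2 := locally_2d_1d_const_y U x y (hU x y k)).
    intros t ht. symmetry. exact (h t y ht).
  - apply (is_derive3_vadd (fun t => vscal (a t y) (X t y)) (fun t => vscal (b t y) (Y t y))).
    + apply (is_derive3_vscal (fun t => a t y) (fun t => X t y)); [exact ha|].
      exact (smooth3_is_derive_u U X x y hX k).
    + apply (is_derive3_vscal (fun t => b t y) (fun t => Y t y)); [exact hb|].
      exact (smooth3_is_derive_u U Y x y hY k).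
Qed.

Lemma dv_combination (U : R -> R -> Prop) (f X Y : R -> R -> V3) (a b : R -> R -> R)
    (x y ay bY : R) :
  open2 U -> smooth3 U X -> smooth3 U Y -> U x y ->
  (forall s t, U s t -> f s t = vadd (vscal (a s t) (X s t)) (vscal (b s t) (Y s t))) ->
  is_derive (fun t => a x t) y ay -> is_derive (fun t => b x t) y bY ->
  dv f x y = vadd (vadd (vscal ay (X x y)) (vscal (a x y) (dv X x y)))
                  (vadd (vscal bY (Y x y)) (vscal (b x y) (dv Y x y))).
Proof.
  intros hU hX hY k h ha hb. apply is_derive3_dv.
  apply is_derive3_ext_loc with
    (f := fun t => vadd (vscal (a x t) (X x t)) (vscal (b x t) (Y x t))).
  - apply filter_imp with (2 := locally_2d_1d_const_x U x y (hU x y k)).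
    intros t ht. symmetry. exact (h x t ht).
  - apply (is_derive3_vadd (fun t => vscal (a x t) (X x t)) (fun t => vscal (b x t) (Y x t))).
    + apply (is_derive3_vscal (fun t => a x t) (fun t => X x t)); [exact ha|].
      exact (smooth3_is_derive_v U X x y hX k).
    + apply (is_derive3_vscal (fun t => b x t) (fun t => Y x t)); [exact hb|].
      exact (smooth3_is_derive_v U Y x y hY k).
Qed.

(** The normal component of [psi_xy = psi_yx] forces the coefficient [eps * b] in [psi_y], and the
    two tangential components are the differential equations. The quadratic relation holds because
    [psi] has curvature [- K_eta / (a ^ 2 + eps * b ^ 2)]. *)
Lemma rotation_field_coefficients (eps zm : R) (K K1 K2 : R -> R) (U : R -> R -> Prop)
    (eta psi : R -> R -> V3) :
  angle_profile eps zm K K1 K2 -> immersion U eta -> profile_net eps zm K U eta ->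
  pseudospherical U psi -> rotation_field U eta psi ->
  exists a b : R -> R -> R, forall x y, U x y ->
    (du psi x y = vadd (vscal (a x y) (du eta x y)) (vscal (b x y) (dv eta x y)) /\
     dv psi x y = vadd (vscal (eps * b x y) (du eta x y)) (vscal (- a x y) (dv eta x y))) /\
    a x y ^ 2 + eps * b x y ^ 2 = eps * ((1 - K (x * y)) * (x * y)) ^ 2 / 16 /\
    (exists l,
      dot (du (du psi) x y) (cross (du eta x y) (dv eta x y)) = a x y * l /\
      dot (dv (dv psi) x y) (cross (du eta x y) (dv eta x y)) = - eps * a x y * l) /\
    exists ax ay bx bY,
      (is_derive (fun t => a t y) x ax /\ is_derive (fun t => a x t) y ay /\
       is_derive (fun t => b t y) x bx /\ is_derive (fun t => b x t) y bY) /\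
      ay + 2 * a x y * chr_xy1 K K1 x y = eps * (bx + b x y * chr_xx K K1 x y) /\
      ax + bY + b x y * chr_yy K K1 x y + 2 * a x y * chr_xy2 K K1 x y = 0.
Proof.
  intros A hi hN [hpi hK] hrot.
  pose proof (rotation_field_cross U eta psi (proj2 (proj1 hi)) (proj1 (proj2 hi))
                (proj1 (proj2 hpi)) hrot) as hcr.
  pose proof (profile_net_christoffel eps zm K K1 K2 U eta A hi hN) as chr. cbv zeta in chr.
  pose proof (profile_net_area eps zm K K1 K2 U eta A hN) as area. cbv zeta in area.
  destruct hi as [[_ hU] [hs hi]]. destruct hpi as [_ [hsp hpi]].
  set (X := du eta) in *. set (Y := dv eta) in *.
  set (P := du psi) in *. set (Q := dv psi) in *.
  pose proof (smooth3_du U eta hs) as hsX. pose proof (smooth3_dv U eta hs) as hsY.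
  pose proof (smooth3_du U psi hsp) as hsP. pose proof (smooth3_dv U psi hsp) as hsQ.
  fold X in hsX. fold Y in hsY. fold P in hsP. fold Q in hsQ.
  set (a := fun x y => gram1 (X x y) (Y x y) (P x y)).
  set (b := fun x y => gram2 (X x y) (Y x y) (P x y)).
  set (c := fun x y => gram1 (X x y) (Y x y) (Q x y)).
  assert (dP : forall x y, U x y ->
      P x y = vadd (vscal (a x y) (X x y)) (vscal (b x y) (Y x y)))
    by (intros x y k; apply (rotation_field_tangent (X x y) (Y x y) (P x y) (Q x y));
        [exact (hi x y k)|exact (hcr x y k)]).
  assert (dQ : forall x y, U x y ->
      Q x y = vadd (vscal (c x y) (X x y)) (vscal (- a x y) (Y x y)))
    by (intros x y k; apply (rotation_field_tangent (X x y) (Y x y) (P x y) (Q x y));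
        [exact (hi x y k)|exact (hcr x y k)]).
  assert (ea : forall x y, U x y -> exists ax ay,
      is_derive (fun t => a t y) x ax /\ is_derive (fun t => a x t) y ay).
  { intros x y k.
    destruct (gram1_derivable (fun t => X t y) (fun t => Y t y) (fun t => P t y) x _ _ _
      (hi x y k) (smooth3_is_derive_u U X x y hsX k) (smooth3_is_derive_u U Y x y hsY k)
      (smooth3_is_derive_u U P x y hsP k)) as [ax hax].
    destruct (gram1_derivable (fun t => X x t) (fun t => Y x t) (fun t => P x t) y _ _ _
      (hi x y k) (smooth3_is_derive_v U X x y hsX k) (smooth3_is_derive_v U Y x y hsY k)
      (smooth3_is_derive_v U P x y hsP k)) as [ay hay].
    exists ax, ay. exact (conj hax hay). }
  assert (eb : forall x y, U x y -> exists bx bY,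
      is_derive (fun t => b t y) x bx /\ is_derive (fun t => b x t) y bY).
  { intros x y k.
    destruct (gram2_derivable (fun t => X t y) (fun t => Y t y) (fun t => P t y) x _ _ _
      (hi x y k) (smooth3_is_derive_u U X x y hsX k) (smooth3_is_derive_u U Y x y hsY k)
      (smooth3_is_derive_u U P x y hsP k)) as [bx hbx].
    destruct (gram2_derivable (fun t => X x t) (fun t => Y x t) (fun t => P x t) y _ _ _
      (hi x y k) (smooth3_is_derive_v U X x y hsX k) (smooth3_is_derive_v U Y x y hsY k)
      (smooth3_is_derive_v U P x y hsP k)) as [bY hbY].
    exists bx, bY. exact (conj hbx hbY). }
  assert (ec : forall x y, U x y -> exists cx cy,
      is_derive (fun t => c t y) x cx /\ is_derive (fun t => c x t) y cy).
  { intros x y k.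
    destruct (gram1_derivable (fun t => X t y) (fun t => Y t y) (fun t => Q t y) x _ _ _
      (hi x y k) (smooth3_is_derive_u U X x y hsX k) (smooth3_is_derive_u U Y x y hsY k)
      (smooth3_is_derive_u U Q x y hsQ k)) as [cx hcx].
    destruct (gram1_derivable (fun t => X x t) (fun t => Y x t) (fun t => Q x t) y _ _ _
      (hi x y k) (smooth3_is_derive_v U X x y hsX k) (smooth3_is_derive_v U Y x y hsY k)
      (smooth3_is_derive_v U Q x y hsQ k)) as [cy hcy].
    exists cx, cy. exact (conj hcx hcy). }
  clearbody a b c.
  assert (hKr : forall x y, U x y -> 0 < x /\ 0 < y /\ 0 < K (x * y) < 1).
  { intros x y k. destruct (hN x y k) as [[hx [hy _]] _]. split; [exact hx|].
    split; [exact hy|].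
    exact (ap_range _ _ _ _ _ A _ (profile_net_z eps zm K U eta hN x y k)). }
  (* The identity [c = eps * b] is needed at all points, since it is differentiated later to replace
     [c_x]. *)
  assert (step : forall x y, U x y ->
      c x y = eps * b x y /\
      forall ax ay bx bY cx cy,
      is_derive (fun t => a t y) x ax -> is_derive (fun t => a x t) y ay ->
      is_derive (fun t => b t y) x bx -> is_derive (fun t => b x t) y bY ->
      is_derive (fun t => c t y) x cx -> is_derive (fun t => c x t) y cy ->
      ay + 2 * a x y * chr_xy1 K K1 x y = cx + c x y * chr_xx K K1 x y /\
      ax + bY + b x y * chr_yy K K1 x y + 2 * a x y * chr_xy2 K K1 x y = 0 /\
      exists l, l <> 0 /\
        l ^ 2 = 4 * K (x * y) / (1 - K (x * y)) * dot (cross (X x y) (Y x y)) (cross (X x y) (Y x y)) /\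
        dot (du P x y) (cross (X x y) (Y x y)) = a x y * l /\
        dot (dv P x y) (cross (X x y) (Y x y)) = eps * b x y * l /\
        dot (dv Q x y) (cross (X x y) (Y x y)) = - eps * a x y * l).
  { intros x y k.
    destruct (chr x y k) as [l [cXX [cXY [cYX [cYY hl]]]]].
    destruct (hKr x y k) as [hx [hy hk]].
    pose proof (dot_self_gt0 _ (hi x y k)) as hD.
    assert (hl0 : l <> 0).
    { intros e0. rewrite e0 in hl.
      assert (0 < 4 * K (x * y) / (1 - K (x * y))) by (apply Rdiv_lt_0_compat; lra). lra. }
    assert (main : forall ax ay bx bY cx cy,
      is_derive (fun t => a t y) x ax -> is_derive (fun t => a x t) y ay ->
      is_derive (fun t => b t y) x bx -> is_derive (fun t => b x t) y bY ->
      is_derive (fun t => c t y) x cx -> is_derive (fun t => c x t) y cy ->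
      (ay + 2 * a x y * chr_xy1 K K1 x y - (cx + c x y * chr_xx K K1 x y) = 0 /\
      ax + bY + b x y * chr_yy K K1 x y + 2 * a x y * chr_xy2 K K1 x y = 0 /\
      (eps * b x y - c x y) * l = 0) /\
      du P x y = vadd (vadd (vscal ax (X x y)) (vscal (a x y) (du X x y)))
                  (vadd (vscal bx (Y x y)) (vscal (b x y) (du Y x y))) /\
      dv P x y = vadd (vadd (vscal ay (X x y)) (vscal (a x y) (dv X x y)))
                  (vadd (vscal bY (Y x y)) (vscal (b x y) (dv Y x y))) /\
      dv Q x y = vadd (vadd (vscal cy (X x y)) (vscal (c x y) (dv X x y)))
                  (vadd (vscal (- ay) (Y x y)) (vscal (- a x y) (dv Y x y)))).
    { intros ax ay bx bY cx cy hax hay hbx hbY hcx hcy.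
      pose proof (is_derive_opp _ _ _ hax) as hnx. pose proof (is_derive_opp _ _ _ hay) as hny.
      pose proof (du_combination U P X Y a b x y ax bx hU hsX hsY k dP hax hbx) as p1.
      pose proof (dv_combination U P X Y a b x y ay bY hU hsX hsY k dP hay hbY) as p2.
      pose proof (du_combination U Q X Y c (fun x y => - a x y) x y cx (- ax)
        hU hsX hsY k dQ hcx hnx) as q1.
      pose proof (dv_combination U Q X Y c (fun x y => - a x y) x y cy (- ay)
        hU hsX hsY k dQ hcy hny) as q2.
      split; [|split; [exact p1|split; [exact p2|exact q2]]].
      assert (e : dv P x y = du Q x y) by (apply (smooth3_schwarz U); auto).
      rewrite p2, q1, cXX, cXY, cYX, cYY in e.
      apply (frame_free (X x y) (Y x y) _ _ _ (hi x y k)).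
      match type of e with ?v = ?v' =>
        transitivity (vadd v (vscal (-1) v')); [|rewrite e]; apply V3_eq; vec; ring end. }
    destruct (ea x y k) as [ax [ay [hax hay]]]. destruct (eb x y k) as [bx [bY [hbx hbY]]].
    destruct (ec x y k) as [cx [cy [hcx hcy]]].
    assert (hcb : c x y = eps * b x y).
    { destruct (main ax ay bx bY cx cy hax hay hbx hbY hcx hcy) as [[_ [_ m]] _].
      apply Rmult_integral in m as [m|m]; [lra|contradiction]. }
    split; [exact hcb|].
    clear ax ay bx bY cx cy hax hay hbx hbY hcx hcy.
    intros ax ay bx bY cx cy hax hay hbx hbY hcx hcy.
    destruct (main ax ay bx bY cx cy hax hay hbx hbY hcx hcy)
      as [[m1 [m2 _]] [p1 [p2 q2]]].
    split; [lra|]. split; [exact m2|].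
    set (D := dot (cross (X x y) (Y x y)) (cross (X x y) (Y x y))) in *.
    exists (l * D). split; [|split; [|split; [|split]]].
    - apply Rmult_integral_contrapositive_currified; [exact hl0|lra].
    - rewrite <- hl. ring.
    - rewrite p1, cXX, cYX. unfold D. vec. ring.
    - rewrite p2, cXY, cYY. unfold D. vec. ring.
    - rewrite q2, cXY, cYY. unfold D. vec. ring. }
  exists a, b. intros x y k.
  destruct (ea x y k) as [ax [ay [hax hay]]]. destruct (eb x y k) as [bx [bY [hbx hbY]]].
  destruct (ec x y k) as [cx [cy [hcx hcy]]].
  destruct (step x y k) as [hcb st].
  destruct (st ax ay bx bY cx cy hax hay hbx hbY hcx hcy)
    as [m1 [m2 [l [hl0 [hl [l1 [l2 l3]]]]]]].
  assert (hcx' : cx = eps * bx).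
  { apply (is_derive_unique_eq (fun t => c t y) x); [exact hcx|].
    apply (is_derive_ext_open_u (fun t => eps * b t y) _ x y _ U hU k).
    - intros t ht. symmetry. exact (proj1 (step t y ht)).
    - exact (is_derive_scal (fun t => b t y) x eps bx hbx). }
  split; [|split; [|split]].
  - split; [exact (dP x y k)|]. rewrite <- hcb. exact (dQ x y k).
  - pose proof (gauss_curv_cross psi x y (hpi x y k)) as g. cbv zeta in g.
    rewrite (hK x y k) in g. fold P Q in g.
    (* The factor is the determinant of the passage from [eta_x], [eta_y] to [psi_x], [psi_y]; it is
       nonzero because [psi] is an immersion. *)
    assert (hw' : cross (P x y) (Q x y) =
      vscal (- (a x y ^ 2 + eps * b x y ^ 2)) (cross (X x y) (Y x y))).
    { rewrite (dP x y k), (dQ x y k), hcb. apply V3_eq; vec; ring. }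
    pose proof (hpi x y k) as hne. fold P Q in hne.
    rewrite hw' in g, hne.
    set (Sg := a x y ^ 2 + eps * b x y ^ 2) in *.
    set (W := cross (X x y) (Y x y)) in *.
    assert (hS : Sg <> 0).
    { intros e0. apply hne. rewrite e0. apply V3_eq; vec; ring. }
    assert (e1 : dot (vscal (- Sg) W) (vscal (- Sg) W) = Sg ^ 2 * dot W W) by (vec; ring).
    assert (e2 : forall z, dot z (vscal (- Sg) W) = - Sg * dot z W) by (intros z; vec; ring).
    rewrite e1, !e2, l1, l2, l3 in g.
    destruct (hKr x y k) as [hx [hy hk]].
    pose proof (area x y k) as hD. change (dot W W = 64 * K (x * y) / ((1 - K (x * y)) ^ 3 * (x * y) ^ 2)) in hD.
    assert (hD0 : dot W W <> 0).
    { pose proof (dot_self_gt0 _ (hi x y k)) as p. change (0 < dot W W) in p. lra. }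
    (* Here [eps * l ^ 2 / dot W W ^ 2] is the Gaussian curvature of [eta]. *)
    assert (g' : Sg * dot W W ^ 2 = eps * l ^ 2).
    { apply (Rmult_eq_reg_l (Sg ^ 3)); [|apply pow_nonzero; exact hS].
      assert (eps2 : eps ^ 2 = 1) by (destruct (ap_eps _ _ _ _ _ A) as [-> | ->]; ring).
      transitivity (- (-1 * (Sg ^ 2 * dot W W) ^ 2)); [ring|]. rewrite g.
      transitivity (Sg ^ 2 * l ^ 2 * (eps * a x y ^ 2 + eps ^ 2 * b x y ^ 2)); [ring|].
      rewrite eps2. transitivity (Sg ^ 2 * l ^ 2 * (eps * a x y ^ 2 + 1 * b x y ^ 2)); [ring|].
      transitivity (Sg ^ 2 * l ^ 2 * (eps * a x y ^ 2 + eps ^ 2 * b x y ^ 2));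
        [rewrite eps2; ring|]. unfold Sg. ring. }
    rewrite hl in g'. apply (Rmult_eq_reg_r (dot W W ^ 2)); [|apply pow_nonzero; exact hD0].
    rewrite g', hD. field. repeat split; lra.
  - exists l. split; [exact l1|exact l3].
  - exists ax, ay, bx, bY. split; [|split].
    + exact (conj hax (conj hay (conj hbx hbY))).
    + rewrite m1, hcb, hcx'. ring.
    + exact m2.
Qed.

(** * The case [a <> 0]: a function conjugate to [H (x * y)] *)

Definition kappa (eps : R) (K : R -> R) (x y : R) : R :=
  eps * ((1 - K (x * y)) * (x * y)) ^ 2 / 16.

Lemma chr_xx_swap (K K1 : R -> R) (x y : R) : chr_xx K K1 y x = chr_yy K K1 x y.
Proof. unfold chr_xx, chr_yy. now rewrite (Rmult_comm y x). Qed.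

Lemma kappa_swap (eps : R) (K : R -> R) (x y : R) : kappa eps K y x = kappa eps K x y.
Proof. unfold kappa. now rewrite (Rmult_comm y x). Qed.

(** [kappa] is the curvature of the net and equals [eps * y ^ 2 / (4 * E)], while
    [E_x = 2 * Gamma^1_11 * E] because the [x]-lines are geodesics. *)
Lemma is_derive_kappa_u (eps : R) (K K1 : R -> R) (x y : R) :
  K (x * y) < 1 -> 0 < x -> is_derive K (x * y) (K1 (x * y)) ->
  is_derive (fun t => kappa eps K t y) x (-2 * chr_xx K K1 x y * kappa eps K x y).
Proof.
  intros hk hx h. pose proof (is_derive_xy_u K x y _ h) as h'.
  unfold chr_xx, kappa. revert h'. generalize (K1 (x * y)). intros k1 h'.
  set (f := fun t => K (t * y)) in *. change (K (x * y)) with (f x) in *.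
  apply is_derive_ext with (f := fun t => eps * ((1 - f t) * (t * y)) ^ 2 / 16);
    [reflexivity|].
  auto_derive.
  - eexists; exact h'.
  - replace (Derive (fun x0 => f x0) x) with (y * k1)
      by (symmetry; apply is_derive_unique; exact h').
    field. split; lra.
Qed.

Lemma is_derive_kappa_v (eps : R) (K K1 : R -> R) (x y : R) :
  K (x * y) < 1 -> 0 < y -> is_derive K (x * y) (K1 (x * y)) ->
  is_derive (fun t => kappa eps K x t) y (-2 * chr_yy K K1 x y * kappa eps K x y).
Proof.
  intros hk hy h. rewrite <- chr_xx_swap, <- kappa_swap.
  apply is_derive_ext with (f := fun t => kappa eps K t x);
    [intros t; apply kappa_swap|].
  apply is_derive_kappa_u; [now rewrite Rmult_comm|exact hy|].
  now rewrite (Rmult_comm y x).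
Qed.

(* [sigma = (b / a) H (x y)] is a conjugate (harmonic if [eps = 1]) of [H (x y)]; this
   forces [H] to be affine. *)
Lemma sigma_derive (eps zm : R) (K K1 K2 : R -> R) (U : R -> R -> Prop)
    (a b : R -> R -> R) (x y ax ay bx bY : R) :
  angle_profile eps zm K K1 K2 -> open2 U -> U x y ->
  0 < x -> 0 < y -> x * y < zm -> a x y <> 0 ->
  (forall s t, U s t -> a s t ^ 2 + eps * b s t ^ 2 = kappa eps K s t) ->
  is_derive (fun t => a t y) x ax -> is_derive (fun t => a x t) y ay ->
  is_derive (fun t => b t y) x bx -> is_derive (fun t => b x t) y bY ->
  ay + 2 * a x y * chr_xy1 K K1 x y = eps * (bx + b x y * chr_xx K K1 x y) ->
  ax + bY + b x y * chr_yy K K1 x y + 2 * a x y * chr_xy2 K K1 x y = 0 ->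
  is_derive (fun t => prof_H K (t * y) * b t y / a t y) x (- eps * x * prof_H1 K K1 (x * y)) /\
  is_derive (fun t => prof_H K (x * t) * b x t / a x t) y (y * prof_H1 K K1 (x * y)).
Proof.
  intros A hU k hx hy hz ha0 h3 hax hay hbx hbY e1 e2.
  assert (hz' : 0 < x * y < zm) by nra.
  pose proof (ap_range _ _ _ _ _ A _ hz') as r.
  pose proof (ap_derive _ _ _ _ _ A _ hz') as dK.
  assert (eps2 : eps * eps = 1) by (destruct (ap_eps _ _ _ _ _ A) as [-> | ->]; ring).
  pose proof (prof_H_derive eps zm K K1 K2 _ A hz') as dH.
  pose proof (is_derive_xy_u _ x y _ dH) as dHx.
  pose proof (is_derive_xy_v _ x y _ dH) as dHy.
  assert (e3x : 2 * a x y * ax + 2 * eps * b x y * bx =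
                -2 * chr_xx K K1 x y * (a x y ^ 2 + eps * b x y ^ 2)).
  { rewrite (h3 x y k).
    apply (is_derive_unique_eq (fun t => kappa eps K t y) x).
    - apply (is_derive_ext_open_u (fun t => a t y ^ 2 + eps * b t y ^ 2) _ x y _ U hU k).
      + intros t ht. exact (h3 t y ht).
      + set (f := fun t => a t y) in *. set (g := fun t => b t y) in *.
        change (a x y) with (f x). change (b x y) with (g x).
        apply is_derive_ext with (f := fun t => f t ^ 2 + eps * g t ^ 2); [reflexivity|].
        auto_derive; [split; [eexists; exact hax|split; [eexists; exact hbx|exact I]]|].
        replace (Derive (fun x0 => f x0) x) with ax
          by (symmetry; apply is_derive_unique; exact hax).
        replace (Derive (fun x0 => g x0) x) with bx
          by (symmetry; apply is_derive_unique; exact hbx).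
        ring.
    - apply is_derive_kappa_u; [lra|exact hx|exact dK]. }
  assert (e3y : 2 * a x y * ay + 2 * eps * b x y * bY =
                -2 * chr_yy K K1 x y * (a x y ^ 2 + eps * b x y ^ 2)).
  { rewrite (h3 x y k).
    apply (is_derive_unique_eq (fun t => kappa eps K x t) y).
    - apply (is_derive_ext_open_v (fun t => a x t ^ 2 + eps * b x t ^ 2) _ x y _ U hU k).
      + intros t ht. exact (h3 x t ht).
      + set (f := fun t => a x t) in *. set (g := fun t => b x t) in *.
        change (a x y) with (f y). change (b x y) with (g y).
        apply is_derive_ext with (f := fun t => f t ^ 2 + eps * g t ^ 2); [reflexivity|].
        auto_derive; [split; [eexists; exact hay|split; [eexists; exact hbY|exact I]]|].
        replace (Derive (fun x0 => f x0) y) with ay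
          by (symmetry; apply is_derive_unique; exact hay).
        replace (Derive (fun x0 => g x0) y) with bY
          by (symmetry; apply is_derive_unique; exact hbY).
        ring.
    - apply is_derive_kappa_v; [lra|exact hy|exact dK]. }
  (* The left side is [a ^ 2 * (b / a)_x]. The derivatives [ay] and [bY] are eliminated with [e3y];
     for [Jy], [e3x] plays this role. *)
  assert (Jx : a x y * bx - b x y * ax =
    eps * a x y ^ 2 * (2 * chr_xy1 K K1 x y - chr_yy K K1 x y) +
    a x y * b x y * (2 * chr_xy2 K K1 x y - chr_xx K K1 x y)).
  { apply (Rmult_eq_reg_l eps); [|intros z0; rewrite z0 in eps2; lra].
    transitivity (a x y ^ 2 * (2 * chr_xy1 K K1 x y - chr_yy K K1 x y) +
      eps * (a x y * b x y * (2 * chr_xy2 K K1 x y - chr_xx K K1 x y))).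
    - apply (f_equal (fun t => a x y * t)) in e1.
      apply (f_equal (fun t => eps * b x y * t)) in e2. lra.
    - transitivity (eps * eps * (a x y ^ 2 * (2 * chr_xy1 K K1 x y - chr_yy K K1 x y)) +
        eps * (a x y * b x y * (2 * chr_xy2 K K1 x y - chr_xx K K1 x y)));
        [rewrite eps2; ring|ring]. }
  assert (Jy : a x y * bY - b x y * ay =
    a x y ^ 2 * (chr_xx K K1 x y - 2 * chr_xy2 K K1 x y) +
    a x y * b x y * (2 * chr_xy1 K K1 x y - chr_yy K K1 x y)).
  { apply (f_equal (fun t => b x y * t)) in e1.
    apply (f_equal (fun t => a x y * t)) in e2. lra. }
  assert (hx0 : x <> 0) by lra. assert (hy0 : y <> 0) by lra.
  assert (hk0 : K (x * y) <> 0) by lra. assert (hk1 : 1 - K (x * y) <> 0) by lra.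
  split.
  - set (f := fun t => a t y) in *. set (g := fun t => b t y) in *.
    set (h := fun t => prof_H K (t * y)) in *.
    apply is_derive_ext with (f := fun t => h t * g t / f t); [reflexivity|].
    auto_derive.
    + split; [eexists; exact dHx|]. split; [eexists; exact hbx|].
      split; [eexists; exact hax|]. split; [exact ha0|exact I].
    + replace (Derive (fun x0 => f x0) x) with ax
        by (symmetry; apply is_derive_unique; exact hax).
      replace (Derive (fun x0 => g x0) x) with bx
        by (symmetry; apply is_derive_unique; exact hbx).
      replace (Derive (fun x0 => h x0) x) with (y * prof_H1 K K1 (x * y))
        by (symmetry; apply is_derive_unique; exact dHx).
      unfold f, g, h.
      transitivity (y * prof_H1 K K1 (x * y) * b x y / a x y +
        prof_H K (x * y) * (a x y * bx - b x y * ax) / a x y ^ 2); [field; exact ha0|].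
      rewrite Jx. unfold prof_H, prof_H1, chr_xx, chr_yy, chr_xy1, chr_xy2.
      field. repeat split; assumption.
  - set (f := fun t => a x t) in *. set (g := fun t => b x t) in *.
    set (h := fun t => prof_H K (x * t)) in *.
    apply is_derive_ext with (f := fun t => h t * g t / f t); [reflexivity|].
    auto_derive.
    + split; [eexists; exact dHy|]. split; [eexists; exact hbY|].
      split; [eexists; exact hay|]. split; [exact ha0|exact I].
    + replace (Derive (fun x0 => f x0) y) with ay
        by (symmetry; apply is_derive_unique; exact hay).
      replace (Derive (fun x0 => g x0) y) with bY
        by (symmetry; apply is_derive_unique; exact hbY).
      replace (Derive (fun x0 => h x0) y) with (x * prof_H1 K K1 (x * y))
        by (symmetry; apply is_derive_unique; exact dHy).
      unfold f, g, h.
      transitivity (x * prof_H1 K K1 (x * y) * b x y / a x y +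
        prof_H K (x * y) * (a x y * bY - b x y * ay) / a x y ^ 2); [field; exact ha0|].
      unfold f, g in Jy. rewrite Jy. unfold prof_H, prof_H1, chr_xx, chr_yy, chr_xy1, chr_xy2.
      field. repeat split; assumption.
Qed.

Lemma prof_H2_continuous (eps zm : R) (K K1 K2 : R -> R) (z : R) :
  angle_profile eps zm K K1 K2 -> 0 < z < zm -> continuity_pt (prof_H2 K K1 K2) z.
Proof.
  intros A hz. pose proof (ap_range _ _ _ _ _ A z hz) as r.
  pose proof (ap_derive _ _ _ _ _ A z hz) as d1.
  pose proof (ap_derive2 _ _ _ _ _ A z hz) as d2.
  assert (hn : z * K z <> 0) by nra.
  (* [K2] is only known to be continuous, so it is separated from coefficients that are
     differentiable. *)
  set (al := fun z => (2 * (K z + z * K1 z) ^ 2 - 2 * K1 z * (z * K z)) / (z * K z) ^ 3).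
  set (be := fun z => - (z * (z * K z)) / (z * K z) ^ 3).
  assert (ca : continuity_pt al z).
  { apply continuity_pt_filterlim, (ex_derive_continuous al). unfold al. auto_derive.
    repeat split; try (eexists; eassumption).
    repeat apply Rmult_integral_contrapositive_currified; lra. }
  assert (cb : continuity_pt be z).
  { apply continuity_pt_filterlim, (ex_derive_continuous be). unfold be. auto_derive.
    repeat split; try (eexists; eassumption).
    repeat apply Rmult_integral_contrapositive_currified; lra. }
  apply continuity_pt_ext with (fun t => al t + be t * K2 t).
  - intros t. unfold al, be, prof_H2, Rdiv. ring.
  - apply continuity_pt_plus; [exact ca|].
    apply continuity_pt_mult; [exact cb|]. exact (ap_continuous _ _ _ _ _ A z hz).
Qed.

(** The mixed derivatives of [sg] are [- eps * x ^ 2 * H''] and [y ^ 2 * H'']. Their continuity,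
    required for the theorem of Schwarz, is the reason for [ap_continuous]. *)
Lemma conjugate_mixed_derivatives (eps zm : R) (K K1 K2 : R -> R) (U : R -> R -> Prop)
    (sg : R -> R -> R) :
  angle_profile eps zm K K1 K2 -> open2 U ->
  (forall x y, U x y -> 0 < x * y < zm /\
    is_derive (fun t => sg t y) x (- eps * x * prof_H1 K K1 (x * y)) /\
    is_derive (fun t => sg x t) y (y * prof_H1 K K1 (x * y))) ->
  forall x y, U x y -> (y ^ 2 + eps * x ^ 2) * prof_H2 K K1 K2 (x * y) = 0.
Proof.
  intros A hU h.
  assert (dxy : forall x y, U x y ->
    is_derive (fun t => Derive (fun s => sg s t) x) y (- eps * x ^ 2 * prof_H2 K K1 K2 (x * y))).
  { intros x y k. destruct (h x y k) as [hz _].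
    apply (is_derive_ext_open_v (fun t => - eps * x * prof_H1 K K1 (x * t)) _ x y _ U hU k).
    - intros t ht. symmetry. apply is_derive_unique. apply (h x t ht).
    - eapply is_derive_eq.
      + apply (is_derive_scal (fun t => prof_H1 K K1 (x * t))).
        apply is_derive_xy_v. exact (prof_H1_derive eps zm K K1 K2 _ A hz).
      + ring. }
  assert (dyx : forall x y, U x y ->
    is_derive (fun t => Derive (fun s => sg t s) y) x (y ^ 2 * prof_H2 K K1 K2 (x * y))).
  { intros x y k. destruct (h x y k) as [hz _].
    apply (is_derive_ext_open_u (fun t => y * prof_H1 K K1 (t * y)) _ x y _ U hU k).
    - intros t ht. symmetry. apply is_derive_unique. apply (h t y ht).
    - eapply is_derive_eq.
      + apply (is_derive_scal (fun t => prof_H1 K K1 (t * y))).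
        apply is_derive_xy_u. exact (prof_H1_derive eps zm K K1 K2 _ A hz).
      + ring. }
  assert (cH : forall x y, U x y ->
      continuity_2d_pt (fun s t => prof_H2 K K1 K2 (s * t)) x y).
  { intros x y k. apply (continuity_1d_2d_pt_comp (prof_H2 K K1 K2) (fun s t => s * t)).
    - apply (prof_H2_continuous eps zm K K1 K2 _ A). apply (h x y k).
    - apply continuity_2d_pt_mult; [apply continuity_2d_pt_id1|apply continuity_2d_pt_id2]. }
  intros x y k.
  assert (s : y ^ 2 * prof_H2 K K1 K2 (x * y) = - eps * x ^ 2 * prof_H2 K K1 K2 (x * y));
    [|lra].
  rewrite <- (is_derive_unique _ _ _ (dxy x y k)), <- (is_derive_unique _ _ _ (dyx x y k)).
  apply Schwarz.
  - apply locally_2d_impl with (2 := hU x y k), locally_2d_forall.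
    intros s t hst. destruct (h s t hst) as [_ [h1 h2]].
    split; [eexists; exact h1|]. split; [eexists; exact h2|].
    split; [eexists; exact (dyx s t hst)|eexists; exact (dxy s t hst)].
  - apply continuity_2d_pt_ext_loc with (f := fun s t => t ^ 2 * prof_H2 K K1 K2 (s * t)).
    + apply locally_2d_impl with (2 := hU x y k), locally_2d_forall.
      intros s t hst. symmetry. exact (is_derive_unique _ _ _ (dyx s t hst)).
    + apply continuity_2d_pt_mult; [|exact (cH x y k)].
      apply continuity_2d_pt_mult; [apply continuity_2d_pt_id2|].
      apply continuity_2d_pt_mult; [apply continuity_2d_pt_id2|apply continuity_2d_pt_const].
  - apply continuity_2d_pt_ext_loc with
      (f := fun s t => - eps * s ^ 2 * prof_H2 K K1 K2 (s * t)).
    + apply locally_2d_impl with (2 := hU x y k), locally_2d_forall.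
      intros s t hst. symmetry. exact (is_derive_unique _ _ _ (dxy s t hst)).
    + apply continuity_2d_pt_mult; [|exact (cH x y k)].
      apply continuity_2d_pt_mult; [apply continuity_2d_pt_const|].
      apply continuity_2d_pt_mult; [apply continuity_2d_pt_id1|].
      apply continuity_2d_pt_mult; [apply continuity_2d_pt_id1|apply continuity_2d_pt_const].
Qed.

(** * No piece of a profile net comes from a surface of revolution *)

Lemma of_revolution_sub (D D' : R -> R -> Prop) (psi : R -> R -> V3) :
  (forall u v, D' u v -> D u v) -> of_revolution D psi -> of_revolution D' psi.
Proof.
  intros hD [p [e1 [e2 [e3 [I [f [g [s [th [ho [hI [hfg [hs [hth h]]]]]]]]]]]]]].
  exists p, e1, e2, e3, I, f, g, s, th.
  split; [exact ho|]. split; [exact hI|]. split; [exact hfg|].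
  split; [intros n; apply (Ck_sub n D); auto|]. split; [intros n; apply (Ck_sub n D); auto|].
  intros u v k. apply h. auto.
Qed.

Lemma immersion_sub (D D' : R -> R -> Prop) (f : R -> R -> V3) :
  open_domain D' -> (forall u v, D' u v -> D u v) -> immersion D f -> immersion D' f.
Proof.
  intros hD' hD [_ [hs hi]]. split; [exact hD'|]. split.
  - exact (smooth3_sub D D' f hD hs).
  - intros u v k. apply hi. auto.
Qed.

(** Otherwise [H (x * y) * b / a] would exist on all of [U], and its mixed derivatives would force
    [H'' = 0] wherever [y ^ 2 + eps * x ^ 2] is nonzero, against [prof_H2_nonzero]. *)
Lemma profile_net_coefficient_zero (eps zm : R) (K K1 K2 : R -> R) (U : R -> R -> Prop)
    (a b : R -> R -> R) :
  angle_profile eps zm K K1 K2 -> open2 U ->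
  (forall x y, U x y -> 0 < x /\ 0 < y /\ x * y < zm) ->
  (forall x y, U x y -> a x y ^ 2 + eps * b x y ^ 2 = kappa eps K x y) ->
  (forall x y, U x y -> exists ax ay bx bY,
      (is_derive (fun t => a t y) x ax /\ is_derive (fun t => a x t) y ay /\
       is_derive (fun t => b t y) x bx /\ is_derive (fun t => b x t) y bY) /\
      ay + 2 * a x y * chr_xy1 K K1 x y = eps * (bx + b x y * chr_xx K K1 x y) /\
      ax + bY + b x y * chr_yy K K1 x y + 2 * a x y * chr_xy2 K K1 x y = 0) ->
  (exists x y, U x y) -> exists x y, U x y /\ a x y = 0.
Proof.
  intros A hU hpos h3 he [x0 [y0 k0]]. apply NNPP. intros n.
  assert (ha : forall x y, U x y -> a x y <> 0).
  { intros x y k e. apply n. exists x, y. exact (conj k e). }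
  clear n.
  pose proof (conjugate_mixed_derivatives eps zm K K1 K2 U
    (fun x y => prof_H K (x * y) * b x y / a x y) A hU) as mix.
  assert (key : forall x y, U x y -> (y ^ 2 + eps * x ^ 2) * prof_H2 K K1 K2 (x * y) = 0).
  { apply mix. intros x y k. destruct (hpos x y k) as [hx [hy hz]].
    destruct (he x y k) as [ax [ay [bx [bY [[d1 [d2 [d3 d4]]] [e1 e2]]]]]].
    split; [nra|].
    exact (sigma_derive eps zm K K1 K2 U a b x y ax ay bx bY A hU k hx hy hz (ha x y k)
             h3 d1 d2 d3 d4 e1 e2). }
  destruct (hU x0 y0 k0) as [d hd].
  destruct (hpos x0 y0 k0) as [hx0 [hy0 hz0]].
  assert (hin : forall x, Rabs (x - x0) < d -> U x y0).
  { intros x hx. apply hd; [exact hx|]. rewrite Rminus_diag, Rabs_R0. apply cond_pos. }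
  pose proof (cond_pos d) as hd0.
  (* Along the row [y = y0] the argument [z = x * y0] sweeps an interval. *)
  assert (fin : forall x1 x2, x0 - d < x1 < x2 -> x2 < x0 + d ->
      (forall x, x1 < x < x2 -> y0 ^ 2 + eps * x ^ 2 <> 0) -> False).
  { intros x1 x2 h12 h2 hne.
    assert (U1 : U x1 y0) by (apply hin, Rabs_def1; lra).
    assert (U2 : U x2 y0) by (apply hin, Rabs_def1; lra).
    destruct (hpos x1 y0 U1) as [p1 _]. destruct (hpos x2 y0 U2) as [p2 [_ q2]].
    apply (prof_H2_nonzero eps zm K K1 K2 (x1 * y0) (x2 * y0) A); [split; nra|lra|].
    intros z hz.
    assert (hzx : x1 < z / y0 < x2).
    { split; apply (Rmult_lt_reg_r y0); try exact hy0; unfold Rdiv;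
        rewrite Rmult_assoc, Rinv_l, Rmult_1_r; lra. }
    assert (Uz : U (z / y0) y0) by (apply hin, Rabs_def1; lra).
    pose proof (key _ _ Uz) as e. replace (z / y0 * y0) with z in e by (field; lra).
    apply Rmult_integral in e as [e|e]; [|exact e]. destruct (hne _ hzx e). }
  (* For [eps = -1] the factor vanishes on the diagonal, so the segment is taken on the side of [x0]
     that points away from it. *)
  destruct (Rle_or_lt y0 x0) as [hle|hlt].
  - apply (fin x0 (x0 + d / 2)); [lra|lra|].
    intros x hx. destruct (ap_eps _ _ _ _ _ A) as [-> | ->]; nra.
  - apply (fin (x0 - d / 2) x0); [lra|lra|].
    intros x hx.
    assert (0 < x).
    { apply (hpos x y0). apply hin, Rabs_def1; lra. }
    destruct (ap_eps _ _ _ _ _ A) as [-> | ->]; nra.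
Qed.

Lemma profile_net_not_revolution (eps zm : R) (K K1 K2 : R -> R) (U : R -> R -> Prop)
    (eta : R -> R -> V3) :
  angle_profile eps zm K K1 K2 -> immersion U eta -> profile_net eps zm K U eta ->
  ~ rotation_field_of_pseudospherical_revolution U eta.
Proof.
  intros A hi hN [psi [hpsi [hrev hrot]]].
  destruct (rotation_field_coefficients eps zm K K1 K2 U eta psi A hi hN hpsi hrot)
    as [a [b h]].
  destruct hi as [[hne hU] [hs hi]]. destruct hpsi as [hpi hK].
  assert (hpos : forall x y, U x y -> 0 < x /\ 0 < y /\ x * y < zm)
    by (intros x y k; apply (hN x y k)).
  assert (ha : forall x y, U x y -> a x y = 0).
  { intros x0 y0 k0. apply NNPP. intros ha0.
    destruct (h x0 y0 k0) as [_ [_ [_ [ax [ay [bx [bY [[d1 [d2 _]] _]]]]]]]].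
    (* Separate derivability in [x] and [y] does not give continuity; Cramer's formula for [a] in
       terms of [psi_x] and the frame does. *)
    assert (ca : continuity_2d_pt a x0 y0).
    { set (X := du eta). set (Y := dv eta). set (P := du psi).
      assert (hsX : smooth3 U X) by exact (smooth3_du U eta hs).
      assert (hsY : smooth3 U Y) by exact (smooth3_dv U eta hs).
      assert (hsP : smooth3 U P) by exact (smooth3_du U psi (proj1 (proj2 hpi))).
      apply continuity_2d_pt_ext_loc with (f := fun x y =>
        (dot (P x y) (X x y) * dot (Y x y) (Y x y) - dot (P x y) (Y x y) * dot (X x y) (Y x y))
        * / dot (cross (X x y) (Y x y)) (cross (X x y) (Y x y))).
      - apply locally_2d_impl with (2 := hU x0 y0 k0), locally_2d_forall.
        intros x y k. unfold P. rewrite (proj1 (proj1 (h x y k))). fold X Y.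
        pose proof (dot_self_gt0 _ (hi x y k)) as p. fold X Y in p.
        apply (Rmult_eq_reg_r (dot (cross (X x y) (Y x y)) (cross (X x y) (Y x y)))); [|lra].
        rewrite Rmult_assoc, Rinv_l by lra.
        generalize (X x y) (Y x y) (a x y) (b x y). intros. vec. ring.
      - pose proof (smooth3_continuity U X x0 y0 hsX k0) as cX.
        pose proof (smooth3_continuity U Y x0 y0 hsY k0) as cY.
        pose proof (smooth3_continuity U P x0 y0 hsP k0) as cP.
        apply continuity_2d_pt_mult.
        + apply continuity_2d_pt_minus; apply continuity_2d_pt_mult; apply cont3_dot;
            assumption.
        + apply continuity_2d_pt_inv; [apply cont3_dot; apply cont3_cross; assumption|].
          pose proof (dot_self_gt0 _ (hi x0 y0 k0)) as p. fold X Y in p. lra. }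
    destruct (locally_2d_and _ _ x0 y0 (continuity_2d_pt_neq_0 a x0 y0 ca ha0)
                (hU x0 y0 k0)) as [d hd].
    set (S := square x0 y0 d).
    assert (hSU : forall x y, S x y -> U x y)
      by (intros x y [k1 k2]; apply (hd x y k1 k2)).
    destruct (profile_net_coefficient_zero eps zm K K1 K2 S a b A (open2_square x0 y0 d))
      as [x [y [[k1 k2] e]]].
    - intros x y k. apply hpos. auto.
    - intros x y k. apply (h x y (hSU x y k)).
    - intros x y k. apply (h x y (hSU x y k)).
    - exists x0, y0. apply square_center.
    - exact (proj1 (hd x y k1 k2) e). }
  destruct hne as [x0 [y0 k0]]. destruct (hU x0 y0 k0) as [d hd].
  destruct (hpos x0 y0 k0) as [hx0 [hy0 hz0]]. pose proof (cond_pos d) as hd0.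
  assert (hin : forall x, Rabs (x - x0) < d -> U x y0).
  { intros x hx. apply hd; [exact hx|]. rewrite Rminus_diag, Rabs_R0. apply cond_pos. }
  (* The angle must vary, and a variation of [K] is available on every interval of values
     [x * y0]. *)
  assert (hx1 : exists x1, U x1 y0 /\ K1 (x1 * y0) <> 0).
  { apply NNPP. intros n.
    assert (U2 : U (x0 + d / 2) y0) by (apply hin, Rabs_def1; lra).
    apply (prof_derive_nonzero eps zm K K1 K2 (x0 * y0) ((x0 + d / 2) * y0) A);
      [split; nra|apply Rlt_le, (hpos _ _ U2)|].
    intros z hz. apply NNPP. intros hz1. apply n. exists (z / y0).
    replace (z / y0 * y0) with z by (field; lra). split; [|exact hz1].
    assert (hzx : x0 < z / y0 < x0 + d / 2).
    { split; apply (Rmult_lt_reg_r y0); try exact hy0; unfold Rdiv;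
        rewrite (Rmult_assoc z), Rinv_l, Rmult_1_r; unfold Rdiv in hz; lra. }
    apply hin, Rabs_def1; lra. }
  destruct hx1 as [x1 [k1 hK1]].
  assert (hrange : forall x y, U x y -> 0 < K (x * y) < 1 /\
      is_derive K (x * y) (K1 (x * y)) /\ is_derive K1 (x * y) (K2 (x * y))).
  { intros x y k. destruct (hpos x y k) as [hx [hy hz]].
    assert (hz' : 0 < x * y < zm) by nra.
    split; [exact (ap_range _ _ _ _ _ A _ hz')|].
    split; [exact (ap_derive _ _ _ _ _ A _ hz')|exact (ap_derive2 _ _ _ _ _ A _ hz')]. }
  assert (cK : continuity_2d_pt (fun s t => K1 (s * t)) x1 y0).
  { apply (continuity_1d_2d_pt_comp K1 (fun s t => s * t)).
    - apply continuity_pt_filterlim, (ex_derive_continuous K1).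
      eexists. apply (hrange x1 y0 k1).
    - apply continuity_2d_pt_mult; [apply continuity_2d_pt_id1|apply continuity_2d_pt_id2]. }
  destruct (locally_2d_and _ _ x1 y0
    (continuity_2d_pt_neq_0 (fun s t => K1 (s * t)) x1 y0 cK hK1) (hU x1 y0 k1)) as [r hr].
  set (S := square x1 y0 r).
  assert (hSU : forall x y, S x y -> U x y) by (intros x y [q1 q2]; apply (hr x y q1 q2)).
  assert (hS0 : S x1 y0) by apply square_center.
  (* With [a = 0], [psi_x = b eta_y] and [psi_y = eps b eta_x]: the cosine [2 * K - 1] of the net
     picks up the sign [eps], and [b ^ 2 = ((1 - K) x y) ^ 2 / 16] rescales [G] and [E] to
     [x ^ 2 / 4] and [y ^ 2 / 4]. *)
  apply (chebyshev_not_revolution S psi (fun z => eps * (2 * K z - 1))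
           (fun z => 2 * eps * K1 z) x1 y0).
  - apply (immersion_sub U S psi); [|exact hSU|exact hpi].
    split; [exists x1, y0; exact hS0|apply open2_square].
  - exact (of_revolution_sub U S psi hSU hrev).
  - exact hS0.
  - intros x y k. pose proof (hSU x y k) as kU.
    destruct (hpos x y kU) as [hx [hy hz]]. destruct (hrange x y kU) as [rK [dK _]].
    destruct (h x y kU) as [[eP eQ] [e3 [[l [l1 l2]] _]]].
    rewrite (ha x y kU) in eP, eQ, e3, l1, l2.
    destruct (hN x y kU) as [_ [hE [hF [hG _]]]].
    assert (eps2 : eps * eps = 1) by (destruct (ap_eps _ _ _ _ _ A) as [-> | ->]; ring).
    assert (b2 : b x y ^ 2 = ((1 - K (x * y)) * (x * y)) ^ 2 / 16).
    { transitivity (eps * eps * b x y ^ 2); [rewrite eps2; ring|].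
      transitivity (eps * (0 ^ 2 + eps * b x y ^ 2)); [ring|]. rewrite e3.
      transitivity (eps * eps * ((1 - K (x * y)) * (x * y)) ^ 2 / 16);
        [field|rewrite eps2; field]. }
    assert (ew : forall z, dot z (cross (du psi x y) (dv psi x y)) =
        - (eps * b x y ^ 2) * dot z (cross (du eta x y) (dv eta x y))).
    { intros z. rewrite eP, eQ. vec. ring. }
    split; [|split; [|split]].
    + split; [exact hx|]. split; [exact hy|]. split.
      * eapply is_derive_eq.
        -- apply (is_derive_scal (fun z => 2 * K z - 1)).
           apply (is_derive_subR (fun z => 2 * K z) (fun _ => 1)).
           ++ apply is_derive_scal. exact dK.
           ++ exact (is_derive_const 1 _).
        -- change (@zero R_NormedModule) with 0. ring.
      * destruct k as [q1 q2]. destruct (hr x y q1 q2) as [q _].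
        apply Rmult_integral_contrapositive_currified; [|exact q].
        destruct (ap_eps _ _ _ _ _ A) as [-> | ->]; lra.
    + unfold fE, fF, fG in *.
      set (X := du eta x y) in *. set (Y := dv eta x y) in *.
      assert (c1 : dot (du psi x y) (du psi x y) = b x y ^ 2 * dot Y Y)
        by (rewrite eP; vec; ring).
      assert (c2 : dot (du psi x y) (dv psi x y) = eps * b x y ^ 2 * dot X Y)
        by (rewrite eP, eQ; vec; ring).
      assert (c3 : dot (dv psi x y) (dv psi x y) = (eps * eps) * b x y ^ 2 * dot X X)
        by (rewrite eQ; vec; ring).
      rewrite c1, c2, c3, eps2, b2, hE, hF, hG.
      split; [|split]; field; repeat split; lra.
    + exact (hK x y kU).
    + cbv zeta. rewrite !ew, l1, l2. split; ring.
Qed.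

(** * The two nets as profile nets *)

Lemma first_form_coefficients (f : R -> R -> V3) (u v p q r : R) :
  (forall a b, I_form f u v a b = p * a ^ 2 + 2 * q * a * b + r * b ^ 2) ->
  fE f u v = p /\ fF f u v = q /\ fG f u v = r.
Proof.
  intros h. unfold I_form in h.
  pose proof (h 1 0). pose proof (h 0 1). pose proof (h 1 1). repeat split; lra.
Qed.

Lemma second_form_coefficients (f : R -> R -> V3) (u v p q r : R) :
  (forall a b, II_form f u v a b = p * a ^ 2 + 2 * q * a * b + r * b ^ 2) ->
  fL f u v = p /\ fM f u v = q /\ fN f u v = r.
Proof.
  intros h. unfold II_form in h.
  pose proof (h 1 0). pose proof (h 0 1). pose proof (h 1 1). repeat split; lra.
Qed.

Lemma immersion_area (D : R -> R -> Prop) (f : R -> R -> V3) (u v : R) :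
  immersion D f -> D u v -> fE f u v * fG f u v - fF f u v ^ 2 > 0.
Proof.
  intros [_ [_ hi]] k. unfold fE, fF, fG. rewrite <- dot_cross_cross.
  apply dot_self_gt0. exact (hi u v k).
Qed.

(** Since [r = sqrt (4 * u * v) = x * y / 2], the variable is [z = 2 * r] and the bound [2 * r1].
    The sign [s = -1] replaces the angle by its supplement, which is the angle between the lines of
    the second net. *)
Lemma profile_of_W (k r1 s : R) (W : R -> R) :
  solves_W k W -> s = 1 \/ s = -1 -> (forall r, 0 < r < r1 -> sin (W r) <> 0) ->
  angle_profile s (2 * r1)
    (fun z => (1 + s * cos (W (z / 2))) / 2)
    (fun z => - s * sin (W (z / 2)) * Derive W (z / 2) / 4)
    (fun z => - s * (cos (W (z / 2)) * Derive W (z / 2) ^ 2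
                     + sin (W (z / 2)) * Derive (Derive W) (z / 2)) / 8).
Proof.
  intros [_ [_ hW]] hs hsin.
  assert (dW : forall z, 0 < z < 2 * r1 ->
      is_derive (fun t => W (t / 2)) z (/ 2 * Derive W (z / 2))).
  { intros z hz. apply (is_derive_comp W (fun t => t / 2)).
    - apply Derive_correct. apply (hW (z / 2)). lra.
    - auto_derive; [exact I|field]. }
  assert (dW1 : forall z, 0 < z < 2 * r1 ->
      is_derive (fun t => Derive W (t / 2)) z (/ 2 * Derive (Derive W) (z / 2))).
  { intros z hz. apply (is_derive_comp (Derive W) (fun t => t / 2)).
    - apply Derive_correct. apply (hW (z / 2)). lra.
    - auto_derive; [exact I|field]. }
  assert (s2 : s * s = 1) by (destruct hs as [-> | ->]; ring).
  split.
  - exact hs.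
  - intros z hz. pose proof (dW z hz) as d.
    set (f := fun t => W (t / 2)) in *.
    apply is_derive_ext with (f := fun t => (1 + s * cos (f t)) / 2); [reflexivity|].
    auto_derive; [eexists; exact d|].
    replace (Derive (fun x => f x) z) with (/ 2 * Derive W (z / 2))
      by (symmetry; apply is_derive_unique; exact d).
    unfold f. field.
  - intros z hz. pose proof (dW z hz) as d. pose proof (dW1 z hz) as d1.
    set (f := fun t => W (t / 2)) in *. set (g := fun t => Derive W (t / 2)) in *.
    apply is_derive_ext with (f := fun t => - s * sin (f t) * g t / 4); [reflexivity|].
    auto_derive; [split; [eexists; exact d|split; [eexists; exact d1|exact I]]|].
    replace (Derive (fun x => f x) z) with (/ 2 * Derive W (z / 2))
      by (symmetry; apply is_derive_unique; exact d).
    replace (Derive (fun x => g x) z) with (/ 2 * Derive (Derive W) (z / 2))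
      by (symmetry; apply is_derive_unique; exact d1).
    unfold f, g. field.
  - intros z hz. pose proof (dW z hz) as d. pose proof (dW1 z hz) as d1.
    set (f := fun t => W (t / 2)) in *. set (g := fun t => Derive W (t / 2)) in *.
    (* Continuity of [W''] comes from the equation, which expresses it through the differentiable
       functions [W] and [W']. *)
    set (F := fun t => - s * (cos (f t) * g t ^ 2
                              + sin (f t) * (sin (f t) - / (t / 2) * g t)) / 8).
    apply continuity_pt_ext_loc with F.
    + apply (filter_imp (fun t => 0 < t)); [|exact (locally_pos z (proj1 hz))].
      intros t ht. unfold F, f, g. destruct (hW (t / 2) ltac:(lra)) as [_ [_ e]].
      replace (Derive (Derive W) (t / 2))
        with (sin (W (t / 2)) - / (t / 2) * Derive W (t / 2)) by lra.
      reflexivity.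
    + apply continuity_pt_filterlim, (ex_derive_continuous F). unfold F. auto_derive.
      repeat split; try (eexists; eassumption). lra.
  - intros z hz. pose proof (hsin (z / 2) ltac:(lra)) as h.
    pose proof (sin2_cos2 (W (z / 2))) as e. unfold Rsqr in e.
    assert (0 < sin (W (z / 2)) * sin (W (z / 2))) by nra.
    destruct hs as [-> | ->]; split; nra.
  - intros z hz. destruct (hW (z / 2) ltac:(lra)) as [_ [_ e]].
    pose proof (sin2_cos2 (W (z / 2))) as e2. unfold Rsqr in e2.
    assert (eW : Derive (Derive W) (z / 2) = sin (W (z / 2)) - 2 * Derive W (z / 2) / z).
    { transitivity (sin (W (z / 2)) - / (z / 2) * Derive W (z / 2)); [lra|field; lra]. }
    rewrite eW. revert e2. generalize (sin (W (z / 2))) (cos (W (z / 2))) (Derive W (z / 2)).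
    intros S C V e2.
    (* The term [W' / r] has been absorbed by [K1 / z], and [4 * K * (1 - K)] is [sin W ^ 2]. *)
    transitivity (- s * (1 - (s * s) * (C * C)) * (C * V ^ 2 + S * S) / 16).
    + field. lra.
    + rewrite s2.
      transitivity (- (s * C) * (S * S) * V ^ 2 * (s * s) / 16
        - s * ((1 - (s * s) * (C * C)) ^ 2) / 16); [|field].
      rewrite s2. replace (1 - 1 * (C * C)) with (S * S) by lra. field.
Qed.

(** The mean curvature keeps the factor [L], whose sign a profile net leaves open. *)
Lemma profile_net_curvatures (eps zm : R) (K : R -> R) (U : R -> R -> Prop)
    (eta : R -> R -> V3) (x y : R) :
  profile_net eps zm K U eta -> U x y -> 0 < K (x * y) < 1 ->
  gauss_curv eta x y = eps * ((1 - K (x * y)) * (x * y)) ^ 2 / 16 /\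
  mean_curv eta x y =
    fL eta x y * (1 - K (x * y)) * (x ^ 2 + eps * y ^ 2) / (32 * K (x * y)).
Proof.
  intros hN h r.
  destruct (hN x y h) as [[hx [hy _]] [hE [hF [hG [hM [hNN hL]]]]]].
  unfold gauss_curv, mean_curv.
  assert (hD : fE eta x y * fG eta x y - fF eta x y ^ 2 =
    64 * K (x * y) / ((1 - K (x * y)) ^ 3 * (x * y) ^ 2)).
  { rewrite hE, hF, hG. field. repeat split; lra. }
  rewrite hD, hM, hNN. split.
  - replace (fL eta x y * (eps * fL eta x y) - 0 ^ 2) with (eps * fL eta x y ^ 2) by ring.
    rewrite hL. field. repeat split; lra.
  - rewrite hE, hG. field. repeat split; lra.
Qed.

Lemma profile_net_sub (eps zm : R) (K : R -> R) (U U' : R -> R -> Prop) (eta : R -> R -> V3) :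
  (forall x y, U' x y -> U x y) -> profile_net eps zm K U eta -> profile_net eps zm K U' eta.
Proof. intros hU hN x y k. apply hN. auto. Qed.

Lemma tilde_omega (W : R -> R) (x y : R) :
  0 < x -> 0 < y -> tilde (omega W) x y = W (x * y / 2).
Proof.
  intros hx hy. unfold tilde, omega. f_equal.
  replace (4 * (x / 2) ^ 2 * (y / 2) ^ 2) with ((x * y / 2) ^ 2) by field.
  apply sqrt_pow2. nra.
Qed.

Lemma tilde_dom_Omega (r1 x y : R) :
  0 < r1 -> tilde_dom (Omega r1) x y <-> 0 < x /\ 0 < y /\ x * y < 2 * r1.
Proof.
  intros hr. unfold tilde_dom, tilde, Omega. split.
  - intros [hx [hy [_ [_ h]]]]. split; [exact hx|]. split; [exact hy|].
    assert (0 < x * y) by nra.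
    replace (4 * (x / 2) ^ 2 * (y / 2) ^ 2) with ((x * y / 2) ^ 2) in h by field. nra.
  - intros [hx [hy h]]. assert (0 < x * y) by nra.
    split; [exact hx|]. split; [exact hy|]. split; [nra|]. split; [nra|].
    replace (4 * (x / 2) ^ 2 * (y / 2) ^ 2) with ((x * y / 2) ^ 2) by field. nra.
Qed.

(** Nonvanishing curvature is asked for in the new coordinates, where the explicit formulas provide
    it. *)
Lemma V_net_tilde (D : R -> R -> Prop) (f : R -> R -> V3) :
  (exists u v, 0 < u /\ 0 < v /\ D u v) -> V_net D f ->
  (forall x y, tilde_dom D x y -> gauss_curv (tilde f) x y <> 0) ->
  V_net (tilde_dom D) (tilde f).
Proof.
  intros hne [hi [_ [hc hg]]] hK. split; [|split; [|split]].
  - exact (immersion_tilde D f hne hi).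
  - exact hK.
  - exact (conjugate_net_tilde D f (proj2 (proj1 hi)) (proj1 (proj2 hi)) hc).
  - exact (geodesic_coordinate_lines_tilde D f hi hg).
Qed.

Lemma sin_cos_half_neq0 (t : R) : sin t <> 0 -> sin (t / 2) <> 0 /\ cos (t / 2) <> 0.
Proof.
  intros h. replace t with (2 * (t / 2)) in h by field. rewrite sin_2a in h.
  split; intros e; apply h; rewrite e; ring.
Qed.

Lemma sqr_sin_half (t : R) : sin (t / 2) ^ 2 = (1 - cos t) / 2.
Proof.
  pose proof (cos_2a_sin (t / 2)) as e. replace (2 * (t / 2)) with t in e by field. lra.
Qed.

Lemma sqr_cos_half (t : R) : cos (t / 2) ^ 2 = (1 + cos t) / 2.
Proof.
  pose proof (cos_2a_cos (t / 2)) as e. replace (2 * (t / 2)) with t in e by field. lra.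
Qed.

Theorem mainTheorem8 (k r1 : R) (W : R -> R) (psi etap etam : R -> R -> V3)
  (hk : 0 < k < PI)
  (hW : solves_W k W)
  (hr1 : first_pi W r1)
  (hpsi : Amsler_surface k r1 W psi)
  (hVp : V_net (Omega r1) etap)
  (hVm : V_net (Omega r1) etam)
  (hAp : alignable (Omega r1) etap)
  (hAm : alignable (Omega r1) etam)
  (hRp : rotation_field (Omega r1) etap psi)
  (hRm : rotation_field (Omega r1) etam psi)
  (hIp : forall u v a b, Omega r1 u v ->
     I_form etap u v a b =
     csc (omega W u v / 2) ^ 4 *
     (1 / u ^ 2 * a ^ 2 + 2 * (cos (omega W u v) / (u * v)) * a * b + 1 / v ^ 2 * b ^ 2))
  (hIm : forall u v a b, Omega r1 u v ->
     I_form etam u v a b =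
     sec (omega W u v / 2) ^ 4 *
     (1 / u ^ 2 * a ^ 2 - 2 * (cos (omega W u v) / (u * v)) * a * b + 1 / v ^ 2 * b ^ 2))
  (hIIp : forall u v a b, Omega r1 u v ->
     II_form etap u v a b =
     2 * cot (omega W u v / 2) * (1 / u * a ^ 2 + 1 / v * b ^ 2))
  (hIIm : forall u v a b, Omega r1 u v ->
     II_form etam u v a b =
     2 * tan (omega W u v / 2) * (1 / u * a ^ 2 - 1 / v * b ^ 2)) :
  let Omegat := tilde_dom (Omega r1) in
  let omegat := tilde (omega W) in
  let etapt := tilde etap in
  let etamt := tilde etam in
  (forall x y a b, Omegat x y ->
     I_form etapt x y a b =
     4 * csc (omegat x y / 2) ^ 4 *
     (1 / x ^ 2 * a ^ 2 + 2 / (x * y) * cos (omegat x y) * a * b + 1 / y ^ 2 * b ^ 2) /\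
     II_form etapt x y a b = 2 * cot (omegat x y / 2) * (a ^ 2 + b ^ 2) /\
     I_form etamt x y a b =
     4 * sec (omegat x y / 2) ^ 4 *
     (1 / x ^ 2 * a ^ 2 - 2 / (x * y) * cos (omegat x y) * a * b + 1 / y ^ 2 * b ^ 2) /\
     II_form etamt x y a b = 2 * tan (omegat x y / 2) * (a ^ 2 - b ^ 2)) /\
  (forall x y, Omegat x y ->
     gauss_curv etapt x y = (x * y / 4) ^ 2 * sin (omegat x y / 2) ^ 4 /\
     gauss_curv etamt x y = - ((x * y / 4) ^ 2 * cos (omegat x y / 2) ^ 4) /\
     mean_curv etapt x y = (x ^ 2 + y ^ 2) / 16 * tan (omegat x y / 2) /\
     mean_curv etamt x y = (x ^ 2 - y ^ 2) / 16 * cot (omegat x y / 2)) /\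
  (V_net Omegat etapt /\ isothermal_conjugate Omegat etapt) /\
  (V_net Omegat etamt /\ isothermal_conjugate Omegat etamt) /\
  (~ minimal Omegat etapt /\
   ~ rotation_field_of_pseudospherical_revolution Omegat etapt) /\
  (~ minimal Omegat etamt /\
   ~ rotation_field_of_pseudospherical_revolution Omegat etamt) /\
  ~ Eisenhart_assertion.
Proof.
  intros Omegat omegat etapt etamt.
  pose proof (proj1 hr1) as hr0.
  pose proof (proj1 hVp) as ip. pose proof (proj1 hVm) as im.
  (* This is read off from the regularity of [etap] at the diagonal point [u = v = r / 2], where
     [sqrt (4 * u * v) = r]: there [E G - F ^ 2] is a multiple of [1 - cos (W r) ^ 2], whatever
     value [csc] takes. *)
  assert (hsin : forall r, 0 < r < r1 -> sin (W r) <> 0).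
  { intros r hr e.
    assert (hO : Omega r1 (r / 2) (r / 2)) by (unfold Omega; nra).
    pose proof (immersion_area _ _ _ _ ip hO) as area.
    assert (eo : omega W (r / 2) (r / 2) = W r).
    { unfold omega. f_equal. replace (4 * (r / 2) * (r / 2)) with (r ^ 2) by field.
      apply sqrt_pow2. lra. }
    set (q := csc (W r / 2) ^ 4). set (c := cos (W r)).
    destruct (first_form_coefficients etap (r / 2) (r / 2) (q * (4 / r ^ 2))
      (q * (c * (4 / r ^ 2))) (q * (4 / r ^ 2))) as [e1 [e2 e3]].
    { intros a b. rewrite (hIp _ _ a b hO), eo. fold q c. field. lra. }
    rewrite e1, e2, e3 in area.
    assert (c2 : c ^ 2 = 1).
    { pose proof (sin2_cos2 (W r)) as z. rewrite e in z. unfold Rsqr in z. fold c in z. lra. }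
    assert (z : q * (4 / r ^ 2) * (q * (4 / r ^ 2)) - (q * (c * (4 / r ^ 2))) ^ 2 =
            (q * (4 / r ^ 2)) ^ 2 * (1 - c ^ 2)) by ring.
    rewrite z, c2 in area. lra. }
  assert (hdom : forall x y, Omegat x y -> (0 < x /\ 0 < y /\ x * y < 2 * r1) /\
      omegat x y = W (x * y / 2) /\ sin (omegat x y / 2) <> 0 /\ cos (omegat x y / 2) <> 0).
  { intros x y h. pose proof (proj1 (tilde_dom_Omega r1 x y hr0) h) as [hx [hy hxy]].
    pose proof (tilde_omega W x y hx hy) as eo. fold omegat in eo.
    split; [auto|]. split; [exact eo|]. apply sin_cos_half_neq0. rewrite eo. apply hsin. nra. }
  assert (forms : forall x y a b, Omegat x y ->
     I_form etapt x y a b =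
     4 * csc (omegat x y / 2) ^ 4 *
     (1 / x ^ 2 * a ^ 2 + 2 / (x * y) * cos (omegat x y) * a * b + 1 / y ^ 2 * b ^ 2) /\
     II_form etapt x y a b = 2 * cot (omegat x y / 2) * (a ^ 2 + b ^ 2) /\
     I_form etamt x y a b =
     4 * sec (omegat x y / 2) ^ 4 *
     (1 / x ^ 2 * a ^ 2 - 2 / (x * y) * cos (omegat x y) * a * b + 1 / y ^ 2 * b ^ 2) /\
     II_form etamt x y a b = 2 * tan (omegat x y / 2) * (a ^ 2 - b ^ 2)).
  { intros x y a b h. destruct (hdom x y h) as [[hx [hy _]] _].
    pose proof (proj2 (proj2 h)) as hO. unfold tilde in hO.
    unfold etapt, etamt.
    rewrite (I_form_tilde _ _ x y a b ip h), (I_form_tilde _ _ x y a b im h),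
      (II_form_tilde _ _ x y a b ip h), (II_form_tilde _ _ x y a b im h).
    unfold omegat, tilde.
    rewrite (hIp _ _ _ _ hO), (hIm _ _ _ _ hO), (hIIp _ _ _ _ hO), (hIIm _ _ _ _ hO).
    set (o := omega W ((x / 2) ^ 2) ((y / 2) ^ 2)).
    repeat split; field; lra. }
  (* [Kp] is [cos (omega / 2) ^ 2], and [Km] is [sin (omega / 2) ^ 2] because the lines of the
     second net meet at the angle [PI - omega]. *)
  set (Kp := fun z => (1 + 1 * cos (W (z / 2))) / 2).
  set (Km := fun z => (1 + -1 * cos (W (z / 2))) / 2).
  pose proof (profile_of_W k r1 1 W hW (or_introl eq_refl) hsin) as Ap. fold Kp in Ap.
  pose proof (profile_of_W k r1 (-1) W hW (or_intror eq_refl) hsin) as Am. fold Km in Am.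
  assert (hKp : forall x y, Omegat x y -> Kp (x * y) = cos (omegat x y / 2) ^ 2 /\
      1 - Kp (x * y) = sin (omegat x y / 2) ^ 2 /\
      2 * Kp (x * y) - 1 = cos (omegat x y)).
  { intros x y h. destruct (hdom x y h) as [_ [e _]]. rewrite sqr_cos_half, sqr_sin_half, e.
    unfold Kp. repeat split; field. }
  assert (hKm : forall x y, Omegat x y -> Km (x * y) = sin (omegat x y / 2) ^ 2 /\
      1 - Km (x * y) = cos (omegat x y / 2) ^ 2 /\
      2 * Km (x * y) - 1 = - cos (omegat x y)).
  { intros x y h. destruct (hdom x y h) as [_ [e _]]. rewrite sqr_cos_half, sqr_sin_half, e.
    unfold Km. repeat split; field. }
  assert (secp : forall x y, Omegat x y -> fL etapt x y = 2 * cot (omegat x y / 2) /\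
      fM etapt x y = 0 /\ fN etapt x y = 2 * cot (omegat x y / 2)).
  { intros x y h. apply second_form_coefficients. intros a b.
    rewrite (proj1 (proj2 (forms x y a b h))). ring. }
  assert (secm : forall x y, Omegat x y -> fL etamt x y = 2 * tan (omegat x y / 2) /\
      fM etamt x y = 0 /\ fN etamt x y = - (2 * tan (omegat x y / 2))).
  { intros x y h. apply second_form_coefficients. intros a b.
    rewrite (proj2 (proj2 (proj2 (forms x y a b h)))). ring. }
  assert (netp : profile_net 1 (2 * r1) Kp Omegat etapt).
  { intros x y h. destruct (hdom x y h) as [[hx [hy hxy]] [_ [hs hc]]].
    destruct (hKp x y h) as [k1 [k2 k3]]. destruct (secp x y h) as [l1 [l2 l3]].
    destruct (first_form_coefficients etapt x y
      (4 / ((1 - Kp (x * y)) ^ 2 * x ^ 2))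
      (4 * (2 * Kp (x * y) - 1) / ((1 - Kp (x * y)) ^ 2 * (x * y)))
      (4 / ((1 - Kp (x * y)) ^ 2 * y ^ 2))) as [e1 [e2 e3]].
    { intros a b. rewrite (proj1 (forms x y a b h)), k2, k3. unfold csc.
      field. repeat split; lra. }
    split; [auto|]. split; [exact e1|]. split; [exact e2|]. split; [exact e3|].
    split; [exact l2|]. split; [rewrite l1, l3; ring|].
    rewrite l1, k2, k1. unfold cot. field. exact hs. }
  assert (netm : profile_net (-1) (2 * r1) Km Omegat etamt).
  { intros x y h. destruct (hdom x y h) as [[hx [hy hxy]] [_ [hs hc]]].
    destruct (hKm x y h) as [k1 [k2 k3]]. destruct (secm x y h) as [l1 [l2 l3]].
    destruct (first_form_coefficients etamt x y
      (4 / ((1 - Km (x * y)) ^ 2 * x ^ 2))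
      (4 * (2 * Km (x * y) - 1) / ((1 - Km (x * y)) ^ 2 * (x * y)))
      (4 / ((1 - Km (x * y)) ^ 2 * y ^ 2))) as [e1 [e2 e3]].
    { intros a b. rewrite (proj1 (proj2 (proj2 (forms x y a b h)))), k2, k3. unfold sec.
      field. repeat split; lra. }
    split; [auto|]. split; [exact e1|]. split; [exact e2|]. split; [exact e3|].
    split; [exact l2|]. split; [rewrite l1, l3; ring|].
    rewrite l1, k2, k1. unfold tan. field. exact hc. }
  assert (curv : forall x y, Omegat x y ->
     gauss_curv etapt x y = (x * y / 4) ^ 2 * sin (omegat x y / 2) ^ 4 /\
     gauss_curv etamt x y = - ((x * y / 4) ^ 2 * cos (omegat x y / 2) ^ 4) /\
     mean_curv etapt x y = (x ^ 2 + y ^ 2) / 16 * tan (omegat x y / 2) /\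
     mean_curv etamt x y = (x ^ 2 - y ^ 2) / 16 * cot (omegat x y / 2)).
  { intros x y h. destruct (hdom x y h) as [[hx [hy hxy]] [_ [hs hc]]].
    assert (hz : 0 < x * y < 2 * r1) by nra.
    destruct (profile_net_curvatures 1 (2 * r1) Kp Omegat etapt x y netp h
      (ap_range _ _ _ _ _ Ap _ hz)) as [g1 m1].
    destruct (profile_net_curvatures (-1) (2 * r1) Km Omegat etamt x y netm h
      (ap_range _ _ _ _ _ Am _ hz)) as [g2 m2].
    destruct (hKp x y h) as [k1 [k2 _]]. destruct (hKm x y h) as [k3 [k4 _]].
    rewrite g1, g2, m1, m2, (proj1 (secp x y h)), (proj1 (secm x y h)), k2, k4, k1, k3.
    unfold tan, cot. repeat split; field; auto. }
  assert (hne : exists u v, 0 < u /\ 0 < v /\ Omega r1 u v).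
  { exists (r1 / 4), (r1 / 4). unfold Omega. nra. }
  (* The mean curvature of [etamt] vanishes on the diagonal, so a point off it is needed. The choice
     has [x * y = r1 < 2 * r1] and [y < 1 < x]. *)
  assert (hpt : exists x y, Omegat x y /\ y < x).
  { exists (2 * (r1 + 1)), (r1 / (2 * (r1 + 1))).
    assert (hlt : r1 / (2 * (r1 + 1)) < 1).
    { apply (Rmult_lt_reg_r (2 * (r1 + 1))); [lra|]. unfold Rdiv.
      rewrite Rmult_assoc, Rinv_l; lra. }
    split; [|lra]. apply tilde_dom_Omega; [exact hr0|].
    split; [lra|]. split; [apply Rdiv_lt_0_compat; lra|].
    replace (2 * (r1 + 1) * (r1 / (2 * (r1 + 1)))) with r1 by (field; lra). lra. }
  assert (meanp : forall x y, Omegat x y -> mean_curv etapt x y <> 0).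
  { intros x y h. destruct (hdom x y h) as [[hx [hy _]] [_ [hs hc]]].
    rewrite (proj1 (proj2 (proj2 (curv x y h)))).
    apply Rmult_integral_contrapositive_currified; [nra|].
    unfold tan, Rdiv. apply Rmult_integral_contrapositive_currified; [exact hs|].
    apply Rinv_neq_0_compat. exact hc. }
  assert (Vp : V_net Omegat etapt).
  { apply V_net_tilde; [exact hne|exact hVp|]. intros x y h.
    destruct (hdom x y h) as [[hx [hy _]] [_ [hs hc]]]. fold etapt.
    rewrite (proj1 (curv x y h)). apply Rmult_integral_contrapositive_currified.
    - apply pow_nonzero. nra.
    - apply pow_nonzero. exact hs. }
  assert (Vm : V_net Omegat etamt).
  { apply V_net_tilde; [exact hne|exact hVm|]. intros x y h.
    destruct (hdom x y h) as [[hx [hy _]] [_ [hs hc]]]. fold etamt.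
    rewrite (proj1 (proj2 (curv x y h))). apply Ropp_neq_0_compat.
    apply Rmult_integral_contrapositive_currified.
    - apply pow_nonzero. nra.
    - apply pow_nonzero. exact hc. }
  assert (Cp : isothermal_conjugate Omegat etapt).
  { split; [apply Vp|]. left. intros x y h. destruct (secp x y h) as [l1 [_ l3]]. lra. }
  assert (Cm : isothermal_conjugate Omegat etamt).
  { split; [apply Vm|]. right. intros x y h. destruct (secm x y h) as [l1 [_ l3]]. lra. }
  split; [exact forms|]. split; [exact curv|]. split; [exact (conj Vp Cp)|].
  split; [exact (conj Vm Cm)|]. split; [|split].
  - split.
    + intros hmin. destruct hpt as [x [y [h _]]]. exact (meanp x y h (hmin x y h)).
    + exact (profile_net_not_revolution _ _ _ _ _ _ _ Ap (proj1 Vp) netp).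
  - split.
    + intros hmin. destruct hpt as [x [y [h hlt]]]. specialize (hmin x y h).
      destruct (hdom x y h) as [[hx [hy _]] [_ [hs hc]]].
      rewrite (proj2 (proj2 (proj2 (curv x y h)))) in hmin.
      apply Rmult_integral in hmin as [e|e]; [nra|].
      unfold cot, Rdiv in e. apply Rmult_integral in e as [e|e]; [exact (hc e)|].
      exact (Rinv_neq_0_compat _ hs e).
    + exact (profile_net_not_revolution _ _ _ _ _ _ _ Am (proj1 Vm) netm).
  (* The first net serves as counterexample: its mean curvature has no zero, so no piece of it is
     minimal. *)
  - intros E. destruct (E Omegat etapt Vp Cp) as [U [hU [hsub [hmin|hrot]]]].
    + destruct hU as [[x [y h]] _]. exact (meanp x y (hsub x y h) (hmin x y h)).
    + exact (profile_net_not_revolution _ _ _ _ _ U etapt Ap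
        (immersion_sub _ _ _ hU hsub (proj1 Vp))
        (profile_net_sub _ _ _ _ _ _ hsub netp) hrot).
Qed.
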